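(* For each of the two metamaterials (Kagome and Rotating Squares) there exists $\eta_0>0$ such that for every $\eta$ with $0<\eta<\eta_0$, every bounded Lipschitz domain $\Omega\subset\mathbb R^2$ and every $u\in H^1(\Omega;\mathbb R^2)$, the effective energy $$E_{\rm eff}^\eta(u,\Omega)=\int_\Omega\overline W^\eta(Du)\,dx$$ vanishes if and only if $u$ is (i.e. coincides almost everywhere with) a compressive conformal map on $\Omega$.
   Context: A deformation $u=(u_1,u_2):\Omega\subset\mathbb R^2\to\mathbb R^2$ is a compressive conformal map if the complex function $f(z)=u_1(x_1,x_2)+iu_2(x_1,x_2)$, $z=x_1+ix_2$, is analytic on $\Omega$ and $|f'(z)|\le1$ for all $z=x_1+ix_2$ with $(x_1,x_2)\in\Omega$ (the value $f'(z)=0$ is allowed). Kagome metamaterial. Lattice vectors $v_1=(2,0)^T$, $v_2=(1,\sqrt3)^T$. Points $O=(0,0)$, $A=(\tfrac12,\tfrac{\sqrt3}{2})$, $B=(-\tfrac12,\tfrac{\sqrt3}{2})$, $C=(-\tfrac12,-\tfrac{\sqrt3}{2})$, $D=(\tfrac12,-\tfrac{\sqrt3}{2})$, $E=(\tfrac32,-\tfrac{\sqrt3}{2})$, $F=(\tfrac32,\tfrac{\sqrt3}{2})$. The unit cell $U$ is the rectangle with vertices $B,C,E,F$; the basic set of nodes is $V=\{A,O,D\}$. The spring energy is $$E_{\rm spr}(u,U)=\sum_{(P,Q)}\big(|u(P)-u(Q)|-|P-Q|\big)^2,$$ the sum being over the six springs $AO,BO,CO,DO,AF,DE$. The penalized triangles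 are $\Delta AOB$ and $\Delta COD$. Rotating Squares metamaterial. Lattice vectors $v_1=(2,0)^T$, $v_2=(0,2)^T$. Points $A=(-1,1)$, $B=(0,1)$, $C=(1,1)$, $D=(-1,0)$, $O=(0,0)$, $E=(1,0)$, $F=(-1,-1)$, $G=(0,-1)$, $H=(1,-1)$. The unit cell $U$ is the square with vertices $A,C,H,F$; the basic set of nodes is $V=\{O,A,B,D\}$. The spring energy is $$E_{\rm spr}(u,U)=\sum_{(P,Q)}c_{PQ}\big(|u(P)-u(Q)|-|P-Q|\big)^2,$$ the sum being over the ten springs $AB,AO,AD,BC,BO,DO,EO,DF,OG,OH$, with $c_{PQ}=2$ for the diagonal springs $AO,OH$ and $c_{PQ}=1$ for the other eight. The penalized triangles are $\Delta AOB,\Delta AOD,\Delta EOH,\Delta GOH$. For both: the set of nodes is $\mathcal V=\bigcup_{\alpha_1,\alpha_2\in\mathbb Z}(V+\alpha_1v_1+\alpha_2v_2)$. A (lattice) deformation is a function $u:\mathcal V\to\mathbb R^2$. For a triangle $T$ with vertices in $\mathcal V$, $Du|_T$ is the (constant) gradient of the affine interpolant of $u$ on $T$, and $|T|$ is its area. For $\eta>0$ put $f^\eta(t)=1/\eta$ for $t\le 0$, $f^\eta(t)=0$ for $t>0$, and $$E^\eta(u,U)=E_{\rm spr}(u,U)+\sum_{T}|T|\,f^\eta(\det Du|_T),$$ the sum being over the penalized triangles. For $\alpha=\alpha_1v_1+\alpha_2v_2$ with $\alpha_1,\alpha_2\in\mathbb Z$, $E^\eta(u,U+\alpha):=E^\eta(u(\cdot+\alpha),U)$.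 Effective energy density. A lattice deformation $\psi:\mathcal V\to\mathbb R^2$ is $k$-periodic ($k\in\mathbb N$, $k\ge1$) if $\psi(x+kv_1)=\psi(x+kv_2)=\psi(x)$ for all $x\in\mathcal V$; $\mathcal A^{\#}(kU)$ denotes the set of these. For $\lambda\in\mathbb R^{2\times2}$, $\lambda x+\psi$ denotes the deformation $x\mapsto\lambda x+\psi(x)$ on $\mathcal V$. Then $$\overline W^\eta(\lambda)=\inf_{k\in\mathbb N}\ \inf_{\psi\in\mathcal A^{\#}(kU)}\ \frac1{k^2|U|}\sum_{\alpha_1,\alpha_2=0}^{k-1}E^\eta(\lambda x+\psi,\,U+\alpha_1v_1+\alpha_2v_2).$$ *)

(* Defs.v *)
From HB Require Import structures.
From mathcomp Require Import all_boot all_order all_algebra complex.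
From mathcomp Require Import all_classical all_reals all_analysis.

Set Implicit Arguments.
Unset Strict Implicit.
Unset Printing Implicit Defensive.

Import Order.TTheory GRing.Theory Num.Theory.
Import numFieldNormedType.Exports.

Local Open Scope classical_set_scope.
Local Open Scope ring_scope.

(* Points of the lattices are column vectors 'cV[R]_2 (on
   which matrices act); points of the continuum domain are pairs in R * R (on
   which the product Lebesgue measure lives). The two meet only through the
   matrix-valued function Du. *)

Section Lattice.
Variable R : realType.

Definition vec (a b : R) : 'cV[R]_2 := \col_i (if i == 0 then a else b).

Definition enorm (x : 'cV[R]_2) : R := Num.sqrt (\sum_i x i 0 ^+ 2).

Record triangle := Triangle { tri1 : 'cV[R]_2; tri2 : 'cV[R]_2; tri3 : 'cV[R]_2 }.

Record spring := Spring
  { stiffness : R; spring_end1 : 'cV[R]_2; spring_end2 : 'cV[R]_2 }.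

Record metamaterial := Metamaterial {
  latvec1 : 'cV[R]_2;
  latvec2 : 'cV[R]_2;
  basic_nodes : seq 'cV[R]_2;
  cell_area : R;
  springs : seq spring;
  penalized : seq triangle }.

Definition kagome : metamaterial :=
  let h := Num.sqrt 3 / 2 in
  let O := vec 0 0 in
  let A := vec (1 / 2) h in
  let B := vec (- (1 / 2)) h in
  let C := vec (- (1 / 2)) (- h) in
  let D := vec (1 / 2) (- h) in
  let E := vec (3 / 2) (- h) in
  let F := vec (3 / 2) h in
  {| latvec1 := vec 2 0;
     latvec2 := vec 1 (Num.sqrt 3);
     basic_nodes := [:: A; O; D];
     (* the rectangle BCEF *)
     cell_area := enorm (C - B) * enorm (E - C);
     springs := [:: Spring 1 A O; Spring 1 B O; Spring 1 C O;
                    Spring 1 D O; Spring 1 A F; Spring 1 D E];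
     penalized := [:: Triangle A O B; Triangle C O D] |}.

Definition rotating_squares : metamaterial :=
  let A := vec (-1) 1 in
  let B := vec 0 1 in
  let C := vec 1 1 in
  let D := vec (-1) 0 in
  let O := vec 0 0 in
  let E := vec 1 0 in
  let F := vec (-1) (-1) in
  let G := vec 0 (-1) in
  let H := vec 1 (-1) in
  {| latvec1 := vec 2 0;
     latvec2 := vec 0 2;
     basic_nodes := [:: O; A; B; D];
     (* the square ACHF *)
     cell_area := enorm (C - A) * enorm (H - C);
     springs := [:: Spring 1 A B; Spring 2 A O; Spring 1 A D; Spring 1 B C;
                    Spring 1 B O; Spring 1 D O; Spring 1 E O; Spring 1 D F;
                    Spring 1 O G; Spring 2 O H];
     penalized := [:: Triangle A O B; Triangle A O D;
                      Triangle E O H; Triangle G O H] |}.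

Definition lattice_shift (M : metamaterial) (a1 a2 : int) : 'cV[R]_2 :=
  a1%:~R *: latvec1 M + a2%:~R *: latvec2 M.

Definition nodes (M : metamaterial) : set 'cV[R]_2 :=
  [set x | exists p (a1 a2 : int),
     p \in basic_nodes M /\ x = p + lattice_shift M a1 a2].

(* A lattice deformation [nodes M -> R^2] is represented by any extension of it
   to all of R^2: only its values at nodes are ever constrained or used. *)
Definition deformation : Type := 'cV[R]_2 -> 'cV[R]_2.

Definition spring_energy (M : metamaterial) (u : deformation) : R :=
  \sum_(s <- springs M)
    stiffness s * (enorm (u (spring_end1 s) - u (spring_end2 s))
                   - enorm (spring_end1 s - spring_end2 s)) ^+ 2.

Definition edge_mx (w : deformation) (T : triangle) : 'M[R]_2 :=
  \matrix_(i, j) ((if j == 0 then w (tri2 T) else w (tri3 T)) - w (tri1 T)) i 0.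

(* The gradient G of the affine interpolant of u on T is determined by
   G *m (Q - P) = u Q - u P for the vertices P, Q of T. *)
Definition interp_grad (u : deformation) (T : triangle) : 'M[R]_2 :=
  edge_mx u T *m invmx (edge_mx id T).

Definition tri_area (T : triangle) : R := `|\det (edge_mx id T)| / 2.

Definition fpen (eta t : R) : R := if t <= 0 then eta^-1 else 0.

Definition cell_energy (M : metamaterial) (eta : R) (u : deformation) : R :=
  spring_energy M u +
  \sum_(T <- penalized M) tri_area T * fpen eta (\det (interp_grad u T)).

Definition shifted_cell_energy (M : metamaterial) (eta : R) (u : deformation)
    (a1 a2 : int) : R :=
  cell_energy M eta (fun x => u (x + lattice_shift M a1 a2)).

Definition periodic (M : metamaterial) (k : nat) : set deformation :=
  [set psi | forall x, nodes M x ->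
     psi (x + k%:R *: latvec1 M) = psi x /\ psi (x + k%:R *: latvec2 M) = psi x].

Definition average_energy (M : metamaterial) (eta : R) (lambda : 'M[R]_2)
    (k : nat) (psi : deformation) : R :=
  (k%:R ^+ 2 * cell_area M)^-1 *
  \sum_(a1 < k) \sum_(a2 < k)
    shifted_cell_energy M eta (fun x => lambda *m x + psi x) a1%:Z a2%:Z.

Definition Wbar (M : metamaterial) (eta : R) (lambda : 'M[R]_2) : \bar R :=
  ereal_inf
    [set ereal_inf [set (average_energy M eta lambda k psi)%:E
                   | psi in periodic M k]
    | k in [set k : nat | (1 <= k)%N]].

End Lattice.

Section Continuum.
Variable R : realType.

Definition lebesgue2 :
    {measure set (measurableTypeR R * measurableTypeR R) -> \bar R} :=
  (@lebesgue_measure R \x @lebesgue_measure R)%E.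

Definition coord (i : 'I_2) (x : R * R) : R := if i == 0 then x.1 else x.2.

Definition dir (j : 'I_2) : R * R := if j == 0 then (1, 0) else (0, 1).

Fixpoint Ck (n : nat) (phi : R * R -> R) : Prop :=
  if n is n'.+1 then
    forall j, (forall x, derivable phi x (dir j)) /\ Ck n' ('D_(dir j) phi)
  else continuous phi.

Definition test_function (Omega : set (R * R)) (phi : R * R -> R) : Prop :=
  [/\ forall n, Ck n phi,
      compact (closure [set x | phi x != 0]) &
      closure [set x | phi x != 0] `<=` Omega].

Definition L2 (Omega : set (R * R)) (f : R * R -> R) : Prop :=
  measurable_fun Omega f /\
  lebesgue2.-integrable Omega (fun x => (f x ^+ 2)%:E).

Definition weak_partial (Omega : set (R * R)) (j : 'I_2) (f g : R * R -> R) :=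
  forall phi, test_function Omega phi ->
    \int[lebesgue2]_(x in Omega) (f x * 'D_(dir j) phi x) =
    - \int[lebesgue2]_(x in Omega) (g x * phi x).

Definition L2_weak_partial (Omega : set (R * R)) (j : 'I_2) (f : R * R -> R) :
    set (R * R -> R) :=
  [set g | L2 Omega g /\ weak_partial Omega j f g].

Definition H1 (Omega : set (R * R)) (u : R * R -> R * R) : Prop :=
  forall i : 'I_2, L2 Omega (coord i \o u) /\
    forall j : 'I_2, L2_weak_partial Omega j (coord i \o u) !=set0.

(* For u in H1, a chosen representative of the weak gradient, which is unique
   up to null sets. *)
Definition weak_grad (Omega : set (R * R)) (u : R * R -> R * R) (x : R * R) :
    'M[R]_2 :=
  \matrix_(i, j) get (L2_weak_partial Omega j (coord i \o u)) x.

(* Near each boundary point, in suitable orthonormal coordinates, Omega is the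
   region strictly above the graph of a Lipschitz function. *)
Definition lipschitz_boundary (Omega : set (R * R)) : Prop :=
  forall x0, (closure Omega `\` interior Omega) x0 ->
    exists (a b : R) (g : R -> R) (L : R),
      [/\ a ^+ 2 + b ^+ 2 = 1,
          L.-lipschitz g &
          \forall x \near x0,
            Omega x <-> g (a * x.1 + b * x.2) < - b * x.1 + a * x.2].

Definition bounded_lipschitz_domain (Omega : set (R * R)) : Prop :=
  [/\ Omega !=set0, open Omega, connected Omega, bounded_set Omega &
      lipschitz_boundary Omega].

Definition complex_fun (u : R * R -> R * R) (z : R[i]^o) : R[i]^o :=
  let w := u (complex.Re z, complex.Im z) in (w.1 +i* w.2)%C.

(* The derivative is the complex one: the scalar field of [derivable] and of
   the normed module R[i]^o is R[i]. *)
Definition compressive_conformal (Omega : set (R * R)) (u : R * R -> R * R) :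
    Prop :=
  forall z : R[i]^o, Omega (complex.Re z, complex.Im z) ->
    derivable (complex_fun u) z 1 /\ `|(complex_fun u)^`()%classic z| <= 1.

Definition Eeff (M : metamaterial R) (eta : R) (Omega : set (R * R))
    (u : R * R -> R * R) : \bar R :=
  (\int[lebesgue2]_(x in Omega) Wbar M eta (weak_grad Omega u x))%E.

End Continuum.

(* Main.v *)
Require Import Defs.
From HB Require Import structures.
From mathcomp Require Import all_boot all_order all_algebra complex.
From mathcomp Require Import all_classical all_reals all_analysis.
From mathcomp Require Import measurable_realfun ring lra zify.
Import Order.TTheory GRing.Theory Num.Theory.
Import numFieldNormedType.Exports.
Set Implicit Arguments.
Unset Strict Implicit.
Unset Printing Implicit Defensive.
Local Open Scope classical_set_scope.
Local Open Scope ring_scope.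

(* For a gradient with squared conformal and anticonformal parts [c] and [q], the excess
   [q + max(0, sqrt c - 1)^2] bounds the effective energy density from below: after moving the springs
   of neighbouring cells by periodicity, every cell energy is a sum over triangles on which the
   penalty excludes an orientation reversal for small [eta], and Jensen's inequality removes the
   periodic perturbation. Conversely, a conformal matrix of norm at most [1] is the macroscopic gradient
   of a counter-rotation of rigid units, which costs nothing. So the density vanishes exactly on the
   matrices of multiplication by [a + i b] with [a^2 + b^2 <= 1].

   A function of zero effective energy is thus a weak solution of the Cauchy-Riemann equations with
   [|f'| <= 1]. Testing them with the radial fields [(z - w) b(|z - w|^2)] shows that its averages against
   [kernel t (|z - w|^2)] do not depend on [t]. These averages are smooth in [w], satisfy the classical
   Cauchy-Riemann equations, and tend to the function itself as [t] tends to [0] (weakly, by Fubini). *)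

(** * Lower bound for the effective energy density *)

(** Two obstacles shape the proof. [Wbar] is an infimum over an uncountable family and is handled
    without measurability: it enters only through the lower bound [c * conf_gap] and through its
    vanishing wherever [conf_gap] does, and its integral is compared by monotonicity for nonnegative
    functions alone. A compressive conformal map comes with a complex derivative at each point but
    no continuity of it, so integration by parts is proved for partial derivatives that merely exist
    and are bounded. For the converse, nothing is differentiated under the integral sign: the
    mollifier is expanded to second order in its centre, with a remainder uniform in the centre and
    in the point, and the expansion is integrated against the function. Because the averages do not
    depend on the radius, each point may use its own radius while nearby points share one, so a
    single function is obtained on all of the domain without shrinking it. *)

Section TriangleInequalities.
Variable R : realType.
Implicit Types (p q r s m e P l : R).

(* The tangent line at [r] of the convex function [sqrt x |-> (sqrt x - 1)^2]. *)
Lemma sqr_sub1_tangent l r : 1 <= r ->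
  (r - 1) ^+ 2 + (1 - r^-1) * (l ^+ 2 - r ^+ 2) <= (l - 1) ^+ 2.
Proof.
move=> r1; have r0 : 0 < r by exact: lt_le_trans r1.
have ri0 : 0 < r^-1 by rewrite invr_gt0.
have -> : (l - 1) ^+ 2 = (r - 1) ^+ 2 + (1 - r^-1) * (l ^+ 2 - r ^+ 2)
                         + r^-1 * (l - r) ^+ 2 by field; rewrite gt_eqF.
by rewrite lerDl mulr_ge0 ?sqr_ge0// ltW.
Qed.

(** For [r = sqrt p > 1], add the tangent inequalities at [r] for [l1] and [l2]: their linear terms
    sum to a nonnegative multiple of [l1^2 + l2^2 - 2 p]. *)
Lemma sqr_max_sub1_le p l1 l2 : 0 <= p ->
  2 * p <= l1 ^+ 2 + l2 ^+ 2 ->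
  Num.max (Num.sqrt p - 1) 0 ^+ 2 <= (l1 - 1) ^+ 2 + (l2 - 1) ^+ 2.
Proof.
move=> p0 pl; have := sqr_sqrtr p0; move: (Num.sqrt p) => r rp.
have [r1|r1] := leP r 1.
  by rewrite max_r ?subr_le0// expr0n/= addr_ge0// sqr_ge0.
rewrite max_l; last by rewrite subr_ge0 ltW.
have t1 := sqr_sub1_tangent l1 (ltW r1).
have t2 := sqr_sub1_tangent l2 (ltW r1).
have i1 : 0 <= 1 - r^-1 by rewrite subr_ge0 invf_le1 ?ltW// (lt_trans _ r1).
have : 0 <= (1 - r^-1) * (l1 ^+ 2 + l2 ^+ 2 - 2 * r ^+ 2).
  by apply: mulr_ge0 => //; rewrite subr_ge0 rp.
have := sqr_ge0 (r - 1).
by move: t1 t2; nra.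
Qed.

Lemma sqr_D1_le l : 0 <= l -> (l + 1) ^+ 2 <= 2 * l ^+ 2 + 2.
Proof. by move=> _; have := sqr_ge0 (l - 1); nra. Qed.

(** A triangle that is shrunk too much has an edge of length at most 1/2, and that edge alone costs
    1/4. *)
Lemma small_side l e : 0 <= l -> l ^+ 2 <= 4^-1 -> (l - 1) ^+ 2 <= e -> 4^-1 <= e.
Proof.
move=> l0 l4; apply: le_trans.
have : l <= 2^-1 by rewrite -(@ler_pXn2r _ 2)// ?nnegrE// exprVn; lra.
by nra.
Qed.

(* [p] and [q] are the squared conformal and anticonformal parts of a gradient, [l1], [l2], [l3] the
   lengths of the images of the three edges of the triangle. *)
Lemma equilateral_anticonf p q l1 l2 l3 P :
  0 <= p -> 0 <= q -> 0 <= l1 -> 0 <= l2 -> 0 <= l3 -> 0 <= P ->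
  3 * (p + q) = l1 ^+ 2 + l2 ^+ 2 + l3 ^+ 2 ->
  6 * (p * q) = (l1 ^+ 2 - (p + q)) ^+ 2 + (l2 ^+ 2 - (p + q)) ^+ 2
                + (l3 ^+ 2 - (p + q)) ^+ 2 ->
  (p <= q -> 2 <= P) ->
  q <= 15 * ((l1 - 1) ^+ 2 + (l2 - 1) ^+ 2 + (l3 - 1) ^+ 2 + P).
Proof.
move=> p0 q0 l10 l20 l30 P0 hm hpq hP.
set e := (l1 - 1) ^+ 2 + (l2 - 1) ^+ 2 + (l3 - 1) ^+ 2.
have x1 := sqr_ge0 (l1 - 1); have x2 := sqr_ge0 (l2 - 1).
have x3 := sqr_ge0 (l3 - 1).
have e0 : 0 <= e by rewrite /e; lra.
(* If the orientation is not preserved, the penalty pays: [(l - 2)^2 >= 0] reads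
   [l^2 <= 2 (l - 1)^2 + 2], so [q <= p + q] is at most [e + 2]. *)
have [pq|pq] := leP p q.
  have := hP pq; have := sqr_ge0 (l1 - 2); have := sqr_ge0 (l2 - 2).
  by have := sqr_ge0 (l3 - 2); rewrite /e; nra.
set m := p + q in hm hpq *.
have s1 := sqr_ge0 l1; have s2 := sqr_ge0 l2; have s3 := sqr_ge0 l3.
(* [m] is the mean of the squared edge lengths. If it is at most 1/4, so is one of them, and
   [q <= m <= 1/4 <= e]. *)
have [m4|m4] := leP m 4^-1.
  suff : 4^-1 <= e by rewrite /m in m4; lra.
  have [h|h] := leP (l1 ^+ 2) 4^-1.
    by apply: (small_side l10 h); rewrite /e; lra.
  have [h2|h2] := leP (l2 ^+ 2) 4^-1.
    by apply: (small_side l20 h2); rewrite /e; lra.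
  have h3 : l3 ^+ 2 <= 4^-1 by lra.
  by apply: (small_side l30 h3); rewrite /e; lra.
(* Square deviations from the mean [m] sum to no more than those from 1. Each of the latter is
   [(l - 1)^2 (l + 1)^2] with [(l + 1)^2 <= 2 l^2 + 2 <= 6 m + 2], while [q < p] gives
   [m q <= 2 p q]. *)
have k1 : 3 * (m * q) <= (6 * m + 2) * e.
  have : (l1 ^+ 2 - m) ^+ 2 + (l2 ^+ 2 - m) ^+ 2 + (l3 ^+ 2 - m) ^+ 2 <=
         (l1 ^+ 2 - 1) ^+ 2 + (l2 ^+ 2 - 1) ^+ 2 + (l3 ^+ 2 - 1) ^+ 2.
    rewrite -subr_ge0 [X in 0 <= X](_ : _ = 3 * (m - 1) ^+ 2); last first.
      have -> : l1 ^+ 2 = 3 * m - l2 ^+ 2 - l3 ^+ 2 by lra.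
      by ring.
    by apply: mulr_ge0; rewrite ?sqr_ge0.
  rewrite -hpq.
  have b1 : (l1 ^+ 2 - 1) ^+ 2 <= (l1 - 1) ^+ 2 * (6 * m + 2).
    rewrite (_ : l1 ^+ 2 - 1 = (l1 - 1) * (l1 + 1)); last by ring.
    by rewrite exprMn ler_wpM2l//; have := sqr_D1_le l10; lra.
  have b2 : (l2 ^+ 2 - 1) ^+ 2 <= (l2 - 1) ^+ 2 * (6 * m + 2).
    rewrite (_ : l2 ^+ 2 - 1 = (l2 - 1) * (l2 + 1)); last by ring.
    by rewrite exprMn ler_wpM2l//; have := sqr_D1_le l20; lra.
  have b3 : (l3 ^+ 2 - 1) ^+ 2 <= (l3 - 1) ^+ 2 * (6 * m + 2).
    rewrite (_ : l3 ^+ 2 - 1 = (l3 - 1) * (l3 + 1)); last by ring.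
    by rewrite exprMn ler_wpM2l//; have := sqr_D1_le l30; lra.
  have : m * q <= 2 * (p * q) by rewrite /m; nra.
  by rewrite /e; lra.
(* Since [m > 1/4], the factor [6 m + 2] is at most [14 m], and [m] cancels. *)
have k2 : m * (3 * q) <= m * (14 * e) by nra.
have m0 : 0 < m by lra.
by move: k2; rewrite ler_pM2l//; lra.
Qed.

(** The analogue for an isosceles right triangle with legs [l1], [l2] and a hypotenuse [l3] of rest
    length [sqrt 2]. The product [p q] is measured by the inequality of the legs and the defect in
    the Pythagorean relation. *)
Lemma right_anticonf p q l1 l2 l3 P :
  0 <= p -> 0 <= q -> 0 <= l1 -> 0 <= l2 -> 0 <= l3 -> 0 <= P ->
  2 * (p + q) = l1 ^+ 2 + l2 ^+ 2 -> l3 ^+ 2 <= 4 * (p + q) ->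
  16 * (p * q) = (l1 ^+ 2 - l2 ^+ 2) ^+ 2 + (l1 ^+ 2 + l2 ^+ 2 - l3 ^+ 2) ^+ 2 ->
  (p <= q -> 2 <= P) ->
  q <= 15 * ((l1 - 1) ^+ 2 + (l2 - 1) ^+ 2 + (l3 - Num.sqrt 2) ^+ 2 + P).
Proof.
move=> p0 q0 l10 l20 l30 P0 hm hl3 hpq hP.
have := @sqr_sqrtr R 2 (ler0n _ 2); have := sqrtr_ge0 (2 : R).
move: (Num.sqrt 2) => t t0 ht.
set e := (l1 - 1) ^+ 2 + (l2 - 1) ^+ 2 + (l3 - t) ^+ 2.
have x1 := sqr_ge0 (l1 - 1); have x2 := sqr_ge0 (l2 - 1).
have x3 := sqr_ge0 (l3 - t).
have e0 : 0 <= e by rewrite /e; lra.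
have [pq|pq] := leP p q.
  have := hP pq; have := sqr_ge0 (l1 - 2); have := sqr_ge0 (l2 - 2).
  by rewrite /e; nra.
set m := p + q in hm hl3 *.
have s1 := sqr_ge0 l1; have s2 := sqr_ge0 l2.
have [m4|m4] := leP m 4^-1.
  suff : 4^-1 <= e by rewrite /m in m4; lra.
  have [h|h] := leP (l1 ^+ 2) 4^-1.
    by apply: (small_side l10 h); rewrite /e; lra.
  have h2 : l2 ^+ 2 <= 4^-1 by lra.
  by apply: (small_side l20 h2); rewrite /e; lra.
have k1 : 8 * (m * q) <= 5 * ((8 * m + 4) * e).
  (* Deviations of the squared lengths from their rest values 1, 1 and 2. The expression for [p q]
     is a quadratic form in them, bounded by 5 times the sum of squares. *)
  pose y1 := (l1 - 1) * (l1 + 1); pose y2 := (l2 - 1) * (l2 + 1).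
  pose y3 := (l3 - t) * (l3 + t).
  have y1E : y1 ^+ 2 <= (l1 - 1) ^+ 2 * (8 * m + 4).
    by rewrite exprMn ler_wpM2l//; have := sqr_D1_le l10; lra.
  have y2E : y2 ^+ 2 <= (l2 - 1) ^+ 2 * (8 * m + 4).
    by rewrite exprMn ler_wpM2l//; have := sqr_D1_le l20; lra.
  have y3E : y3 ^+ 2 <= (l3 - t) ^+ 2 * (8 * m + 4).
    by rewrite exprMn ler_wpM2l//; have := sqr_ge0 (l3 - t); nra.
  have hy : 16 * (p * q) = (y1 - y2) ^+ 2 + (y1 + y2 - y3) ^+ 2.
    by rewrite hpq; congr (_ ^+ 2 + _ ^+ 2); rewrite /y1 /y2 /y3; lra.
  have : (y1 - y2) ^+ 2 + (y1 + y2 - y3) ^+ 2 <= 5 * (y1 ^+ 2 + y2 ^+ 2 + y3 ^+ 2).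
    have := sqr_ge0 (y1 + y2); have := sqr_ge0 (y1 - y2).
    by have := sqr_ge0 (y1 + y3); have := sqr_ge0 (y2 + y3); nra.
  have : m * q <= 2 * (p * q) by rewrite /m; nra.
  by rewrite /e; lra.
have k2 : m * (8 * q) <= m * (120 * e) by nra.
have m0 : 0 < m by lra.
by move: k2; rewrite ler_pM2l//; lra.
Qed.

End TriangleInequalities.

Section Gradients.
Variable R : realType.
Implicit Types (F G : 'M[R]_2) (x y : 'cV[R]_2) (T : triangle R).

Lemma ord2P (i : 'I_2) : i = 0 \/ i = 1.
Proof. by case: i => -[|[|//]] ?; [left|right]; exact/val_inj. Qed.

Lemma lift_ord2 : lift 0 0 = 1 :> 'I_2.
Proof. exact/val_inj. Qed.

Lemma det_mx22 F : \det F = F 0 0 * F 1 1 - F 0 1 * F 1 0.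
Proof.
rewrite (expand_det_row _ 0) big_ord_recl big_ord1 /cofactor !det_mx11 !mxE.
rewrite !lift_ord2 (_ : lift 1 0 = 0) 1?(_ : lift (0 : 'I_2) 0 = 1);
  do ?exact/val_inj.
by rewrite expr0 expr1 mul1r mulN1r mulrN.
Qed.

(** In complex notation [F z = alpha z + beta conj z]. This is [|beta|^2], and [conf_sqr] is
    [|alpha|^2]. *)
Definition anticonf_sqr F : R :=
  ((F 0 0 - F 1 1) ^+ 2 + (F 1 0 + F 0 1) ^+ 2) / 4.

Definition conf_sqr F : R :=
  ((F 0 0 + F 1 1) ^+ 2 + (F 1 0 - F 0 1) ^+ 2) / 4.

Definition conf_gap F : R :=
  anticonf_sqr F + Num.max (Num.sqrt (conf_sqr F) - 1) 0 ^+ 2.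

Lemma anticonf_sqr_ge0 F : 0 <= anticonf_sqr F.
Proof. by rewrite divr_ge0// addr_ge0// sqr_ge0. Qed.

Lemma conf_sqr_ge0 F : 0 <= conf_sqr F.
Proof. by rewrite divr_ge0// addr_ge0// sqr_ge0. Qed.

Lemma conf_gap_ge0 F : 0 <= conf_gap F.
Proof. by rewrite addr_ge0 ?anticonf_sqr_ge0// sqr_ge0. Qed.

Lemma det_conf F : \det F = conf_sqr F - anticonf_sqr F.
Proof. by rewrite det_mx22 /conf_sqr /anticonf_sqr; field. Qed.

Lemma enormE x : enorm x = Num.sqrt (x 0 0 ^+ 2 + x 1 0 ^+ 2).
Proof. by rewrite /enorm big_ord_recl big_ord1 lift_ord2. Qed.

Lemma enorm_ge0 x : 0 <= enorm x.
Proof. by rewrite enormE sqrtr_ge0. Qed.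

Lemma sqr_enorm x : enorm x ^+ 2 = x 0 0 ^+ 2 + x 1 0 ^+ 2.
Proof. by rewrite enormE sqr_sqrtr// addr_ge0 ?sqr_ge0. Qed.

Lemma enormN x : enorm (- x) = enorm x.
Proof. by rewrite !enormE !mxE !sqrrN. Qed.

Lemma enorm_dist x y : enorm (x - y) = enorm (y - x).
Proof. by rewrite -enormN opprB. Qed.

Lemma vec0E (a b : R) : vec a b 0 0 = a. Proof. by rewrite mxE. Qed.

Lemma vec1E (a b : R) : vec a b 1 0 = b. Proof. by rewrite mxE. Qed.

Lemma vecP x (a b : R) : x 0 0 = a -> x 1 0 = b -> x = vec a b.
Proof.
move=> xa xb; apply/matrixP => i j; rewrite ord1.
by case: (ord2P i) => ->; rewrite ?vec0E ?vec1E.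
Qed.

Lemma vecD (a b c d : R) : vec a b + vec c d = vec (a + c) (b + d).
Proof. by apply: vecP; rewrite !mxE. Qed.

Lemma vecN (a b : R) : - vec a b = vec (- a) (- b).
Proof. by apply: vecP; rewrite !mxE. Qed.

Lemma vecZ (k a b : R) : k *: vec a b = vec (k * a) (k * b).
Proof. by apply: vecP; rewrite !mxE. Qed.

Lemma enorm_vec (a b : R) : enorm (vec a b) = Num.sqrt (a ^+ 2 + b ^+ 2).
Proof. by rewrite enormE vec0E vec1E. Qed.

Lemma mulmx_vec0 F (a b : R) : (F *m vec a b) 0 0 = F 0 0 * a + F 0 1 * b.
Proof.
rewrite mxE big_ord_recl big_ord1 vec0E.
by rewrite lift_ord2 vec1E.
Qed.

Lemma mulmx_vec1 F (a b : R) : (F *m vec a b) 1 0 = F 1 0 * a + F 1 1 * b.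
Proof.
rewrite mxE big_ord_recl big_ord1 vec0E.
by rewrite lift_ord2 vec1E.
Qed.

Lemma mulmx_vec_inj F (a b c d : R) : a * d - b * c != 0 ->
  F *m vec a b = 0 -> F *m vec c d = 0 -> F = 0.
Proof.
move=> hd /matrixP ab /matrixP cd; apply/matrixP => i j.
have e0 k : F k 0 * a + F k 1 * b = 0.
  have h := ab k 0; rewrite [RHS]mxE in h; rewrite -{}h.
  by case: (ord2P k) => ->; rewrite ?mulmx_vec0 ?mulmx_vec1.
have e1 k : F k 0 * c + F k 1 * d = 0.
  have h := cd k 0; rewrite [RHS]mxE in h; rewrite -{}h.
  by case: (ord2P k) => ->; rewrite ?mulmx_vec0 ?mulmx_vec1.
rewrite mxE; apply/eqP; rewrite -(mulIr_eq0 _ (mulIf hd)); apply/eqP.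
have h0 := e0 i; have h1 := e1 i; case: (ord2P j) => ->.
  transitivity (d * (F i 0 * a + F i 1 * b) - b * (F i 0 * c + F i 1 * d)).
    by ring.
  by rewrite h0 h1 !mulr0 subrr.
transitivity (a * (F i 0 * c + F i 1 * d) - c * (F i 0 * a + F i 1 * b)).
  by ring.
by rewrite h0 h1 !mulr0 subrr.
Qed.

Lemma edge_mx_cols (w : deformation R) T :
  col 0 (edge_mx w T) = w (tri2 T) - w (tri1 T) /\
  col 1 (edge_mx w T) = w (tri3 T) - w (tri1 T).
Proof. by split; apply/matrixP => i j; rewrite !mxE/= ord1. Qed.

Lemma interp_gradP (u : deformation R) T : \det (edge_mx id T) != 0 ->
  interp_grad u T *m (tri2 T - tri1 T) = u (tri2 T) - u (tri1 T) /\
  interp_grad u T *m (tri3 T - tri1 T) = u (tri3 T) - u (tri1 T).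
Proof.
move=> dT; have uT : edge_mx id T \in unitmx by rewrite unitmxE unitfE.
have eq2 : interp_grad u T *m edge_mx id T = edge_mx u T.
  by rewrite /interp_grad -mulmxA mulVmx// mulmx1.
have [c0 c1] := edge_mx_cols u T; have [d0 d1] := edge_mx_cols id T.
split; first by rewrite -c0 -d0 !colE mulmxA eq2.
by rewrite -c1 -d1 !colE mulmxA eq2.
Qed.

Lemma interp_gradDl (F : 'M[R]_2) (psi : deformation R) T :
  \det (edge_mx id T) != 0 ->
  interp_grad (fun x => F *m x + psi x) T = F + interp_grad psi T.
Proof.
move=> dT; have uT : edge_mx id T \in unitmx by rewrite unitmxE unitfE.
apply: (can_inj (mulmxK uT)).
rewrite mulmxDl /interp_grad -!mulmxA mulVmx// !mulmx1.
have [d2 d3] := edge_mx_cols id T; have [e2 e3] := edge_mx_cols psi T.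
have [f2 f3] := edge_mx_cols (fun x => F *m x + psi x) T.
have cols (A B : 'M[R]_2) : col 0 A = col 0 B -> col 1 A = col 1 B -> A = B.
  move=> /matrixP h0 /matrixP h1; apply/matrixP => i j.
  by case: (ord2P j) => ->; [have := h0 i 0|have := h1 i 0]; rewrite !mxE.
have colM (A : 'M[R]_2) j : col j (F *m A) = F *m col j A.
  by rewrite !colE mulmxA.
by apply: cols; rewrite raddfD/= colM ?(f2, f3) ?(d2, d3) ?(e2, e3) mulmxBr;
  rewrite opprD addrACA.
Qed.

Lemma interp_grad_sum (I : Type) (r : seq I) (w : I -> deformation R) T :
  interp_grad (fun x => \sum_(i <- r) w i x) T =
  \sum_(i <- r) interp_grad (w i) T.
Proof.
rewrite /interp_grad -mulmx_suml; congr (_ *m _).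
apply/matrixP => i j; rewrite summxE [LHS]mxE.
under [RHS]eq_bigr do rewrite mxE.
by case: ifP => _; rewrite -sumrB summxE.
Qed.

(** The origin of the threshold [8^-1]: the penalized triangles have areas [sqrt 3 / 4] and [1 / 2],
    both at least 1/4, and a reversed triangle must cost 2 in the estimates of the anticonformal
    part. *)
Lemma fpen_ge2 (eta t c : R) : 0 < eta < 8^-1 -> 4^-1 <= c ->
  t <= 0 -> 2 <= c * fpen eta t.
Proof.
move=> /andP[e0 e8] c4 t0; rewrite /fpen t0.
have : 8 <= eta^-1 by rewrite -[leLHS]invrK lef_pV2 ?posrE ?invr_gt0// ltW.
by nra.
Qed.

Lemma fpen_ge0 (eta t : R) : 0 < eta -> 0 <= fpen eta t.
Proof. by move=> e0; rewrite /fpen; case: ifP => // _; rewrite invr_ge0 ltW. Qed.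

(** The anticonformal part costs the factor 15. For the conformal part, the three squared lengths
    sum to [3 (p + q) >= 3 p], so some two of them sum to at least [2 p], which is what
    [sqr_max_sub1_le] asks. *)
Lemma equilateral_energy F (eta : R) : 0 < eta < 8^-1 ->
  conf_gap F <= 30 *
    ((enorm (F *m vec (1 / 2) (Num.sqrt 3 / 2)) - 1) ^+ 2 +
     (enorm (F *m vec (- (1 / 2)) (Num.sqrt 3 / 2)) - 1) ^+ 2 +
     (enorm (F *m vec 1 0) - 1) ^+ 2 + Num.sqrt 3 / 4 * fpen eta (\det F)).
Proof.
move=> he; have /andP[e0 _] := he.
set l1 := enorm _; set l2 := enorm (F *m vec (- _) _).
set l3 := enorm (F *m vec 1 0); set P := _ * fpen _ _.
have t3 : Num.sqrt 3 ^+ 2 = 3 :> R by rewrite sqr_sqrtr.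
have P0 : 0 <= P by rewrite mulr_ge0 ?divr_ge0 ?fpen_ge0// sqrtr_ge0.
have s1 : l1 ^+ 2 = (F 0 0 / 2 + F 0 1 * (Num.sqrt 3 / 2)) ^+ 2
                    + (F 1 0 / 2 + F 1 1 * (Num.sqrt 3 / 2)) ^+ 2.
  by rewrite sqr_enorm mulmx_vec0 mulmx_vec1; field.
have s2 : l2 ^+ 2 = (- F 0 0 / 2 + F 0 1 * (Num.sqrt 3 / 2)) ^+ 2
                    + (- F 1 0 / 2 + F 1 1 * (Num.sqrt 3 / 2)) ^+ 2.
  by rewrite sqr_enorm mulmx_vec0 mulmx_vec1; field.
have s3 : l3 ^+ 2 = F 0 0 ^+ 2 + F 1 0 ^+ 2.
  by rewrite sqr_enorm mulmx_vec0 mulmx_vec1 !mulr1 !mulr0 !addr0.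
have hP : conf_sqr F <= anticonf_sqr F -> 2 <= P.
  move=> h; apply: fpen_ge2 => //; last by rewrite det_conf subr_le0.
  suff : 1 <= Num.sqrt 3 :> R by lra.
  by rewrite -{1}sqrtr1 ler_wsqrtr// ler1n.
have hm : 3 * (conf_sqr F + anticonf_sqr F) = l1 ^+ 2 + l2 ^+ 2 + l3 ^+ 2.
  by rewrite s1 s2 s3 /conf_sqr /anticonf_sqr; field: t3.
have hpq : 6 * (conf_sqr F * anticonf_sqr F) =
    (l1 ^+ 2 - (conf_sqr F + anticonf_sqr F)) ^+ 2 +
    (l2 ^+ 2 - (conf_sqr F + anticonf_sqr F)) ^+ 2 +
    (l3 ^+ 2 - (conf_sqr F + anticonf_sqr F)) ^+ 2.
  by rewrite s1 s2 s3 /conf_sqr /anticonf_sqr; field: t3.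
have q1 := equilateral_anticonf (conf_sqr_ge0 F) (anticonf_sqr_ge0 F)
  (enorm_ge0 _ : 0 <= l1) (enorm_ge0 _ : 0 <= l2) (enorm_ge0 _ : 0 <= l3) P0 hm hpq hP.
have x1 := sqr_ge0 (l1 - 1); have x2 := sqr_ge0 (l2 - 1).
have x3 := sqr_ge0 (l3 - 1).
rewrite /conf_gap; suff : Num.max (Num.sqrt (conf_sqr F) - 1) 0 ^+ 2 <=
  (l1 - 1) ^+ 2 + (l2 - 1) ^+ 2 + (l3 - 1) ^+ 2.
  by move: q1; lra.
have p0 := conf_sqr_ge0 F; have a0 := anticonf_sqr_ge0 F.
have [h|h] := leP (2 * conf_sqr F) (l1 ^+ 2 + l2 ^+ 2).
  by have := sqr_max_sub1_le p0 h; lra.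
have [h'|h'] := leP (2 * conf_sqr F) (l1 ^+ 2 + l3 ^+ 2).
  by have := sqr_max_sub1_le p0 h'; lra.
have h'' : (2 * conf_sqr F) <= (l2 ^+ 2 + l3 ^+ 2) by lra.
by have := sqr_max_sub1_le p0 h''; lra.
Qed.

(** Here the two legs already satisfy [l1^2 + l2^2 = 2 (p + q) >= 2 p]. *)
Lemma right_energy F (eta : R) : 0 < eta < 8^-1 ->
  conf_gap F <= 30 *
    ((enorm (F *m vec 1 0) - 1) ^+ 2 + (enorm (F *m vec 0 1) - 1) ^+ 2 +
     (enorm (F *m vec 1 (- 1)) - Num.sqrt 2) ^+ 2 + 1 / 2 * fpen eta (\det F)).
Proof.
move=> he; have /andP[e0 _] := he.
set l1 := enorm _; set l2 := enorm (F *m vec 0 1).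
set l3 := enorm (F *m vec 1 _); set P := _ * fpen _ _.
have P0 : 0 <= P by rewrite mulr_ge0 ?divr_ge0 ?fpen_ge0.
have s1 : l1 ^+ 2 = F 0 0 ^+ 2 + F 1 0 ^+ 2.
  by rewrite sqr_enorm mulmx_vec0 mulmx_vec1; ring.
have s2 : l2 ^+ 2 = F 0 1 ^+ 2 + F 1 1 ^+ 2.
  by rewrite sqr_enorm mulmx_vec0 mulmx_vec1; ring.
have s3 : l3 ^+ 2 = (F 0 0 - F 0 1) ^+ 2 + (F 1 0 - F 1 1) ^+ 2.
  by rewrite sqr_enorm mulmx_vec0 mulmx_vec1; ring.
have hP : conf_sqr F <= anticonf_sqr F -> 2 <= P.
  move=> h; apply: fpen_ge2 => //; last by rewrite det_conf subr_le0.
  by lra.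
have hm : 2 * (conf_sqr F + anticonf_sqr F) = l1 ^+ 2 + l2 ^+ 2.
  by rewrite s1 s2 /conf_sqr /anticonf_sqr; field.
have hl3 : l3 ^+ 2 <= 4 * (conf_sqr F + anticonf_sqr F).
  rewrite s3 /conf_sqr /anticonf_sqr.
  by have := sqr_ge0 (F 0 0 + F 0 1); have := sqr_ge0 (F 1 0 + F 1 1); nra.
have hpq : 16 * (conf_sqr F * anticonf_sqr F) =
    (l1 ^+ 2 - l2 ^+ 2) ^+ 2 + (l1 ^+ 2 + l2 ^+ 2 - l3 ^+ 2) ^+ 2.
  by rewrite s1 s2 s3 /conf_sqr /anticonf_sqr; field.
have q1 := right_anticonf (conf_sqr_ge0 F) (anticonf_sqr_ge0 F)
  (enorm_ge0 _ : 0 <= l1) (enorm_ge0 _ : 0 <= l2) (enorm_ge0 _ : 0 <= l3) P0 hm hl3 hpq hP.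
have p0 := conf_sqr_ge0 F; have a0 := anticonf_sqr_ge0 F.
have h : 2 * conf_sqr F <= l1 ^+ 2 + l2 ^+ 2 by lra.
have := sqr_max_sub1_le p0 h; have x3 := sqr_ge0 (l3 - Num.sqrt 2).
have x1 := sqr_ge0 (l1 - 1); have x2 := sqr_ge0 (l2 - 1).
by rewrite /conf_gap; move: q1; lra.
Qed.

End Gradients.

(** * Convexity of the excess and summation over the cells of a period *)

Section Averaging.
Variable R : realType.
Implicit Types (F G lambda : 'M[R]_2) (M : metamaterial R).

(** Convexity of [conf_gap] in the form of a supporting affine function at [lambda]. It is the
    tangent plane of the quadratic [anticonf_sqr] plus, when the conformal modulus [r] exceeds 1,
    the tangent at [r] of [t |-> max(t - 1, 0)^2], evaluated at the component of the conformal part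
    of [F] along that of [lambda]. *)
Lemma conf_gap_tangent lambda : exists a b c d e : R,
  (forall F, a * F 0 0 + b * F 0 1 + c * F 1 0 + d * F 1 1 + e <= conf_gap F) /\
  a * lambda 0 0 + b * lambda 0 1 + c * lambda 1 0 + d * lambda 1 1 + e =
    conf_gap lambda.
Proof.
have anti F : anticonf_sqr F = ((F 0 0 - F 1 1) / 2) ^+ 2
    + ((F 1 0 + F 0 1) / 2) ^+ 2 by rewrite /anticonf_sqr; field.
have conf F : conf_sqr F = ((F 0 0 + F 1 1) / 2) ^+ 2
    + ((F 1 0 - F 0 1) / 2) ^+ 2 by rewrite /conf_sqr; field.
pose s := (lambda 0 0 - lambda 1 1) / 2; pose t := (lambda 1 0 + lambda 0 1) / 2.
have tangent F : 2 * s * ((F 0 0 - F 1 1) / 2) + 2 * t * ((F 1 0 + F 0 1) / 2)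
    - s ^+ 2 - t ^+ 2 <= anticonf_sqr F.
  rewrite anti; have := sqr_ge0 (s - (F 0 0 - F 1 1) / 2).
  by have := sqr_ge0 (t - (F 1 0 + F 0 1) / 2); nra.
have tangentE : 2 * s * s + 2 * t * t - s ^+ 2 - t ^+ 2 = anticonf_sqr lambda.
  by rewrite anti -/s -/t; ring.
pose r := Num.sqrt (conf_sqr lambda).
have r2 : r ^+ 2 = conf_sqr lambda by rewrite sqr_sqrtr// conf_sqr_ge0.
(* The second summand of [conf_gap] vanishes at [lambda], where it is minimal: it is supported by
   0. *)
have [r1|r1] := leP r 1.
  exists s, t, t, (- s), (- s ^+ 2 - t ^+ 2); split => [F|].
    rewrite /conf_gap (le_trans _ (lerD (tangent F) (sqr_ge0 _)))//; lra.
  rewrite /conf_gap -/r max_r ?subr_le0// expr0n/= addr0 -tangentE /s /t; lra.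
(* [(x, y)] is the unit direction of the conformal part of [lambda]. By Cauchy-Schwarz the component
   in this direction is at most the modulus. *)
pose x := (lambda 0 0 + lambda 1 1) / 2 / r.
pose y := (lambda 1 0 - lambda 0 1) / 2 / r.
have r0 : 0 < r by exact: lt_trans r1.
have xy1 : x ^+ 2 + y ^+ 2 = 1.
  transitivity ((((lambda 0 0 + lambda 1 1) / 2) ^+ 2
    + ((lambda 1 0 - lambda 0 1) / 2) ^+ 2) / r ^+ 2).
    by rewrite /x /y; field; rewrite gt_eqF.
  by rewrite -conf r2 divff// -r2 sqrf_eq0 gt_eqF.
have radial F : 2 * (r - 1) * (x * ((F 0 0 + F 1 1) / 2)
    + y * ((F 1 0 - F 0 1) / 2) - 1) - (r - 1) ^+ 2 <=
    Num.max (Num.sqrt (conf_sqr F) - 1) 0 ^+ 2.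
  have cs : x * ((F 0 0 + F 1 1) / 2) + y * ((F 1 0 - F 0 1) / 2) <=
      Num.sqrt (conf_sqr F).
    rewrite conf; set p := (F 0 0 + F 1 1) / 2; set q := (F 1 0 - F 0 1) / 2.
    have pq0 : 0 <= p ^+ 2 + q ^+ 2 by rewrite addr_ge0 ?sqr_ge0.
    apply: (le_trans (ler_norm _)); rewrite -sqrtr_sqr ler_wsqrtr//.
    have -> : (x * p + y * q) ^+ 2 =
        (x ^+ 2 + y ^+ 2) * (p ^+ 2 + q ^+ 2) - (x * q - y * p) ^+ 2 by ring.
    by rewrite xy1 mul1r gerBl sqr_ge0.
  move: (Num.sqrt (conf_sqr F)) cs => z cs.
  set v := x * _ + y * _ in cs *.
  have rzv : 0 <= (r - 1) * (z - v) by rewrite mulr_ge0// subr_ge0// ltW.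
  have [z1|z1] := leP z 1.
    by rewrite max_r ?subr_le0// expr0n/=; have := sqr_ge0 (r - 1); nra.
  rewrite max_l; last by rewrite subr_ge0 ltW.
  rewrite -subr_ge0; move: v rzv cs => v rzv cs.
  have -> : (z - 1) ^+ 2 - (2 * (r - 1) * (v - 1) - (r - 1) ^+ 2) =
      (r - z) ^+ 2 + 2 * ((r - 1) * (z - v)) by ring.
  by rewrite addr_ge0 ?sqr_ge0// mulr_ge0.
have radialE : 2 * (r - 1) * (x * ((lambda 0 0 + lambda 1 1) / 2)
    + y * ((lambda 1 0 - lambda 0 1) / 2) - 1) - (r - 1) ^+ 2 =
    Num.max (Num.sqrt (conf_sqr lambda) - 1) 0 ^+ 2.
  rewrite -/r max_l; last by rewrite subr_ge0 ltW.
  have -> : x * ((lambda 0 0 + lambda 1 1) / 2)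
    + y * ((lambda 1 0 - lambda 0 1) / 2) = r.
    apply: (mulIf (lt0r_neq0 r0)); rewrite -[RHS]expr2 r2 conf /x /y.
    by field; rewrite gt_eqF.
  by ring.
exists (s + (r - 1) * x), (t - (r - 1) * y), (t + (r - 1) * y),
  (- s + (r - 1) * x), (- s ^+ 2 - t ^+ 2 - 2 * (r - 1) - (r - 1) ^+ 2).
split => [F|].
  rewrite /conf_gap (le_trans _ (lerD (tangent F) (radial F)))// le_eqVlt.
  by apply/orP; left; apply/eqP; field.
rewrite /conf_gap -radialE -tangentE.
by rewrite /s /t; move: r x y {r2 r1 r0 xy1 radial radialE} => r' x' y'; field.
Qed.

(** Sum the supporting inequality at [lambda]: the affine side depends only on the sum of the
    matrices. *)
Lemma conf_gap_jensen (I : finType) (J : Type) (S : seq J) (F : I -> J -> 'M[R]_2)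
    lambda :
  \sum_i \sum_(T <- S) F i T = (#|I| * size S)%:R *: lambda ->
  (#|I| * size S)%:R * conf_gap lambda <= \sum_i \sum_(T <- S) conf_gap (F i T).
Proof.
move=> hF; have [a [b [c [d [e [tF tl]]]]]] := conf_gap_tangent lambda.
have le : \sum_i \sum_(T <- S) (a * F i T 0 0 + b * F i T 0 1 + c * F i T 1 0
    + d * F i T 1 1 + e) <= \sum_i \sum_(T <- S) conf_gap (F i T).
  by apply: ler_sum => i _; apply: ler_sum.
apply: le_trans le; rewrite -tl.
have entry i j : \sum_i0 \sum_(T <- S) F i0 T i j =
    (#|I| * size S)%:R * lambda i j.
  move/matrixP/(_ i j): hF; rewrite !mxE summxE => <-.
  by apply: eq_bigr => k _; rewrite summxE.
have cst : \sum_(i : I) \sum_(T <- S) e = (#|I| * size S)%:R * e.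
  under eq_bigr do rewrite big_const_seq count_predT iter_addr_0.
  by rewrite sumr_const -mulrnA -[LHS]mulr_natl mulnC.
rewrite le_eqVlt; apply/orP; left; apply/eqP.
under [RHS]eq_bigr do rewrite !big_split/= -!mulr_sumr.
rewrite !big_split/= -!mulr_sumr !entry cst; ring.
Qed.

Lemma lattice_shiftD M (a b c d : int) :
  lattice_shift M (a + b) (c + d) = lattice_shift M a c + lattice_shift M b d.
Proof. by rewrite /lattice_shift !intrD !scalerDl addrACA. Qed.

Lemma nodes_shift M x a b : nodes M x -> nodes M (x + lattice_shift M a b).
Proof.
move=> [p [a1 [a2 [hp ->]]]]; exists p, (a1 + a), (a2 + b); split => //.
by rewrite lattice_shiftD -addrA.
Qed.

Lemma basic_node M p : p \in basic_nodes M -> nodes M p.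
Proof.
move=> pM; exists p, 0, 0; split => //.
by rewrite /lattice_shift !scale0r !addr0.
Qed.

(** A shift by 1 only moves the term of index 0 to the end of the period; the general shift follows
    by induction on [b] in both directions. *)
Lemma sum_int_shift (V : zmodType) (k : nat) (h : int -> V) (b : int) :
  (forall a, h (a + k%:Z) = h a) ->
  \sum_(a < k) h (a%:Z + b) = \sum_(a < k) h a%:Z.
Proof.
have step (g : int -> V) : (forall a, g (a + k%:Z) = g a) ->
    \sum_(a < k) g (a%:Z + 1) = \sum_(a < k) g a%:Z.
  case: k => [|k] hg; first by rewrite !big_ord0.
  rewrite big_ord_recr [RHS]big_ord_recl/= addrC; congr (_ + _).
    by rewrite -[in RHS](add0r 0%:Z) -(hg (0 : int)) add0r -addn1 PoszD.
  by apply: eq_bigr => i _; rewrite /bump/= add1n -addn1 PoszD.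
move=> hp; elim/int_rec: b => [|n IHn|n IHn].
- by apply: eq_bigr => i _; rewrite addr0.
- rewrite -IHn -(step (fun a => h (a + n%:Z))) => [|a]; last first.
    by rewrite addrAC hp.
  by apply: eq_bigr => i _; rewrite -addn1 PoszD addrAC addrA.
- rewrite -IHn -(step (fun a => h (a - n.+1%:Z))) => [|a]; last first.
    by rewrite addrAC hp.
  apply: eq_bigr => i _; congr h; rewrite -addn1 PoszD opprD; lra.
Qed.

Lemma sum_cells_shift (V : zmodType) (k : nat) (h : int -> int -> V) (b1 b2 : int) :
  (forall a1 a2, h (a1 + k%:Z) a2 = h a1 a2) ->
  (forall a1 a2, h a1 (a2 + k%:Z) = h a1 a2) ->
  \sum_(a1 < k) \sum_(a2 < k) h (a1%:Z + b1) (a2%:Z + b2) =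
  \sum_(a1 < k) \sum_(a2 < k) h a1%:Z a2%:Z.
Proof.
move=> h1 h2.
rewrite (sum_int_shift b1 (h := fun a => \sum_(a2 < k) h a (a2%:Z + b2))).
  by apply: eq_bigr => i _; rewrite sum_int_shift.
by move=> a; apply: eq_bigr => j _; rewrite h1.
Qed.

Variables (M : metamaterial R) (k : nat) (lambda : 'M[R]_2).
Variable psi : deformation R.
Hypothesis psiP : Defs.periodic M k psi.

Let u : deformation R := fun x => lambda *m x + psi x.
Let sh := lattice_shift M.

Lemma periodic_shift1 P a1 a2 : nodes M P ->
  psi (P + sh (a1 + k%:Z) a2) = psi (P + sh a1 a2).
Proof.
move=> nP; have := psiP (nodes_shift a1 a2 nP); move=> -[<- _].
congr psi; rewrite -[RHS]addrA; congr (P + _).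
rewrite -[a2 in LHS]addr0 /sh lattice_shiftD; congr (_ + _).
by rewrite /lattice_shift scale0r addr0.
Qed.

Lemma periodic_shift2 P a1 a2 : nodes M P ->
  psi (P + sh a1 (a2 + k%:Z)) = psi (P + sh a1 a2).
Proof.
move=> nP; have := psiP (nodes_shift a1 a2 nP); move=> -[_ <-].
congr psi; rewrite -[RHS]addrA; congr (P + _).
rewrite -[a1 in LHS]addr0 /sh lattice_shiftD; congr (_ + _).
by rewrite /lattice_shift scale0r add0r.
Qed.

(** Over a whole period, a spring may be replaced by any of its lattice translates. This trades the
    springs that are not edges of penalized triangles for translates that are. *)
Lemma sum_bond_shift (phi : 'cV[R]_2 -> R) (P Q : 'cV[R]_2) (b1 b2 : int) :
  nodes M P -> nodes M Q ->
  \sum_(a1 < k) \sum_(a2 < k)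
    phi (u (P + sh b1 b2 + sh a1%:Z a2%:Z) - u (Q + sh b1 b2 + sh a1%:Z a2%:Z)) =
  \sum_(a1 < k) \sum_(a2 < k)
    phi (u (P + sh a1%:Z a2%:Z) - u (Q + sh a1%:Z a2%:Z)).
Proof.
move=> nP nQ.
pose h (a1 a2 : int) := phi (u (P + sh a1 a2) - u (Q + sh a1 a2)).
have uE S a1 a2 : u (S + sh a1 a2) = lambda *m S + lambda *m sh a1 a2
    + psi (S + sh a1 a2) by rewrite /u mulmxDr.
(* The affine part contributes only [lambda (P - Q)], so the summand is periodic in the cell indices
   although [u] is not. *)
have hE a1 a2 : h a1 a2 = phi (lambda *m P - lambda *m Q
    + (psi (P + sh a1 a2) - psi (Q + sh a1 a2))).
  rewrite /h !uE; congr phi.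
  move: (lambda *m P) (lambda *m Q) (lambda *m sh a1 a2) => p q c.
  by rewrite opprD addrACA (opprD q c) (addrACA p c) subrr addr0.
rewrite -(@sum_cells_shift _ k h b1 b2); last 2 first.
- by move=> a1 a2; rewrite !hE !periodic_shift1.
- by move=> a1 a2; rewrite !hE !periodic_shift2.
apply: eq_bigr => a1 _; apply: eq_bigr => a2 _; rewrite /h /sh.
by rewrite ![_%:Z + _]addrC !lattice_shiftD -!addrA.
Qed.

Let Psi : deformation R := fun x =>
  \sum_(c : 'I_k * 'I_k) psi (x + sh c.1%:Z c.2%:Z).

Lemma sum_periodic P b1 b2 : nodes M P -> Psi (P + sh b1 b2) = Psi P.
Proof.
move=> nP; rewrite /Psi -(pair_bigA _ (fun i j : 'I_k =>
  psi (P + sh b1 b2 + sh i%:Z j%:Z)))/=.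
rewrite -(pair_bigA _ (fun i j : 'I_k => psi (P + sh i%:Z j%:Z)))/=.
rewrite -(@sum_cells_shift _ k (fun i j => psi (P + sh i j)) b1 b2); last 2 first.
- by move=> a1 a2; rewrite periodic_shift1.
- by move=> a1 a2; rewrite periodic_shift2.
apply: eq_bigr => a1 _; apply: eq_bigr => a2 _.
by rewrite /sh ![_%:Z + _]addrC !lattice_shiftD -!addrA.
Qed.

(* Averaging [psi] over the cells gives a [1]-periodic perturbation, whose gradients cancel
   over the penalized triangles of one cell. *)
Lemma conf_gap_le_sum_cells :
  all (fun T => \det (edge_mx id T) != 0) (penalized M) ->
  (forall w : deformation R,
     (forall P b1 b2, nodes M P -> w (P + sh b1 b2) = w P) ->
     \sum_(T <- penalized M) interp_grad w T = 0) ->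
  (k ^ 2 * size (penalized M))%:R * conf_gap lambda <=
  \sum_(a1 < k) \sum_(a2 < k) \sum_(T <- penalized M)
    conf_gap (interp_grad (fun x => u (x + sh a1%:Z a2%:Z)) T).
Proof.
move=> dM hw; rewrite (pair_bigA _ (fun i j : 'I_k => \sum_(T <- penalized M)
  conf_gap (interp_grad (fun x => u (x + sh i%:Z j%:Z)) T)))/=.
have -> : (k ^ 2)%N = #|{: 'I_k * 'I_k}| by rewrite card_prod card_ord mulnn.
apply: conf_gap_jensen.
pose v (c : 'I_k * 'I_k) : deformation R :=
  fun x => lambda *m sh c.1%:Z c.2%:Z + psi (x + sh c.1%:Z c.2%:Z).
have uE (c : 'I_k * 'I_k) : (fun x => u (x + sh c.1%:Z c.2%:Z)) = (fun x => lambda *m x + v c x).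
  by apply/funext => x; rewrite /u /v mulmxDr -addrA.
under eq_bigr do rewrite uE.
have -> : \sum_(c : 'I_k * 'I_k) \sum_(T <- penalized M)
    interp_grad (fun x => lambda *m x + v c x) T =
  \sum_(c : 'I_k * 'I_k) ((size (penalized M))%:R *: lambda +
    \sum_(T <- penalized M) interp_grad (v c) T).
  apply: eq_bigr => c _; elim: (penalized M) dM => [_|T S IHS /=].
    by rewrite !big_nil scale0r addr0.
  move=> /andP[dT dS]; rewrite !big_cons IHS// interp_gradDl//.
  by rewrite -[(size S).+1]add1n natrD scalerDl scale1r addrACA.
rewrite big_split/= sumr_const -scaler_nat scalerA -natrM.
rewrite exchange_big/=; under [X in _ + X]eq_bigr do rewrite -interp_grad_sum.
rewrite hw ?addr0// => P b1 b2 nP; rewrite /v !big_split/=; congr (_ + _).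
exact: sum_periodic.
Qed.

End Averaging.

Lemma det_edge_vec (R : realType) (a b c d e f : R) :
  \det (edge_mx id (Triangle (vec a b) (vec c d) (vec e f))) =
  (c - a) * (f - b) - (e - a) * (d - b).
Proof. by rewrite det_mx22 !mxE. Qed.

(** Used with [n = k^2] cells, [m] penalized triangles in each, [c] the cell area and [S] the total
    energy. *)
Lemma average_scaling (R : realType) (n m G S c : R) : 0 < n -> 0 < c ->
  n * m * G <= 30 * S -> (30 * c)^-1 * (m * G) <= (n * c)^-1 * S.
Proof.
move=> n0 c0 h.
rewrite (_ : (30 * c)^-1 * (m * G) = (30 * n * c)^-1 * (n * m * G)); last first.
  by field; rewrite !gt_eqF.
rewrite (_ : (n * c)^-1 * S = (30 * n * c)^-1 * (30 * S)); last first.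
  by field; rewrite !gt_eqF.
by apply: ler_wpM2l => //; rewrite invr_ge0 !mulr_ge0// ltW.
Qed.

(** [X] and [Y] are the energies of the traded springs before and after translation: equal in total,
    not cell by cell. *)
Lemma eq_sum2_replace (R : realType) k (P Q X Y : 'I_k -> 'I_k -> R) :
  \sum_a \sum_b X a b = \sum_a \sum_b Y a b ->
  (forall a b, P a b = Q a b + (X a b - Y a b)) ->
  \sum_a \sum_b P a b = \sum_a \sum_b Q a b.
Proof.
move=> XY PQ; under eq_bigr do under eq_bigr do rewrite PQ.
under eq_bigr do rewrite big_split sumrB.
by rewrite big_split sumrB /= XY subrr addr0.
Qed.

(** * The lower bound for the Kagome lattice *)

Section Kagome.
Variable R : realType.
Let h : R := Num.sqrt 3 / 2.
Let O : 'cV[R]_2 := vec 0 0.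
Let A : 'cV[R]_2 := vec (1 / 2) h.
Let B : 'cV[R]_2 := vec (- (1 / 2)) h.
Let C : 'cV[R]_2 := vec (- (1 / 2)) (- h).
Let D : 'cV[R]_2 := vec (1 / 2) (- h).
Let E : 'cV[R]_2 := vec (3 / 2) (- h).
Let F : 'cV[R]_2 := vec (3 / 2) h.
Let T1 := Triangle A O B.
Let T2 := Triangle C O D.
Implicit Types (w : deformation R).

Let bond w (P Q : 'cV[R]_2) : R := (enorm (w P - w Q) - 1) ^+ 2.

Lemma kagome_h_sqr : h ^+ 2 = 3 / 4.
Proof. by rewrite expr_div_n sqr_sqrtr//; field. Qed.

Lemma kagome_h_gt0 : 0 < h.
Proof. by rewrite divr_gt0// sqrtr_gt0. Qed.

Lemma kagome_enorm1 (a b : R) : a ^+ 2 + b ^+ 2 = 1 -> enorm (vec a b) = 1.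
Proof. by move=> ab; rewrite enorm_vec ab sqrtr1. Qed.

Lemma kagome_enorms :
  [/\ enorm (A - O) = 1, enorm (B - O) = 1 & enorm (C - O) = 1] /\
  [/\ enorm (D - O) = 1, enorm (A - F) = 1 & enorm (D - E) = 1].
Proof.
have h2 := kagome_h_sqr.
have n1 : enorm (A - O) = 1.
  by rewrite /A /O vecN vecD kagome_enorm1//; move: h2; lra.
have n2 : enorm (B - O) = 1.
  by rewrite /B /O vecN vecD kagome_enorm1//; move: h2; lra.
have n3 : enorm (C - O) = 1.
  by rewrite /C /O vecN vecD kagome_enorm1//; move: h2; lra.
have n4 : enorm (D - O) = 1.
  by rewrite /D /O vecN vecD kagome_enorm1//; move: h2; lra.
have n5 : enorm (A - F) = 1.
  by rewrite /A /F vecN vecD kagome_enorm1//; move: h2; lra.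
have n6 : enorm (D - E) = 1.
  by rewrite /D /E vecN vecD kagome_enorm1//; move: h2; lra.
by [].
Qed.

Lemma kagome_cell_energyE eta w : cell_energy (kagome R) eta w =
  bond w A O + bond w B O + bond w C O + bond w D O + bond w A F + bond w D E
  + Num.sqrt 3 / 4 * fpen eta (\det (interp_grad w T1))
  + Num.sqrt 3 / 4 * fpen eta (\det (interp_grad w T2)).
Proof.
have h0 := kagome_h_gt0.
rewrite /cell_energy /spring_energy !big_cons !big_nil/= -/h -/O -/A -/B -/C -/D -/E -/F.
have [[n1 n2 n3] [n4 n5 n6]] := kagome_enorms.
rewrite n1 n2 n3 n4 n5 n6 !mul1r !addr0 -/T1 -/T2.
have -> : tri_area T1 = Num.sqrt 3 / 4.
  rewrite /tri_area det_edge_vec (_ : _ - _ = - h); last by field.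
  by rewrite normrN gtr0_norm// /h; field.
have -> : tri_area T2 = Num.sqrt 3 / 4.
  rewrite /tri_area det_edge_vec (_ : _ - _ = - h); last by field.
  by rewrite normrN gtr0_norm// /h; field.
by rewrite /bond !addrA.
Qed.

Lemma kagome_cell_area_gt0 : 0 < cell_area (kagome R).
Proof.
rewrite /= -/h -/A -/B -/O -/C -/D -/E mulr_gt0//.
  rewrite /B /C vecN vecD enorm_vec sqrtr_gt0 ltr_wpDl ?sqr_ge0//.
  by rewrite exprn_even_gt0//= -opprD oppr_eq0 gt_eqF// addr_gt0// kagome_h_gt0.
rewrite /E /C vecN vecD enorm_vec sqrtr_gt0.
by apply: ltr_wpDr; [exact: sqr_ge0|apply: exprn_gt0; lra].
Qed.

Lemma kagome_det1 : \det (edge_mx id T1) != 0.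
Proof.
rewrite det_edge_vec (_ : _ - _ = - h); last by field.
by rewrite oppr_eq0 gt_eqF// kagome_h_gt0.
Qed.

Lemma kagome_det2 : \det (edge_mx id T2) != 0.
Proof.
rewrite det_edge_vec (_ : _ - _ = - h); last by field.
by rewrite oppr_eq0 gt_eqF// kagome_h_gt0.
Qed.

Lemma kagome_grad1 w : [/\ interp_grad w T1 *m A = w A - w O,
  interp_grad w T1 *m B = w B - w O & interp_grad w T1 *m vec 1 0 = w A - w B].
Proof.
have [/= e1 e2] := interp_gradP w kagome_det1.
have a : A = - (O - A) by rewrite /A /O !(vecN, vecD); congr vec; ring.
have b : B = (B - A) - (O - A) by rewrite /A /B /O !(vecN, vecD); congr vec; ring.
have c : vec 1 0 = - (B - A).
  by rewrite /A /B !(vecN, vecD); congr vec; field.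
split; first by rewrite {1}a mulmxN e1 opprB.
  by rewrite {1}b mulmxBr e1 e2 opprB addrA subrK.
by rewrite c mulmxN e2 opprB.
Qed.

Lemma kagome_grad2 w : [/\ interp_grad w T2 *m A = w O - w C,
  interp_grad w T2 *m B = w O - w D & interp_grad w T2 *m vec 1 0 = w D - w C].
Proof.
have [/= e1 e2] := interp_gradP w kagome_det2.
have a : A = O - C by rewrite /A /C /O !(vecN, vecD); congr vec; ring.
have b : B = (O - C) - (D - C).
  by rewrite /B /C /D /O !(vecN, vecD); congr vec; field.
have c : vec 1 0 = D - C.
  by rewrite /C /D !(vecN, vecD); congr vec; field.
split; first by rewrite {1}a.
  by rewrite {1}b mulmxBr e1 e2 opprB addrA subrK.
by rewrite c.
Qed.

Lemma kagome_nodes : [/\ nodes (kagome R) A, nodes (kagome R) O,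
  nodes (kagome R) B, nodes (kagome R) C & nodes (kagome R) D].
Proof.
have nA : nodes (kagome R) A by apply: basic_node; rewrite !inE eqxx.
have nO : nodes (kagome R) O by apply: basic_node; rewrite !inE eqxx orbT.
have nD : nodes (kagome R) D by apply: basic_node; rewrite !inE eqxx !orbT.
split => //.
  rewrite (_ : B = D + lattice_shift (kagome R) (-1) 1); first exact: nodes_shift.
  by rewrite /lattice_shift/= !(vecZ, vecD); congr vec; rewrite /h; field.
rewrite (_ : C = A + lattice_shift (kagome R) 0 (-1)); first exact: nodes_shift.
by rewrite /lattice_shift/= !(vecZ, vecD); congr vec; rewrite /h; field.
Qed.

Lemma kagome_shiftE : [/\ F = D + lattice_shift (kagome R) 0 1,
  A = C + lattice_shift (kagome R) 0 1,
  D = B + lattice_shift (kagome R) 1 (-1) &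
  E = A + lattice_shift (kagome R) 1 (-1)].
Proof.
by split; rewrite /lattice_shift/= !(vecZ, vecD); congr vec; rewrite /h; field.
Qed.

(** [AF] is a translate of [CD], and [DE] of [BA]. After the trade, the six springs are exactly the
    edges of the two penalized triangles, and [equilateral_energy] applies to each of them. *)
Lemma kagome_average_ge eta lambda k psi : 0 < eta < 8^-1 -> (0 < k)%N ->
  Defs.periodic (kagome R) k psi ->
  (30 * cell_area (kagome R))^-1 * (2 * conf_gap lambda) <=
  average_energy (kagome R) eta lambda k psi.
Proof.
move=> he k0 psiP; have [nA nO nB nC nD] := kagome_nodes.
have [sF sA sD sE] := kagome_shiftE.
rewrite /average_energy; set u := fun x => lambda *m x + psi x.
pose w (a1 a2 : nat) : deformation R :=
  fun x => u (x + lattice_shift (kagome R) a1%:Z a2%:Z).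
have AF : \sum_(a1 < k) \sum_(a2 < k) bond (w a1 a2) A F =
    \sum_(a1 < k) \sum_(a2 < k) bond (w a1 a2) C D.
  rewrite -(sum_bond_shift lambda psiP (fun z => (enorm z - 1) ^+ 2) 0 1 nC nD).
  by rewrite -sA -sF.
have DE : \sum_(a1 < k) \sum_(a2 < k) bond (w a1 a2) D E =
    \sum_(a1 < k) \sum_(a2 < k) bond (w a1 a2) B A.
  rewrite -(sum_bond_shift lambda psiP (fun z => (enorm z - 1) ^+ 2) 1 (-1) nB nA).
  by rewrite -sD -sE.
have -> : \sum_(a1 < k) \sum_(a2 < k)
    shifted_cell_energy (kagome R) eta u a1%:Z a2%:Z =
  \sum_(a1 < k) \sum_(a2 < k) (bond (w a1 a2) A O + bond (w a1 a2) B O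
   + bond (w a1 a2) C O + bond (w a1 a2) D O + bond (w a1 a2) C D
   + bond (w a1 a2) B A
   + Num.sqrt 3 / 4 * fpen eta (\det (interp_grad (w a1 a2) T1))
   + Num.sqrt 3 / 4 * fpen eta (\det (interp_grad (w a1 a2) T2))).
  apply: (eq_sum2_replace (X := fun a1 a2 => bond (w a1 a2) A F + bond (w a1 a2) D E)
    (Y := fun a1 a2 => bond (w a1 a2) C D + bond (w a1 a2) B A)).
    under eq_bigr do rewrite big_split.
    under [RHS]eq_bigr do rewrite big_split.
    by rewrite !big_split /= AF DE.
  move=> a1 a2; rewrite /shifted_cell_energy kagome_cell_energyE -/(w a1 a2).
  move: (fpen _ _) (fpen _ _) (bond _ A O) (bond _ B O) (bond _ C O) (bond _ D O) (bond _ A F)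
    (bond _ D E) (bond _ C D) (bond _ B A) (Num.sqrt 3); clear; move=> *; ring.
have cells : \sum_(a1 < k) \sum_(a2 < k) \sum_(T <- penalized (kagome R))
    conf_gap (interp_grad (w a1 a2) T) <=
  30 * \sum_(a1 < k) \sum_(a2 < k) (bond (w a1 a2) A O + bond (w a1 a2) B O
   + bond (w a1 a2) C O + bond (w a1 a2) D O + bond (w a1 a2) C D
   + bond (w a1 a2) B A
   + Num.sqrt 3 / 4 * fpen eta (\det (interp_grad (w a1 a2) T1))
   + Num.sqrt 3 / 4 * fpen eta (\det (interp_grad (w a1 a2) T2))).
  rewrite mulr_sumr; apply: ler_sum => a1 _.
  rewrite mulr_sumr; apply: ler_sum => a2 _.
  rewrite !big_cons big_nil addr0 -/h -/A -/O -/B -/C -/D -/T1 -/T2.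
  have [g1 g2 g3] := kagome_grad1 (w a1 a2).
  have [g4 g5 g6] := kagome_grad2 (w a1 a2).
  have := equilateral_energy (interp_grad (w a1 a2) T1) he.
  have := equilateral_energy (interp_grad (w a1 a2) T2) he.
  rewrite -/h -/A -/B g1 g2 g3 g4 g5 g6 /bond.
  rewrite (enorm_dist (w a1 a2 O) (w a1 a2 C)) (enorm_dist (w a1 a2 O) (w a1 a2 D)).
  rewrite (enorm_dist (w a1 a2 D) (w a1 a2 C)) (enorm_dist (w a1 a2 A) (w a1 a2 B)).
  lra.
have := @conf_gap_le_sum_cells R (kagome R) k lambda psi psiP.
rewrite -/u => /(_ _ _)/wrap[].
  by rewrite /= -/h -/A -/B -/O -/C -/D -/T1 -/T2 kagome_det1 kagome_det2.
(* For a 1-periodic [v] the two gradients cancel: on the vector [A] they sum to [v A - v C], on [B]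
   to [v B - v D], and these are pairs of equivalent nodes. *)
move=> v vP; rewrite !big_cons big_nil addr0 -/h -/A -/O -/B -/C -/D -/T1 -/T2.
  have [g1 g2 _] := kagome_grad1 v; have [g4 g5 _] := kagome_grad2 v.
  apply: (@mulmx_vec_inj _ _ (1 / 2) h (- (1 / 2)) h).
  - by rewrite (_ : _ - _ = h) ?gt_eqF ?kagome_h_gt0//; field.
  - by rewrite mulmxDl g1 g4 {1}sA vP// addrA subrK subrr.
  - by rewrite mulmxDl g2 g5 sD vP// addrA subrK subrr.
move=> /le_trans/(_ cells).
have k0' : 0 < k%:R :> R by rewrite ltr0n.
have c0 := kagome_cell_area_gt0.
by rewrite natrM natrX; apply: average_scaling; rewrite ?exprn_gt0.
Qed.
End Kagome.

(** * The lower bound for the rotating squares *)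

Section RotatingSquares.
Variable R : realType.
Let A : 'cV[R]_2 := vec (-1) 1.
Let B : 'cV[R]_2 := vec 0 1.
Let C : 'cV[R]_2 := vec 1 1.
Let D : 'cV[R]_2 := vec (-1) 0.
Let O : 'cV[R]_2 := vec 0 0.
Let E : 'cV[R]_2 := vec 1 0.
Let F : 'cV[R]_2 := vec (-1) (-1).
Let G : 'cV[R]_2 := vec 0 (-1).
Let H : 'cV[R]_2 := vec 1 (-1).
Let T1 := Triangle A O B.
Let T2 := Triangle A O D.
Let T3 := Triangle E O H.
Let T4 := Triangle G O H.
Let M := rotating_squares R.
Implicit Types (w : deformation R).

Let bond w (L : R) (P Q : 'cV[R]_2) : R := (enorm (w P - w Q) - L) ^+ 2.

Lemma squares_enorms : [/\ enorm (A - B) = 1, enorm (A - O) = Num.sqrt 2,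
  enorm (A - D) = 1 & enorm (B - C) = 1] /\ [/\ enorm (B - O) = 1,
  enorm (D - O) = 1, enorm (E - O) = 1 & enorm (D - F) = 1] /\
  enorm (O - G) = 1 /\ enorm (O - H) = Num.sqrt 2.
Proof.
have e (P Q : 'cV[R]_2) (n : R) : (P 0 0 - Q 0 0) ^+ 2 + (P 1 0 - Q 1 0) ^+ 2 = n ->
    enorm (P - Q) = Num.sqrt n by move=> <-; rewrite enormE !mxE.
have e1 (P Q : 'cV[R]_2) : (P 0 0 - Q 0 0) ^+ 2 + (P 1 0 - Q 1 0) ^+ 2 = 1 ->
    enorm (P - Q) = 1 by move=> /e ->; exact: sqrtr1.
by do ?split; (apply: e1 || apply: e); rewrite !vec0E !vec1E; ring.
Qed.

Lemma squares_cell_energyE eta w : cell_energy M eta w =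
  bond w 1 A B + 2 * bond w (Num.sqrt 2) A O + bond w 1 A D + bond w 1 B C
  + bond w 1 B O + bond w 1 D O + bond w 1 E O + bond w 1 D F + bond w 1 O G
  + 2 * bond w (Num.sqrt 2) O H
  + 1 / 2 * fpen eta (\det (interp_grad w T1))
  + 1 / 2 * fpen eta (\det (interp_grad w T2))
  + 1 / 2 * fpen eta (\det (interp_grad w T3))
  + 1 / 2 * fpen eta (\det (interp_grad w T4)).
Proof.
rewrite /cell_energy /spring_energy !big_cons !big_nil/=.
rewrite -/O -/A -/B -/C -/D -/E -/F -/G -/H -/T1 -/T2 -/T3 -/T4.
have [[-> -> -> ->] [[-> -> -> ->] [-> ->]]] := squares_enorms.
have area1 T : \det (edge_mx id T) = 1 -> tri_area T = 1 / 2 :> R.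
  by move=> dT; rewrite /tri_area dT normr1.
have areaN1 T : \det (edge_mx id T) = - 1 -> tri_area T = 1 / 2 :> R.
  by move=> dT; rewrite /tri_area dT normrN normr1.
have a1 : tri_area T1 = 1 / 2 by apply: area1; rewrite det_edge_vec; ring.
have a2 : tri_area T2 = 1 / 2 by apply: areaN1; rewrite det_edge_vec; ring.
have a3 : tri_area T3 = 1 / 2 by apply: area1; rewrite det_edge_vec; ring.
have a4 : tri_area T4 = 1 / 2 by apply: areaN1; rewrite det_edge_vec; ring.
rewrite a1 a2 a3 a4.
by rewrite !mul1r !addr0 /bond !addrA.
Qed.

Lemma squares_dets : [/\ \det (edge_mx id T1) != 0, \det (edge_mx id T2) != 0,
  \det (edge_mx id T3) != 0 & \det (edge_mx id T4) != 0].
Proof.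
have pos T : \det (edge_mx id T) = 1 -> \det (edge_mx id T) != 0 :> R.
  by move=> ->; exact: oner_neq0.
have neg T : \det (edge_mx id T) = - 1 -> \det (edge_mx id T) != 0 :> R.
  by move=> ->; rewrite oppr_eq0 oner_neq0.
by split; [apply: pos|apply: neg|apply: pos|apply: neg];
  rewrite det_edge_vec; ring.
Qed.

Lemma squares_grad1 w : [/\ interp_grad w T1 *m vec 1 0 = w B - w A,
  interp_grad w T1 *m vec 0 1 = w B - w O &
  interp_grad w T1 *m vec 1 (-1) = w O - w A].
Proof.
have [d _ _ _] := squares_dets; have [/= e1 e2] := interp_gradP w d.
have a : vec 1 0 = B - A by rewrite vecN vecD; congr vec; ring.
have b : vec 0 1 = (B - A) - (O - A) by rewrite !(vecN, vecD); congr vec; ring.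
have c : vec 1 (-1) = O - A by rewrite vecN vecD; congr vec; ring.
split; first by rewrite a.
  by rewrite b mulmxBr e1 e2 opprB addrA subrK.
by rewrite c.
Qed.

Lemma squares_grad2 w : [/\ interp_grad w T2 *m vec 1 0 = w O - w D,
  interp_grad w T2 *m vec 0 1 = w A - w D &
  interp_grad w T2 *m vec 1 (-1) = w O - w A].
Proof.
have [_ d _ _] := squares_dets; have [/= e1 e2] := interp_gradP w d.
have a : vec 1 0 = (O - A) - (D - A) by rewrite !(vecN, vecD); congr vec; ring.
have b : vec 0 1 = - (D - A) by rewrite !(vecN, vecD); congr vec; ring.
have c : vec 1 (-1) = O - A by rewrite vecN vecD; congr vec; ring.
split; first by rewrite a mulmxBr e1 e2 opprB addrA subrK.
  by rewrite b mulmxN e2 opprB.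
by rewrite c.
Qed.

Lemma squares_grad3 w : [/\ interp_grad w T3 *m vec 1 0 = w E - w O,
  interp_grad w T3 *m vec 0 1 = w E - w H &
  interp_grad w T3 *m vec 1 (-1) = w H - w O].
Proof.
have [_ _ d _] := squares_dets; have [/= e1 e2] := interp_gradP w d.
have a : vec 1 0 = - (O - E) by rewrite !(vecN, vecD); congr vec; ring.
have b : vec 0 1 = - (H - E) by rewrite !(vecN, vecD); congr vec; ring.
have c : vec 1 (-1) = (H - E) - (O - E).
  by rewrite !(vecN, vecD); congr vec; ring.
split; first by rewrite a mulmxN e1 opprB.
  by rewrite b mulmxN e2 opprB.
by rewrite c mulmxBr e1 e2 opprB addrA subrK.
Qed.

Lemma squares_grad4 w : [/\ interp_grad w T4 *m vec 1 0 = w H - w G,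
  interp_grad w T4 *m vec 0 1 = w O - w G &
  interp_grad w T4 *m vec 1 (-1) = w H - w O].
Proof.
have [_ _ _ d] := squares_dets; have [/= e1 e2] := interp_gradP w d.
have a : vec 1 0 = H - G by rewrite !(vecN, vecD); congr vec; ring.
have b : vec 0 1 = O - G by rewrite !(vecN, vecD); congr vec; ring.
have c : vec 1 (-1) = (H - G) - (O - G).
  by rewrite !(vecN, vecD); congr vec; ring.
split; first by rewrite a.
  by rewrite b.
by rewrite c mulmxBr e1 e2 opprB addrA subrK.
Qed.

Lemma squares_shiftE : [/\ E = D + lattice_shift M 1 0,
  C = A + lattice_shift M 1 0, F = A + lattice_shift M 0 (-1),
  G = B + lattice_shift M 0 (-1) & H = A + lattice_shift M 1 (-1)] /\
  H = F + lattice_shift M 1 0 /\ H = C + lattice_shift M 0 (-1).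
Proof.
by do !split; rewrite /lattice_shift/= !(vecZ, vecD); congr vec; ring.
Qed.

Lemma squares_nodes : [/\ nodes M A, nodes M B, nodes M D & nodes M O] /\
  nodes M C /\ nodes M F.
Proof.
have nO : nodes M O by apply: basic_node; rewrite !inE eqxx.
have nA : nodes M A by apply: basic_node; rewrite !inE eqxx orbT.
have nB : nodes M B by apply: basic_node; rewrite !inE eqxx !orbT.
have nD : nodes M D by apply: basic_node; rewrite !inE eqxx !orbT.
have [[_ -> -> _ _] _] := squares_shiftE.
by do !split => //; exact: nodes_shift.
Qed.

Lemma squares_cell_area_gt0 : 0 < cell_area M.
Proof.
rewrite /= -/A -/C -/H /C /A /H !vecN !vecD !enorm_vec mulr_gt0// sqrtr_gt0.
by rewrite subrr expr0n add0r exprn_even_gt0//= -opprD oppr_eq0.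
Qed.

(** [BC] is a translate of [GH], and [DF] of [EH]. After the trade, the springs are the edges of the
    four penalized triangles; each diagonal belongs to two of them, which matches its stiffness
    2. *)
Lemma squares_average_ge eta lambda k psi : 0 < eta < 8^-1 -> (0 < k)%N ->
  Defs.periodic M k psi ->
  (30 * cell_area M)^-1 * (4 * conf_gap lambda) <=
  average_energy M eta lambda k psi.
Proof.
move=> he k0 psiP; have [[nA nB nD nO] [nC nF]] := squares_nodes.
have [[sE sC sF sG sH] [sH1 sH2]] := squares_shiftE.
rewrite /average_energy; set u := fun x => lambda *m x + psi x.
pose w (a1 a2 : nat) : deformation R :=
  fun x => u (x + lattice_shift M a1%:Z a2%:Z).
have BC : \sum_(a1 < k) \sum_(a2 < k) bond (w a1 a2) 1 B C =
    \sum_(a1 < k) \sum_(a2 < k) bond (w a1 a2) 1 G H.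
  rewrite -(sum_bond_shift lambda psiP (fun z => (enorm z - 1) ^+ 2) 0 (-1) nB nC).
  by rewrite -sG -sH2.
have DF : \sum_(a1 < k) \sum_(a2 < k) bond (w a1 a2) 1 D F =
    \sum_(a1 < k) \sum_(a2 < k) bond (w a1 a2) 1 E H.
  rewrite -(sum_bond_shift lambda psiP (fun z => (enorm z - 1) ^+ 2) 1 0 nD nF).
  by rewrite -sE -sH1.
pose energy (w : deformation R) := bond w 1 A B + 2 * bond w (Num.sqrt 2) A O
  + bond w 1 A D + bond w 1 G H + bond w 1 B O + bond w 1 D O + bond w 1 E O
  + bond w 1 E H + bond w 1 O G + 2 * bond w (Num.sqrt 2) O H
  + 1 / 2 * fpen eta (\det (interp_grad w T1))
  + 1 / 2 * fpen eta (\det (interp_grad w T2))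
  + 1 / 2 * fpen eta (\det (interp_grad w T3))
  + 1 / 2 * fpen eta (\det (interp_grad w T4)).
have -> : \sum_(a1 < k) \sum_(a2 < k)
    shifted_cell_energy M eta u a1%:Z a2%:Z =
  \sum_(a1 < k) \sum_(a2 < k) energy (w a1 a2).
  apply: (eq_sum2_replace (X := fun a1 a2 => bond (w a1 a2) 1 B C + bond (w a1 a2) 1 D F)
    (Y := fun a1 a2 => bond (w a1 a2) 1 G H + bond (w a1 a2) 1 E H)).
    under eq_bigr do rewrite big_split.
    under [RHS]eq_bigr do rewrite big_split.
    by rewrite !big_split /= BC DF.
  move=> a1 a2; rewrite /shifted_cell_energy squares_cell_energyE -/(w a1 a2) /energy.
  move: (fpen _ _) (fpen _ _) (fpen _ _) (fpen _ _) (bond _ _ A B) (bond _ _ A O) (bond _ _ A D)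
    (bond _ _ B C) (bond _ _ B O) (bond _ _ D O) (bond _ _ E O) (bond _ _ D F) (bond _ _ O G)
    (bond _ _ O H) (bond _ _ G H) (bond _ _ E H); clear; move=> *; ring.
have cells : \sum_(a1 < k) \sum_(a2 < k) \sum_(T <- penalized M)
    conf_gap (interp_grad (w a1 a2) T) <=
  30 * \sum_(a1 < k) \sum_(a2 < k) energy (w a1 a2).
  rewrite mulr_sumr; apply: ler_sum => a1 _.
  rewrite mulr_sumr; apply: ler_sum => a2 _.
  rewrite !big_cons big_nil addr0 -/A -/O -/B -/D -/E -/G -/H.
  rewrite -/T1 -/T2 -/T3 -/T4 /energy; move: (w a1 a2) => v.
  have := right_energy (interp_grad v T1) he.
  have := right_energy (interp_grad v T2) he.
  have := right_energy (interp_grad v T3) he.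
  have := right_energy (interp_grad v T4) he.
  have [-> -> ->] := squares_grad1 v; have [-> -> ->] := squares_grad2 v.
  have [-> -> ->] := squares_grad3 v; have [-> -> ->] := squares_grad4 v.
  rewrite (enorm_dist (v B) (v A)) (enorm_dist (v O) (v A)).
  rewrite (enorm_dist (v O) (v D)) (enorm_dist (v H) (v G)).
  rewrite (enorm_dist (v H) (v O)) /bond; lra.
have := @conf_gap_le_sum_cells R M k lambda psi psiP.
rewrite -/u => /(_ _ _)/wrap[].
- have [d1 d2 d3 d4] := squares_dets.
  rewrite /= -/A -/B -/O -/D -/E -/G -/H -/T1 -/T2 -/T3 -/T4.
  by rewrite d1 d2 d3 d4.
(* For a 1-periodic [v] the gradients of opposite triangles cancel, since [E], [G], [H] are
   equivalent to [D], [B], [A]. *)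
- move=> v vP; rewrite !big_cons big_nil addr0 -/A -/O -/B -/D -/E -/G -/H.
  rewrite -/T1 -/T2 -/T3 -/T4.
  have [g11 g12 _] := squares_grad1 v; have [g21 g22 _] := squares_grad2 v.
  have [g31 g32 _] := squares_grad3 v; have [g41 g42 _] := squares_grad4 v.
  apply: (@mulmx_vec_inj _ _ 1 0 0 1).
  + by rewrite mulr1 mulr0 subr0 oner_eq0.
  + rewrite !mulmxDl g11 g21 g31 g41 sE sH sG !vP//.
    by rewrite (addrA (v O - v D)) [v O - v D + _]addrA subrK subrr add0r addrA subrK subrr.
  + rewrite !mulmxDl g12 g22 g32 g42 sE sH sG !vP//.
    rewrite (addrA (v A - v D)) [v A - v D + _]addrA subrK subrr add0r.
    by rewrite addrA subrK subrr.
move=> /le_trans/(_ cells).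
have k0' : 0 < k%:R :> R by rewrite ltr0n.
have c0 := squares_cell_area_gt0.
by rewrite natrM natrX; apply: average_scaling; rewrite ?exprn_gt0.
Qed.

End RotatingSquares.

(** * Mechanisms realizing compressive conformal gradients *)

Section Mechanisms.
Variable R : realType.
Implicit Types (M : metamaterial R) (lambda : 'M[R]_2).

(* The matrix of the multiplication by [a + i b]. *)
Definition conf_mx (a b : R) : 'M[R]_2 :=
  \matrix_(i, j) if i == j then a else if i == 0 then - b else b.

Lemma conf_mxD a b c d : conf_mx a b + conf_mx c d = conf_mx (a + c) (b + d).
Proof.
apply/matrixP => i j.
by case: (ord2P i) => ->; case: (ord2P j) => ->; rewrite !mxE//= opprD.
Qed.

Lemma conf_mxN a b : - conf_mx a b = conf_mx (- a) (- b).
Proof.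
by apply/matrixP => i j; case: (ord2P i) => ->; case: (ord2P j) => ->; rewrite !mxE.
Qed.

Lemma det_conf_mx a b : \det (conf_mx a b) = a ^+ 2 + b ^+ 2.
Proof. by rewrite det_mx22 !mxE/=; ring. Qed.

Lemma enorm_conf_mx a b (x : 'cV[R]_2) : a ^+ 2 + b ^+ 2 = 1 ->
  enorm (conf_mx a b *m x) = enorm x.
Proof.
move=> ab; rewrite (vecP (erefl (x 0 0)) (erefl (x 1 0))) !enormE.
rewrite mulmx_vec0 mulmx_vec1 vec0E vec1E !mxE/=; congr Num.sqrt.
transitivity ((a ^+ 2 + b ^+ 2) * (x 0 0 ^+ 2 + x 1 0 ^+ 2)); first by ring.
by rewrite ab mul1r.
Qed.

Lemma conf_gap_eq0 lambda : conf_gap lambda = 0 ->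
  exists a b, lambda = conf_mx a b /\ a ^+ 2 + b ^+ 2 <= 1.
Proof.
move=> /eqP; rewrite paddr_eq0 ?anticonf_sqr_ge0 ?sqr_ge0// => /andP[].
rewrite mulf_eq0 invr_eq0 (gt_eqF (_ : 0 < 4))// orbF.
rewrite paddr_eq0 ?sqr_ge0// !sqrf_eq0 subr_eq0 addr_eq0 => /andP[/eqP l1 /eqP l2].
rewrite maxEle; case: ifPn => [|/negPf]; last first.
  move=> + /eqP le0; rewrite le0 lexx//.
rewrite subr_le0 => le1 _; exists (lambda 0 0), (lambda 1 0); split.
  apply/matrixP => i j.
  by case: (ord2P i) => ->; case: (ord2P j) => ->; rewrite !mxE//= l2 opprK.
suff <- : conf_sqr lambda = lambda 0 0 ^+ 2 + lambda 1 0 ^+ 2.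
  by rewrite -(sqr_sqrtr (conf_sqr_ge0 lambda)) expr_le1// sqrtr_ge0.
rewrite /conf_sqr -l1 (_ : lambda 0 1 = - lambda 1 0); last by rewrite l2 opprK.
by field.
Qed.

Lemma conf_gap_conf_mx a b : a ^+ 2 + b ^+ 2 <= 1 -> conf_gap (conf_mx a b) = 0.
Proof.
move=> ab; rewrite /conf_gap /anticonf_sqr /conf_sqr !mxE/= subrr subrr.
rewrite expr0n/= addr0 mul0r add0r max_r ?expr0n// subr_le0.
rewrite (_ : _ / _ = a ^+ 2 + b ^+ 2); last by field.
by rewrite -sqrtr1 ler_wsqrtr.
Qed.

(* [c + i d] is orthogonal to [a + i b] and completes it to a unit vector, so both [(a + c) + i (b + d)]
   and [(a - c) + i (b - d)] are rotations. *)
Lemma rotation_split (a b : R) : a ^+ 2 + b ^+ 2 <= 1 ->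
  exists c d, (a + c) ^+ 2 + (b + d) ^+ 2 = 1 /\ (a - c) ^+ 2 + (b - d) ^+ 2 = 1.
Proof.
set n := a ^+ 2 + b ^+ 2 => n1.
have [n0|n0] := eqVneq n 0.
  move: n0 => /eqP; rewrite paddr_eq0 ?sqr_ge0// !sqrf_eq0 => /andP[/eqP -> /eqP ->].
  by exists 1, 0; split; ring.
have n_gt0 : 0 < n by rewrite lt_neqAle eq_sym n0 addr_ge0 ?sqr_ge0.
pose t := Num.sqrt ((1 - n) / n).
have t2 : t ^+ 2 = (1 - n) / n by rewrite sqr_sqrtr// divr_ge0 ?subr_ge0// ltW.
have key : n + t ^+ 2 * n = 1 by rewrite t2 divfK// addrC subrK.
exists (- (t * b)), (t * a); split; rewrite -[RHS]key /n; ring.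
Qed.

(** The hypothesis says that inequivalent names denote inequivalent nodes. So the basic node under a
    lattice node is unique, and the value may be read off from whichever one [xget] selects. *)
Lemma basic_nodes_extend M (c : 'cV[R]_2 -> 'cV[R]_2) :
  (forall p q a b, p \in basic_nodes M -> q \in basic_nodes M ->
     p - q = lattice_shift M a b -> p = q) ->
  exists psi : deformation R, forall p a b, p \in basic_nodes M ->
    psi (p + lattice_shift M a b) = c p.
Proof.
move=> hM.
pose P x p := p \in basic_nodes M /\ exists a b, x = p + lattice_shift M a b.
exists (fun x => c (xget 0 (P x))) => p a b pM; congr c.
have : P (p + lattice_shift M a b) p by split=> //; exists a, b.
move=> /(xgetI 0)[qM [a' [b' e]]]; set q := xget _ _ in qM e *.
apply: (hM _ _ (a - a') (b - b')) => //.
rewrite lattice_shiftD; move: (lattice_shift M a b) e => s e.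
have -> : q = p + s - lattice_shift M a' b' by rewrite e addrK.
rewrite (_ : lattice_shift M (- a') (- b') = - lattice_shift M a' b').
  by rewrite addrAC [p + _]addrC addrK.
by rewrite /lattice_shift !intrN !scaleNr opprD.
Qed.

Lemma basic_nodes_extend_periodic M (c : 'cV[R]_2 -> 'cV[R]_2) psi :
  (forall p a b, p \in basic_nodes M -> psi (p + lattice_shift M a b) = c p) ->
  Defs.periodic M 1 psi.
Proof.
move=> hpsi x [p [a [b [pM ->]]]]; rewrite hpsi//.
have e1 : 1%:R *: latvec1 M = lattice_shift M 1 0.
  by rewrite /lattice_shift scale0r addr0.
have e2 : 1%:R *: latvec2 M = lattice_shift M 0 1.
  by rewrite /lattice_shift scale0r add0r.
rewrite e1 e2; move: hpsi e1 e2 => hpsi _ _.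
by split; rewrite -[p + _ + _]addrA -lattice_shiftD hpsi.
Qed.

Lemma average_energy1 M eta lambda psi :
  cell_energy M eta (fun x => lambda *m x + psi x) = 0 ->
  average_energy M eta lambda 1 psi = 0.
Proof.
move=> e0; rewrite /average_energy !big_ord1 /shifted_cell_energy.
rewrite (_ : (fun x => _) = (fun x => lambda *m x + psi x)) ?e0 ?mulr0//.
by apply/funext => x; rewrite /lattice_shift !scale0r !addr0.
Qed.

Lemma int_double_neq1 (a : int) : 2 * a%:~R != 1 :> R.
Proof.
apply/eqP => h; have : (2 * a)%:~R = 1%:~R :> R by rewrite intrM h.
by move/intr_inj; lia.
Qed.

Lemma fpen1 (eta t : R) : t = 1 -> fpen eta t = 0.
Proof. by move=> ->; rewrite /fpen ler10. Qed.

End Mechanisms.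

Section KagomeMechanism.
Variable R : realType.
Let M := kagome R.
Let h : R := Num.sqrt 3 / 2.
Let O : 'cV[R]_2 := vec 0 0.
Let A : 'cV[R]_2 := vec (1 / 2) h.
Let B : 'cV[R]_2 := vec (- (1 / 2)) h.
Let C : 'cV[R]_2 := vec (- (1 / 2)) (- h).
Let D : 'cV[R]_2 := vec (1 / 2) (- h).
Let E : 'cV[R]_2 := vec (3 / 2) (- h).
Let F : 'cV[R]_2 := vec (3 / 2) h.

(** Every pair of distinct basic nodes would make twice an integer equal to 1, through one
    coordinate or both. *)
Lemma kagome_basic_nodes_neq p q a b : p \in basic_nodes M ->
  q \in basic_nodes M -> p - q = lattice_shift M a b -> p = q.
Proof.
have h0 : 0 < h := kagome_h_gt0 R.
have s3 : Num.sqrt 3 = 2 * h by rewrite /h; field.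
have key (x y x' y' : R) : vec x y - vec x' y' = lattice_shift M a b ->
    x - x' = a%:~R * 2 + b%:~R /\ y - y' = b%:~R * (2 * h).
  rewrite /lattice_shift/= !(vecN, vecZ, vecD) mulr1 mulr0 add0r s3.
  by move=> /matrixP e; split; [have := e 0 0|have := e 1 0]; rewrite ?vec0E ?vec1E.
rewrite !inE => /or3P[] /eqP -> /or3P[] /eqP -> //;
  rewrite -/h => /key[e1 e2]; rewrite -/h in e2; exfalso; clear key.
- move: e2; rewrite subr0 (_ : b%:~R * (2 * h) = h * (b%:~R * 2)); last by ring.
  rewrite -[LHS]mulr1 => /(mulfI (lt0r_neq0 h0)).
  by move/esym/eqP; rewrite mulrC; apply/negP/int_double_neq1.
- have b1 : b%:~R = 1 :> R by apply: (mulIf (lt0r_neq0 h0)); lra.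
  have : 2 * (- a)%:~R = 1 :> R by rewrite intrN; lra.
  by apply/eqP/int_double_neq1.
- have : 2 * (- b)%:~R = 1 :> R.
    by rewrite intrN; apply: (mulIf (lt0r_neq0 h0)); lra.
  by apply/eqP/int_double_neq1.
- have : 2 * b%:~R = 1 :> R by apply: (mulIf (lt0r_neq0 h0)); lra.
  by apply/eqP/int_double_neq1.
- have b1 : b%:~R = - 1 :> R by apply: (mulIf (lt0r_neq0 h0)); lra.
  have : 2 * a%:~R = 1 :> R by lra.
  by apply/eqP/int_double_neq1.
- have : 2 * (- b)%:~R = 1 :> R.
    by rewrite intrN; apply: (mulIf (lt0r_neq0 h0)); lra.
  by apply/eqP/int_double_neq1.
Qed.

(** The triangle [AOB] is moved by the rotation [lambda + mu] and [COD] by [lambda - mu]. The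
    perturbation [mu x] on one and [- mu x] on the other is periodic, because the equivalent nodes
    [C] and [A] are opposite, and so are [B] and [D]. *)
Lemma kagome_zero_energy eta (a b : R) : a ^+ 2 + b ^+ 2 <= 1 ->
  exists2 psi, Defs.periodic M 1 psi &
    average_energy M eta (conf_mx a b) 1 psi = 0.
Proof.
move=> /rotation_split[c [d [plus minus]]].
pose mu := conf_mx c d; pose lambda := conf_mx a b.
(* Of the basic nodes, [D] is the one in the lower triangle only; the sign makes the value at [B],
   its translate, equal to [mu B]. *)
pose disp (p : 'cV[R]_2) := if p == D then - (mu *m p) else mu *m p.
have h0 : 0 < h := kagome_h_gt0 R.
have [psi hpsi] := basic_nodes_extend disp kagome_basic_nodes_neq.
exists psi; first exact: basic_nodes_extend_periodic hpsi.
apply: average_energy1; rewrite -/lambda; set w := fun x => _.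
have OnD : O != D.
  by apply/eqP => /matrixP/(_ 0 0); rewrite !vec0E; lra.
have AnD : A != D.
  by apply/eqP => /matrixP/(_ 1 0); rewrite !vec1E -/h; move: h0; rewrite -/h; lra.
have psi0 p : p \in basic_nodes M -> psi p = disp p.
  move=> pM; rewrite -(hpsi p 0 0 pM); congr psi.
  by rewrite /lattice_shift !scale0r !addr0.
have [sF sA sD sE] := kagome_shiftE R.
have nA : A \in basic_nodes M by rewrite !inE eqxx.
have nO : O \in basic_nodes M by rewrite !inE eqxx orbT.
have nD : D \in basic_nodes M by rewrite !inE eqxx !orbT.
have pA : psi A = mu *m A by rewrite psi0// /disp (negPf AnD).
have pO : psi O = mu *m O by rewrite psi0// /disp (negPf OnD).
have pD : psi D = - (mu *m D) by rewrite psi0// /disp eqxx.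
have pF : psi F = - (mu *m D) by rewrite [F]sF hpsi// /disp eqxx.
have pE : psi E = mu *m A by rewrite [E]sE hpsi// /disp (negPf AnD).
have sB : B = D + lattice_shift M (-1) 1.
  by rewrite /lattice_shift/= !(vecZ, vecD); congr vec; rewrite /h; field.
have sC : C = A + lattice_shift M 0 (-1).
  by rewrite /lattice_shift/= !(vecZ, vecD); congr vec; rewrite /h; field.
have DB : D = - B by rewrite vecN opprK.
have CA : C = - A by rewrite vecN.
have O0 : O = 0 by apply/esym/vecP; rewrite mxE.
have pB : psi B = mu *m B by rewrite {1}sB hpsi// /disp eqxx DB mulmxN opprK.
have pC : psi C = - (mu *m C).
  by rewrite {1}sC hpsi// /disp (negPf AnD) CA mulmxN opprK.
have wO : w O = 0 by rewrite /w pO O0 !mulmx0 addr0.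
have wA : w A = (lambda + mu) *m A by rewrite /w pA mulmxDl.
have wB : w B = (lambda + mu) *m B by rewrite /w pB mulmxDl.
have wC : w C = (lambda - mu) *m C by rewrite /w pC mulmxBl.
have wD : w D = (lambda - mu) *m D by rewrite /w pD mulmxBl.
have wAF : w A - w F = (lambda - mu) *m (A - F).
  rewrite /w pA pF; have -> : D = (F - A) - A.
    by rewrite !(vecN, vecD); congr vec; field.
  by rewrite !mulmxBr !mulmxBl; apply/matrixP => i j; rewrite !mxE; ring.
have wDE : w D - w E = (lambda + mu) *m (D - E).
  rewrite /w pD pE; have -> : A = (E - D) - D.
    by rewrite !(vecN, vecD); congr vec; field.
  by rewrite !mulmxBr !mulmxDl; apply/matrixP => i j; rewrite !mxE; ring.
have lmE : lambda + mu = conf_mx (a + c) (b + d) by rewrite conf_mxD.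
have lmE' : lambda - mu = conf_mx (a - c) (b - d) by rewrite conf_mxN conf_mxD.
have isoP x : enorm ((lambda + mu) *m x) = enorm x.
  by rewrite lmE enorm_conf_mx.
have isoM x : enorm ((lambda - mu) *m x) = enorm x.
  by rewrite lmE' enorm_conf_mx.
have g1 : interp_grad w (Triangle A O B) = lambda + mu.
  have [e1 e2 _] := kagome_grad1 w; apply/eqP; rewrite -subr_eq0; apply/eqP.
  apply: (@mulmx_vec_inj _ _ (1 / 2) h (- (1 / 2)) h).
  - by rewrite (_ : _ - _ = h) ?gt_eqF//; field.
  - by rewrite mulmxBl e1 -/O wO subr0 wA subrr.
  - by rewrite mulmxBl e2 -/O wO subr0 wB subrr.
have g2 : interp_grad w (Triangle C O D) = lambda - mu.
  have [e1 e2 _] := kagome_grad2 w; apply/eqP; rewrite -subr_eq0; apply/eqP.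
  apply: (@mulmx_vec_inj _ _ (1 / 2) h (- (1 / 2)) h).
  - by rewrite (_ : _ - _ = h) ?gt_eqF//; field.
  - by rewrite mulmxBl e1 -/O wO add0r wC CA mulmxN opprK subrr.
  - by rewrite mulmxBl e2 -/O wO add0r wD DB mulmxN opprK subrr.
have [[+ + +] [+ + +]] := kagome_enorms R.
rewrite -/h -/A -/B -/C -/D -/E -/F -/O O0 !subr0 => n1 n2 n3 n4 n5 n6.
rewrite kagome_cell_energyE -/h -/A -/B -/C -/D -/E -/F -/O g1 g2.
rewrite wAF wDE wO !subr0 wA wB wC wD !isoP !isoM n1 n2 n3 n4 n5 n6.
rewrite lmE lmE' !fpen1 ?det_conf_mx//.
by rewrite subrr !expr0n/=; ring.
Qed.

End KagomeMechanism.

Section SquaresMechanism.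
Variable R : realType.
Let M := rotating_squares R.
Let A : 'cV[R]_2 := vec (-1) 1.
Let B : 'cV[R]_2 := vec 0 1.
Let C : 'cV[R]_2 := vec 1 1.
Let D : 'cV[R]_2 := vec (-1) 0.
Let O : 'cV[R]_2 := vec 0 0.
Let E : 'cV[R]_2 := vec 1 0.
Let F : 'cV[R]_2 := vec (-1) (-1).
Let G : 'cV[R]_2 := vec 0 (-1).
Let H : 'cV[R]_2 := vec 1 (-1).

Lemma squares_basic_nodes_neq p q a b : p \in basic_nodes M ->
  q \in basic_nodes M -> p - q = lattice_shift M a b -> p = q.
Proof.
have key (x y x' y' : R) : vec x y - vec x' y' = lattice_shift M a b ->
    x - x' = a%:~R * 2 /\ y - y' = b%:~R * 2.
  rewrite /lattice_shift/= !(vecN, vecZ, vecD) !mulr0 add0r addr0.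
  by move=> /matrixP e; split; [have := e 0 0|have := e 1 0]; rewrite ?vec0E ?vec1E.
have odd (t : R) (n : int) : t = 1 \/ t = - 1 -> t = n%:~R * 2 -> False.
  move=> [->|->] e; [have : 2 * n%:~R = 1 :> R by rewrite mulrC|
    have : 2 * (- n)%:~R = 1 :> R by rewrite intrN mulrN mulrC -e opprK];
  by apply/eqP/int_double_neq1.
rewrite !inE => /or4P[] /eqP -> /or4P[] /eqP -> //; move=> /key[e1 e2]; exfalso;
  solve [apply: (odd _ _ _ e1); (left; lra) || (right; lra)
        |apply: (odd _ _ _ e2); (left; lra) || (right; lra)].
Qed.

(** All four basic nodes lie on the square [ABOD], which is moved by [lambda + mu]. The square
    [OEHG] is moved by [lambda - mu]: its corners [E], [G], [H] are opposite to the equivalent nodes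
    [D], [B], [A]. *)
Lemma squares_zero_energy eta (a b : R) : a ^+ 2 + b ^+ 2 <= 1 ->
  exists2 psi, Defs.periodic M 1 psi &
    average_energy M eta (conf_mx a b) 1 psi = 0.
Proof.
move=> /rotation_split[c [d [plus minus]]].
pose mu := conf_mx c d; pose lambda := conf_mx a b.
have [psi hpsi] := basic_nodes_extend (fun p => mu *m p) squares_basic_nodes_neq.
exists psi; first exact: basic_nodes_extend_periodic hpsi.
apply: average_energy1; rewrite -/lambda; set w := fun x => _.
have psi0 p : p \in basic_nodes M -> psi p = mu *m p.
  move=> pM; rewrite -(hpsi p 0 0 pM); congr psi.
  by rewrite /lattice_shift !scale0r !addr0.
have [[sE sC sF sG sH] _] := squares_shiftE R.
have nO : O \in basic_nodes M by rewrite !inE eqxx.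
have nA : A \in basic_nodes M by rewrite !inE eqxx orbT.
have nB : B \in basic_nodes M by rewrite !inE eqxx !orbT.
have nD : D \in basic_nodes M by rewrite !inE eqxx !orbT.
have pA := psi0 _ nA; have pB := psi0 _ nB.
have pD := psi0 _ nD; have pO := psi0 _ nO.
have O0 : O = 0 by apply/esym/vecP; rewrite mxE.
have pE : psi E = - (mu *m E).
  by rewrite {1}[E]sE hpsi// -mulmxN; congr (_ *m _); rewrite vecN; congr vec; ring.
have pG : psi G = - (mu *m G).
  by rewrite {1}[G]sG hpsi// -mulmxN; congr (_ *m _); rewrite vecN; congr vec; ring.
have pH : psi H = - (mu *m H).
  by rewrite {1}[H]sH hpsi// -mulmxN; congr (_ *m _); rewrite vecN; congr vec; ring.
have pC : psi C = mu *m A by rewrite {1}[C]sC hpsi.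
have pF : psi F = mu *m A by rewrite {1}[F]sF hpsi.
have wO : w O = 0 by rewrite /w pO O0 !mulmx0 addr0.
have wA : w A = (lambda + mu) *m A by rewrite /w pA mulmxDl.
have wB : w B = (lambda + mu) *m B by rewrite /w pB mulmxDl.
have wD : w D = (lambda + mu) *m D by rewrite /w pD mulmxDl.
have wE : w E = (lambda - mu) *m E by rewrite /w pE mulmxBl.
have wG : w G = (lambda - mu) *m G by rewrite /w pG mulmxBl.
have wH : w H = (lambda - mu) *m H by rewrite /w pH mulmxBl.
have wBC : w B - w C = (lambda - mu) *m (B - C).
  rewrite /w pB pC; have -> : A = B - (C - B).
    by rewrite !(vecN, vecD); congr vec; ring.
  by rewrite !mulmxBr !mulmxBl; apply/matrixP => i j; rewrite !mxE; ring.
have wDF : w D - w F = (lambda - mu) *m (D - F).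
  rewrite /w pD pF; have -> : A = D - (F - D).
    by rewrite !(vecN, vecD); congr vec; ring.
  by rewrite !mulmxBr !mulmxBl; apply/matrixP => i j; rewrite !mxE; ring.
have lmE : lambda + mu = conf_mx (a + c) (b + d) by rewrite conf_mxD.
have lmE' : lambda - mu = conf_mx (a - c) (b - d) by rewrite conf_mxN conf_mxD.
have isoP x : enorm ((lambda + mu) *m x) = enorm x.
  by rewrite lmE enorm_conf_mx.
have isoM x : enorm ((lambda - mu) *m x) = enorm x.
  by rewrite lmE' enorm_conf_mx.
have basis (X Y : 'M[R]_2) : X *m E = Y *m E -> X *m B = Y *m B -> X = Y.
  move=> e1 e2; apply/eqP; rewrite -subr_eq0; apply/eqP.
  apply: (@mulmx_vec_inj _ _ 1 0 0 1).
  - by rewrite mulr1 mulr0 subr0 oner_eq0.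
  - by rewrite mulmxBl -/E e1 subrr.
  - by rewrite mulmxBl -/B e2 subrr.
have EA : E = B - A by rewrite !(vecN, vecD); congr vec; ring.
have BD : B = A - D by rewrite !(vecN, vecD); congr vec; ring.
have ED : E = - D by rewrite vecN; congr vec; ring.
have EH : E = H - G by rewrite !(vecN, vecD); congr vec; ring.
have BG : B = - G by rewrite vecN; congr vec; ring.
have BH : B = E - H by rewrite !(vecN, vecD); congr vec; ring.
have g1 : interp_grad w (Triangle A O B) = lambda + mu.
  have [e1 e2 _] := squares_grad1 w; apply: basis.
    by rewrite e1 -/A -/B wA wB -mulmxBr EA.
  by rewrite e2 -/B -/O wB wO subr0.
have g2 : interp_grad w (Triangle A O D) = lambda + mu.
  have [e1 e2 _] := squares_grad2 w; apply: basis.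
    by rewrite e1 -/O -/D wO wD sub0r ED mulmxN.
  by rewrite e2 -/A -/D wA wD -mulmxBr BD.
have g3 : interp_grad w (Triangle E O H) = lambda - mu.
  have [e1 e2 _] := squares_grad3 w; apply: basis.
    by rewrite e1 -/E -/O wE wO subr0.
  by rewrite e2 -/E -/H wE wH -mulmxBr BH.
have g4 : interp_grad w (Triangle G O H) = lambda - mu.
  have [e1 e2 _] := squares_grad4 w; apply: basis.
    by rewrite e1 -/G -/H wG wH -mulmxBr EH.
  by rewrite e2 -/O -/G wO wG sub0r BG mulmxN.
have [[+ + + +] [[+ + + +] [+ +]]] := squares_enorms R.
rewrite -/A -/B -/C -/D -/E -/F -/G -/H -/O O0 !(subr0, sub0r) !enormN.
move=> n1 n2 n3 n4 n5 n6 n7 n8 n9 n10.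
rewrite squares_cell_energyE -/A -/B -/C -/D -/E -/F -/G -/H -/O g1 g2 g3 g4.
rewrite wBC wDF wO !(subr0, sub0r) !enormN wE wG wH wA wB wD -!mulmxBr !isoP !isoM.
rewrite n1 n2 n3 n4 n5 n6 n7 n8 n9 n10 lmE lmE' !fpen1 ?det_conf_mx//.
by rewrite !subrr !expr0n/=; ring.
Qed.

End SquaresMechanism.

(** * The zero set of the effective density *)

Section EffectiveEnergyDensity.
Variable R : realType.
Variables (M : metamaterial R) (eta : R).
Hypothesis hM : M = kagome R \/ M = rotating_squares R.
Hypothesis heta : 0 < eta < 8^-1.

Lemma Wbar_ge_conf_gap : exists2 c : R, 0 < c &
  forall lambda, ((c * conf_gap lambda)%:E <= Wbar M eta lambda)%E.
Proof.
have lb c : (forall lambda k psi, (0 < k)%N -> Defs.periodic M k psi ->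
    c * conf_gap lambda <= average_energy M eta lambda k psi) ->
    forall lambda, ((c * conf_gap lambda)%:E <= Wbar M eta lambda)%E.
  move=> h lambda; apply: le_ereal_inf_tmp => _ [k /= k0 <-].
  by apply: le_ereal_inf_tmp => _ [psi psiP <-]; rewrite lee_fin h.
(* The factors 2 and 4 count the penalized triangles of a cell. *)
case: hM => MM; [exists ((30 * cell_area M)^-1 * 2)|exists ((30 * cell_area M)^-1 * 4)].
- by rewrite MM mulr_gt0// invr_gt0 mulr_gt0// kagome_cell_area_gt0.
- by apply: lb => lambda k psi k0; rewrite MM => psiP; rewrite -mulrA kagome_average_ge.
- by rewrite MM mulr_gt0// invr_gt0 mulr_gt0// squares_cell_area_gt0.
- by apply: lb => lambda k psi k0; rewrite MM => psiP; rewrite -mulrA squares_average_ge.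
Qed.

Lemma Wbar_ge0 lambda : (0 <= Wbar M eta lambda)%E.
Proof.
have [c c0 /(_ lambda)] := Wbar_ge_conf_gap; apply: le_trans.
by rewrite lee_fin mulr_ge0 ?conf_gap_ge0// ltW.
Qed.

Lemma Wbar_eq0 lambda : conf_gap lambda = 0 -> Wbar M eta lambda = 0%E.
Proof.
move=> /conf_gap_eq0[a [b [-> ab]]]; apply/eqP; rewrite eq_le Wbar_ge0 andbT.
have [psi psiP e0] : exists2 psi, Defs.periodic M 1 psi &
    average_energy M eta (conf_mx a b) 1 psi = 0.
  by case: hM => ->; [exact: kagome_zero_energy|exact: squares_zero_energy].
apply: ge_ereal_inf; exists (ereal_inf [set (average_energy M eta (conf_mx a b) 1 psi)%:E
  | psi in Defs.periodic M 1]); first by exists 1%N.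
by apply: ereal_inf_lbound; exists psi; rewrite ?e0.
Qed.

End EffectiveEnergyDensity.

(** * Smooth functions *)

Section DirectionallySmooth.
Context {R : realType} {V : normedModType R} {I : Type} (d : I -> V).
Implicit Types (f g : V -> R) (n : nat).

(* Unlike [Ck], every derivative below order [n] is required to be continuous; this makes the class
   visibly closed under products. *)
Fixpoint smooth_upto n f : Prop := continuous f /\
  if n is n'.+1 then
    forall i, (forall x, derivable f x (d i)) /\ smooth_upto n' ('D_(d i) f)
  else True.

Definition smooth f := forall n, smooth_upto n f.

Lemma smooth_upto_continuous n f : smooth_upto n f -> continuous f.
Proof. by case: n => [|n] []. Qed.

Lemma smooth_uptoW n f : smooth_upto n.+1 f -> smooth_upto n f.
Proof.
elim: n f => [|n IHn] f [cf hf]; split => // i.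
by have [df sf] := hf i; split => //; exact: IHn.
Qed.

Lemma smooth_continuous f : smooth f -> continuous f.
Proof. by move=> /(_ 0%N)/smooth_upto_continuous. Qed.

Lemma smooth_derivable f i x : smooth f -> derivable f x (d i).
Proof. by move=> /(_ 1%N)[_ /(_ i)[]]. Qed.

Lemma smooth_derive f i : smooth f -> smooth ('D_(d i) f).
Proof. by move=> sf n; have [_ /(_ i)[]] := sf n.+1. Qed.

Lemma smooth_upto_cst n (c : R) : smooth_upto n (cst c).
Proof.
elim: n c => [|n IHn] c; split=> //; [exact: cst_continuous|exact: cst_continuous|].
move=> i; split => [x|]; first exact: derivable_cst.
by rewrite (_ : 'D_(d i) _ = cst 0)//; apply/funext => x; rewrite derive_cst.
Qed.

Lemma smooth_uptoD n f g : smooth_upto n f -> smooth_upto n g ->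
  smooth_upto n (f \+ g).
Proof.
elim: n f g => [|n IHn] f g [cf hf] [cg hg]; (split; first by
  move=> x; apply: cvgD; [exact: cf|exact: cg]).
  by [].
move=> i; have [df sf] := hf i; have [dg sg] := hg i.
split => [x|]; first exact: derivableD.
rewrite (_ : 'D_(d i) _ = 'D_(d i) f \+ 'D_(d i) g); first exact: IHn.
by apply/funext => x; rewrite deriveD.
Qed.

Lemma smooth_uptoM n f g : smooth_upto n f -> smooth_upto n g ->
  smooth_upto n (f \* g).
Proof.
elim: n f g => [|n IHn] f g sf0 sg0; have [cf hf] := sf0; have [cg hg] := sg0;
  (split; first by move=> x; apply: cvgM; [exact: cf|exact: cg]).
  by [].
move=> i; have [df sf] := hf i; have [dg sg] := hg i.
split => [x|]; first exact: derivableM.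
rewrite (_ : 'D_(d i) _ = (f \* 'D_(d i) g) \+ (g \* 'D_(d i) f)).
  by apply: smooth_uptoD; apply: IHn => //; exact: smooth_uptoW.
by apply/funext => x; rewrite deriveM.
Qed.

Lemma smooth_uptoV n f : (forall x, f x != 0) -> smooth_upto n f ->
  smooth_upto n (fun x => (f x)^-1).
Proof.
move=> f0; elim: n => [|n IHn] sf0; have [cf hf] := sf0;
  (split; first by move=> x; apply: cvgV; [exact: f0|exact: cf]).
  by [].
move=> i; have [df sf] := hf i.
split => [x|]; first exact: derivableV.
have sV := IHn (smooth_uptoW sf0).
rewrite (_ : 'D_(d i) _ = (cst (-1) \* 'D_(d i) f) \*
  ((fun x => (f x)^-1) \* (fun x => (f x)^-1))).
  by do 2?apply: smooth_uptoM => //; exact: smooth_upto_cst.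
apply/funext => x; rewrite deriveV//= /GRing.scale/= expr2 invfM; ring.
Qed.

Lemma smoothD f g : smooth f -> smooth g -> smooth (f \+ g).
Proof. by move=> sf sg n; exact: smooth_uptoD. Qed.

Lemma smoothM f g : smooth f -> smooth g -> smooth (f \* g).
Proof. by move=> sf sg n; exact: smooth_uptoM. Qed.

Lemma smoothV f : (forall x, f x != 0) -> smooth f ->
  smooth (fun x => (f x)^-1).
Proof. by move=> f0 sf n; exact: smooth_uptoV. Qed.

Lemma smooth_cst (c : R) : smooth (cst c).
Proof. by move=> n; exact: smooth_upto_cst. Qed.

Lemma eq_smooth f g : f =1 g -> smooth f -> smooth g.
Proof. by move=> /funext ->. Qed.

End DirectionallySmooth.

(** A family with a single direction, so that functions on the line and on the plane share one
    notion of smoothness. *)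
Definition unit_dir {R : realType} (_ : unit) : R^o := 1.

Notation smooth1 := (smooth unit_dir).

Section Composition.
Context {R : realType} {V : normedModType R} {I : Type} (d : I -> V).

(** A chain rule for an inner function that is derivable in the direction [v] only: restricted to
    the line through [x], everything becomes a function of one real variable. *)
Lemma is_derive_comp_line (b : R -> R) (f : V -> R) x v :
  derivable f x v -> derivable b (f x) 1 ->
  derivable (b \o f) x v /\ 'D_v (b \o f) x = b^`()%classic (f x) * 'D_v f x.
Proof.
move=> df db; pose g (t : R) := f (t *: v + x).
have g0 : g 0 = f x by rewrite /g scale0r add0r.
have dg : derivable g 0 1 by exact: (derivable1P _ _ _).1.
have db' : derivable b (g 0) 1 by rewrite g0.
have lineE (h : V -> R) : 'D_v h x = (fun t : R => h (t *: v + x))^`()%classic 0.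
  rewrite derive1E /derive; set k1 := fun t => t^-1 *: _; set k2 := fun t => t^-1 *: _.
  suff -> : k1 = k2 by [].
  by apply/funext => t; rewrite /k1 /k2/= addr0 scale0r add0r [_%:A]mulr1.
split.
  apply: (derivable1P _ _ _).2; apply/derivable1_diffP.
  apply: (@differentiable_comp _ _ _ _ g b); first exact/derivable1_diffP.
  exact/derivable1_diffP.
by rewrite !lineE -g0 -(derive1_comp dg db').
Qed.

Lemma smooth_upto_comp n (b : R -> R) (f : V -> R) :
  smooth_upto unit_dir n b -> smooth_upto d n f ->
  smooth_upto d n (b \o f).
Proof.
elim: n b => [|n IHn] b sb0 sf0; have [cb hb] := sb0; have [cf hf] := sf0;
  (split; first by move=> x; apply: continuous_comp; [exact: cf|exact: cb]).
  by [].
move=> i; have [df sf] := hf i; have [db sb] := hb tt.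
split => [x|]; first exact: (is_derive_comp_line (df x) (db _)).1.
rewrite (_ : 'D_(d i) _ = (b^`()%classic \o f) \* 'D_(d i) f).
  apply: smooth_uptoM => //; apply: IHn; last exact: smooth_uptoW.
  by rewrite (_ : b^`()%classic = 'D_1 b)//; apply/funext => x; rewrite derive1E.
by apply/funext => x; exact: (is_derive_comp_line (df x) (db _)).2.
Qed.

Lemma smooth_comp (b : R -> R) (f : V -> R) :
  smooth1 b -> smooth d f -> smooth d (b \o f).
Proof. by move=> sb sf n; exact: smooth_upto_comp. Qed.

End Composition.



Section SmoothLine.
Variable R : realType.

Lemma smooth1_id : smooth1 (@id R).
Proof.
case=> [|n]; (split; first by move=> x; exact: cvg_id); first by [].
move=> i; split => [x|]; first exact: derivable_id.
have -> : 'D_(unit_dir i) (@id R) = cst 1 :> (R -> R).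
  by apply/funext => x; rewrite derive_id.
exact: smooth_upto_cst.
Qed.

Lemma smooth1_derive1 (f : R -> R) : smooth1 f -> smooth1 f^`()%classic.
Proof.
move=> sf; rewrite (_ : f^`()%classic = 'D_1 f); first exact: (smooth_derive tt sf).
by apply/funext => x; rewrite derive1E.
Qed.

Lemma smooth1_derivable (f : R -> R) x : smooth1 f -> derivable f x 1.
Proof. by move=> sf; exact: (@smooth_derivable _ _ _ unit_dir f tt x sf). Qed.

(* [t^-n exp(-1/t)], extended by [0] to the left. *)
Definition flat (n : nat) (t : R) : R := if 0 < t then t^-1 ^+ n * expR (- t^-1) else 0.

(** Put [s = 1/t] and [N = n + 1] in [(s / N)^N <= exp s]. This makes every [flat n] tend to 0 at
    the origin. *)
Lemma flat_le n : exists2 C : R, 0 <= C & forall t, `|flat n t| <= C * `|t|.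
Proof.
exists (n.+1%:R ^+ n.+1); first by rewrite exprn_ge0.
move=> t; rewrite /flat; case: ifPn => [t0|_]; last by rewrite normr0 mulr_ge0 ?exprn_ge0.
have ti : 0 <= t^-1 by rewrite invr_ge0 ltW.
rewrite !gtr0_norm//; last first.
  by rewrite mulr_gt0 ?expR_gt0// exprn_gt0// invr_gt0.
have n0 : 0 < n.+1%:R :> R by rewrite ltr0n.
have : (t^-1 / n.+1%:R) ^+ n.+1 <= expR t^-1.
  rewrite -[X in expR X](divfK (lt0r_neq0 n0)) expRM_natr.
  rewrite ler_pXn2r ?nnegrE ?divr_ge0 ?expR_ge0//.
  by rewrite (le_trans _ (expR_ge1Dx _))// lerDr.
rewrite expr_div_n ler_pdivrMr ?exprn_gt0// exprSr => h.
rewrite expRN ler_pdivrMr ?expR_gt0//.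
rewrite -(@ler_pM2r _ t^-1) ?invr_gt0//.
rewrite (_ : _ * t * _ * _ = expR t^-1 * n.+1%:R ^+ n.+1)//.
by field; rewrite gt_eqF.
Qed.

Lemma flat_derive (n : nat) (x : R) : is_derive x 1 (flat n) (flat n.+2 x - n%:R * flat n.+1 x).
Proof.
have [x0|x0|->] := ltgtP x 0.
- have fx k : flat k x = 0 by rewrite /flat ltNge ltW.
  rewrite !fx mulr0 subr0; apply: (@near_eq_is_derive R R^o R^o (cst 0)).
  near=> y; rewrite /flat ifN// -leNgt ltW//.
  by near: y; exact: lt_nbhsl.
- apply: (@near_eq_is_derive R R^o R^o (fun t => t^-1 ^+ n * expR (- t^-1))).
    near=> y; rewrite /flat ifT//; near: y; exact: lt_nbhsr.
  have xn0 : x != 0 by rewrite gt_eqF.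
  have dV : is_derive x 1 (fun t : R => t^-1) (- x ^- 2).
    apply: DeriveDef; first exact: derivableV.
    by rewrite deriveV// derive_id /GRing.scale/= mulr1.
  have de : is_derive x 1 (fun t : R => expR (- t^-1)) (expR (- x^-1) * x ^- 2).
    have dNV : is_derive x 1 (fun t : R => - t^-1) (x ^- 2).
      by rewrite -[x ^- 2]opprK; exact: is_deriveN.
    have dd : derivable (fun t : R => - t^-1) x 1 by [].
    have de : derivable (@expR R) (- x^-1) 1 by exact: derivable_expR.
    have [d1 d2] := is_derive_comp_line dd de.
    apply: DeriveDef; first exact: d1.
    have -> : expR (- x^-1) = expR^`()%classic (- x^-1).
      by rewrite derive1E; have /(congr1 (fun g => g (- x^-1))) := @derive_expR R.
    by rewrite [LHS]d2; congr (_ * _); exact: derive_val.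
  have dX : is_derive x 1 (fun t : R => t^-1 ^+ n)
      ((n%:R * x^-1 ^+ n.-1) *: (- x ^- 2)).
    have := @is_deriveX R R^o (fun t : R => t^-1) n x 1 _ dV.
    by rewrite exprfctE.
  have [d1 d2] := @is_deriveM R R^o _ _ x 1 _ _ dX de.
  apply: DeriveDef; [exact: d1|rewrite [LHS]d2].
  rewrite /flat x0 /GRing.scale/=.
  case: n {dX d1 d2} => [|n]/=; first by rewrite expr0 !mul0r mulr0 addr0 subr0 mul1r -exprVn mulrC.
  rewrite -!exprVn !exprS; ring.
- have f0 k : flat k 0 = 0 by rewrite /flat ltxx.
  rewrite !f0 mulr0 subr0.
  have [C C0 hC] := flat_le n.+1.
  have C1 : 0 < C + 1 by rewrite ltr_wpDl.
  have lim0 : h^-1 *: ((flat n \o shift 0) (h *: (1 : R^o)) - flat n 0) @[h --> 0^'] --> (0 : R).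
    rewrite f0; apply/cvgrPdist_le => e e0; near=> h.
    have hn0 : h != 0 by near: h; exact: nbhs_dnbhs_neq.
    rewrite /= addr0 !subr0 sub0r normrN [_%:A]mulr1.
    (* The difference quotient at 0 is again a member of the family, so [flat_le] sends it to 0. *)
    have -> : h^-1 *: flat n h = flat n.+1 h.
      rewrite /flat /GRing.scale/=; case: ifP; rewrite ?mulr0// exprS mulrA//.
    apply: (le_trans (hC h)).
    have hle : `|h| <= e / (C + 1).
      by near: h; apply: dnbhs0_le; exact: divr_gt0.
    apply: (@le_trans _ _ ((C + 1) * `|h|)).
      by rewrite ler_wpM2r// lerDl.
    by rewrite mulrC -ler_pdivlMr.
  apply: DeriveDef; first by apply/cvg_ex; exists 0; exact: lim0.
  exact/cvg_lim.
Unshelve. all: by end_near. Qed.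

Lemma flat_smooth n : smooth1 (flat n).
Proof.
move=> m; elim: m n => [|m IHm] n.
  split=> // x; apply: differentiable_continuous; apply/derivable1_diffP.
  by have [] := flat_derive n x.
split.
  by move=> x; apply: differentiable_continuous; apply/derivable1_diffP;
    have [] := flat_derive n x.
move=> i; split => [x|]; first by have [] := flat_derive n x.
have -> : 'D_(unit_dir i) (flat n) = flat n.+2 \+ (cst (- n%:R) \* flat n.+1).
  by apply/funext => x; have [_ ->] := flat_derive n x; rewrite /= mulNr.
by apply: smooth_uptoD => //; apply: smooth_uptoM => //; exact: smooth_upto_cst.
Qed.

End SmoothLine.

Section SmoothStep.
Variable R : realType.

Lemma nondecreasing_derive1_ge0 (f : R -> R) (x : R) :
  {homo f : y z / y <= z} -> derivable f x 1 -> 0 <= f^`()%classic x.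
Proof.
move=> hf df; rewrite derive1E; apply: limr_ge; first exact: df.
near=> h; have h0 : h != 0 by near: h; exact: nbhs_dnbhs_neq.
rewrite /= [_%:A]mulr1 /GRing.scale/=; have [hn|hp] := ltP h 0.
  apply: mulr_le0; first by rewrite invr_le0 ltW.
  by rewrite subr_le0 hf// gerDr ltW.
by rewrite mulr_ge0 ?invr_ge0// subr_ge0 hf// lerDr.
Unshelve. all: by end_near. Qed.

Lemma flat0_ge0 (t : R) : 0 <= flat 0 t.
Proof. by rewrite /flat; case: ifP => // _; rewrite mul1r expR_ge0. Qed.

Lemma flat0_gt0 (t : R) : 0 < t -> 0 < flat 0 t.
Proof. by move=> t0; rewrite /flat t0 mul1r expR_gt0. Qed.

Lemma flat0_le0 (t : R) : t <= 0 -> flat 0 t = 0.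
Proof. by rewrite /flat ltNge => ->. Qed.

Lemma flat0_homo : {homo flat 0 : s t / s <= t :> R}.
Proof.
move=> s t st; have [s0|s0] := leP s 0; first by rewrite flat0_le0// flat0_ge0.
have t0 := lt_le_trans s0 st.
by rewrite /flat s0 t0 !mul1r ler_expR lerN2 lef_pV2.
Qed.

(** The usual smooth transition from 0 to 1, taking place between 1 and 2. *)
Definition step (s : R) : R := flat 0 (s - 1) / (flat 0 (s - 1) + flat 0 (2 - s)).

Lemma step_den_gt0 (s : R) : 0 < flat 0 (s - 1) + flat 0 (2 - s).
Proof.
have [s1|s1] := leP s 1.
  by rewrite ltr_wpDl ?flat0_ge0// flat0_gt0//; lra.
by rewrite ltr_wpDr ?flat0_ge0// flat0_gt0// subr_gt0.
Qed.

Lemma step_eq0 (s : R) : s <= 1 -> step s = 0.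
Proof. by move=> s1; rewrite /step flat0_le0 ?mul0r// subr_le0. Qed.

Lemma step_eq1 (s : R) : 2 <= s -> step s = 1.
Proof.
move=> s2; rewrite /step (flat0_le0 (_ : 2 - s <= 0)) ?subr_le0// addr0 divff//.
by rewrite gt_eqF// flat0_gt0//; lra.
Qed.

Lemma step_ge0 (s : R) : 0 <= step s.
Proof. by rewrite divr_ge0 ?flat0_ge0// ltW// step_den_gt0. Qed.

Lemma step_le1 (s : R) : step s <= 1.
Proof. by rewrite ler_pdivrMr ?step_den_gt0// mul1r lerDl flat0_ge0. Qed.

Lemma step_homo : {homo step : s t / s <= t}.
Proof.
move=> s t st; rewrite /step ler_pdivrMr ?step_den_gt0// mulrAC.
rewrite ler_pdivlMr ?step_den_gt0// !mulrDr lerD//; first by rewrite mulrC.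
have f1 : flat 0 (s - 1) <= flat 0 (t - 1) by rewrite flat0_homo// lerD2r.
have f2 : flat 0 (2 - t) <= flat 0 (2 - s) by rewrite flat0_homo// lerD2l lerN2.
by rewrite ler_pM ?flat0_ge0.
Qed.

Lemma smooth1_affine (a b : R) : smooth1 (fun s : R => a * s + b).
Proof.
apply: smoothD; last exact: smooth_cst.
by apply: smoothM; [exact: smooth_cst|exact: smooth1_id].
Qed.

Lemma smooth_step : smooth1 step.
Proof.
have s1 : smooth1 (fun s : R => flat 0 (s - 1)).
  apply: (@smooth_comp _ _ _ unit_dir (flat 0) (fun s : R => s - 1)); first exact: flat_smooth.
  by apply: eq_smooth (smooth1_affine 1 (-1)) => s; rewrite mul1r.
have s2 : smooth1 (fun s : R => flat 0 (2 - s)).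
  apply: (@smooth_comp _ _ _ unit_dir (flat 0) (fun s : R => 2 - s)); first exact: flat_smooth.
  by apply: eq_smooth (smooth1_affine (-1) 2) => s; rewrite mulN1r addrC.
apply: smoothM => //; apply: smoothV; last exact: smoothD.
by move=> s; rewrite gt_eqF// step_den_gt0.
Qed.

Lemma near_cst_derive1_eq0 (f : R -> R) (c x : R) :
  (\forall y \near x, f y = c) -> f^`()%classic x = 0.
Proof.
move=> h; rewrite derive1E (@near_eq_derive R R^o R^o f (cst c) x 1)//.
exact: derive_cst.
Qed.

End SmoothStep.

Section SmoothPlane.
Variable R : realType.
Implicit Types (f g : R * R -> R) (z w x : R * R) (K Omega : set (R * R)).

Lemma smooth_upto_Ck n f : smooth_upto (@dir R) n f -> Ck n f.
Proof.
by elim: n f => [|n IHn] f [cf hf] //= j; have [df sf] := hf j; split => //; exact: IHn.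
Qed.

Lemma is_derive_fst x (v : R * R) : is_derive x v (fun z : R * R => z.1) v.1.
Proof.
have lim : (fun h : R => h^-1 *: (((fun z : R * R => z.1) \o shift x) (h *: v) - x.1))
    @ 0^' --> v.1.
  apply: (@cvg_trans _ ((cst v.1 : R -> R) @ 0^')); last exact: cvg_cst.
  apply: near_eq_cvg; near=> h; have h0 : h != 0 by near: h; exact: nbhs_dnbhs_neq.
  by rewrite /= addrK scalerA mulVf// scale1r.
by apply: DeriveDef; [apply/cvg_ex; exists v.1; exact: lim|exact/cvg_lim].
Unshelve. all: by end_near. Qed.

Lemma is_derive_snd x (v : R * R) : is_derive x v (fun z : R * R => z.2) v.2.
Proof.
have lim : (fun h : R => h^-1 *: (((fun z : R * R => z.2) \o shift x) (h *: v) - x.2))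
    @ 0^' --> v.2.
  apply: (@cvg_trans _ ((cst v.2 : R -> R) @ 0^')); last exact: cvg_cst.
  apply: near_eq_cvg; near=> h; have h0 : h != 0 by near: h; exact: nbhs_dnbhs_neq.
  by rewrite /= addrK scalerA mulVf// scale1r.
by apply: DeriveDef; [apply/cvg_ex; exists v.2; exact: lim|exact/cvg_lim].
Unshelve. all: by end_near. Qed.

Notation smooth2 := (smooth (@dir R)).

Lemma smooth_fst : smooth2 (fun z : R * R => z.1).
Proof.
case=> [|n]; (split; first by move=> x; exact: cvg_fst); first by [].
move=> i; split => [x|]; first by have [] := is_derive_fst x (dir R i).
have -> : 'D_(dir R i) (fun z : R * R => z.1) = cst (dir R i).1.
  by apply/funext => x; have [_ ->] := is_derive_fst x (dir R i).
exact: smooth_upto_cst.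
Qed.

Lemma smooth_snd : smooth2 (fun z : R * R => z.2).
Proof.
case=> [|n]; (split; first by move=> x; exact: cvg_snd); first by [].
move=> i; split => [x|]; first by have [] := is_derive_snd x (dir R i).
have -> : 'D_(dir R i) (fun z : R * R => z.2) = cst (dir R i).2.
  by apply/funext => x; have [_ ->] := is_derive_snd x (dir R i).
exact: smooth_upto_cst.
Qed.

(** Lets the sequel carry an explicit compact set outside which a function vanishes, in place of the
    closure of its support. *)
Lemma smooth_test_function Omega K f : smooth2 f -> compact K -> K `<=` Omega ->
  (forall x, ~ K x -> f x = 0) -> test_function Omega f.
Proof.
move=> sf cK KO f0; have clK : closed K.
  by apply: compact_closed => //; exact: norm_hausdorff.
have sub : closure [set x | f x != 0] `<=` K.
  rewrite ((closure_id K).1 clK); apply: closure_subset => x /= fx.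
  by apply: contrapT => /f0 fx0; rewrite fx0 eqxx in fx.
split; first by move=> n; exact: smooth_upto_Ck.
- by apply: (subclosed_compact _ cK sub); exact: closed_closure.
- exact: subset_trans sub KO.
Qed.

Definition dist_sqr z w : R := (z.1 - w.1) ^+ 2 + (z.2 - w.2) ^+ 2.

Lemma dist_sqr_ge0 z w : 0 <= dist_sqr z w.
Proof. by rewrite addr_ge0// sqr_ge0. Qed.

Lemma dist_sqrC z w : dist_sqr z w = dist_sqr w z.
Proof. by rewrite /dist_sqr; ring. Qed.

Lemma smooth_coordB (i : 'I_2) w : smooth2 (fun z => Defs.coord i z - Defs.coord i w).
Proof.
apply: smoothD; last exact: smooth_cst.
by case: (ord2P i) => ->; [exact: smooth_fst|exact: smooth_snd].
Qed.

Lemma derive_coordB (i j : 'I_2) w z :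
  'D_(dir R j) (fun z => Defs.coord i z - Defs.coord i w) z = (i == j)%:R.
Proof.
rewrite deriveB; last 2 first.
- by case: (ord2P i) => ->;
    [have [] := is_derive_fst z (dir R j)|have [] := is_derive_snd z (dir R j)].
- exact: derivable_cst.
rewrite derive_cst subr0 /Defs.coord /dir.
by case: (ord2P i) => ->; case: (ord2P j) => -> /=;
  [have [_ ->] := is_derive_fst z (1, 0)|have [_ ->] := is_derive_fst z (0, 1)
  |have [_ ->] := is_derive_snd z (1, 0)|have [_ ->] := is_derive_snd z (0, 1)].
Qed.

Lemma smooth_dist_sqr w : smooth2 (dist_sqr^~ w).
Proof.
apply: (@eq_smooth _ _ _ _ ((fun z => Defs.coord 0 z - Defs.coord 0 w) \* (fun z => Defs.coord 0 z - Defs.coord 0 w) \+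
  (fun z => Defs.coord 1 z - Defs.coord 1 w) \* (fun z => Defs.coord 1 z - Defs.coord 1 w))).
  by move=> z; rewrite /dist_sqr /= -!expr2.
by apply: smoothD; apply: smoothM; exact: smooth_coordB.
Qed.

Lemma derive_dist_sqr (j : 'I_2) w z :
  'D_(dir R j) (dist_sqr^~ w) z = 2 * (Defs.coord j z - Defs.coord j w).
Proof.
pose c i := (fun z => Defs.coord i z - Defs.coord i w).
rewrite (_ : dist_sqr^~ w = (c 0 \* c 0) \+ (c 1 \* c 1)); last first.
  by apply/funext => x; rewrite /dist_sqr /= -!expr2.
have dc i : derivable (c i) z (dir R j).
  exact: smooth_derivable (smooth_coordB i w).
rewrite deriveD ?deriveM//; try exact: derivableM.
rewrite !derive_coordB /GRing.scale/= /c.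
by case: (ord2P j) => -> /=; rewrite !(mulr0, mulr1); ring.
Qed.

Lemma compact_rectangle (a b c d : R) :
  compact [set z : R * R | a <= z.1 <= b /\ c <= z.2 <= d].
Proof.
rewrite (_ : [set z | _] = `[a, b]%classic `*` `[c, d]%classic).
  by apply: compact_setX; exact: segment_compact.
by apply/seteqP; split => -[x y] /=; rewrite !in_itv/=.
Qed.

Lemma compact_disk w (r : R) : compact [set z | dist_sqr z w <= r].
Proof.
have [r0|r0] := leP 0 r; last first.
  rewrite (_ : [set z | _] = set0); first exact: compact0.
  by rewrite -subset0 => z /= zr; have := dist_sqr_ge0 z w; lra.
pose q := Num.sqrt r.
have cR := @compact_rectangle (w.1 - q) (w.1 + q) (w.2 - q) (w.2 + q).
apply: subclosed_compact cR _.
  rewrite (_ : [set z | _] = (dist_sqr^~ w) @^-1` [set t | t <= r])//.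
  apply: preimage_closed => [z _|]; last exact: closed_le.
  exact: (smooth_continuous (@smooth_dist_sqr w)).
have bound (t : R) : t ^+ 2 <= r -> - q <= t <= q.
  by move=> t2; rewrite -ler_norml -sqrtr_sqr ler_wsqrtr.
move=> z /= zr; have z1 := bound (z.1 - w.1); have z2 := bound (z.2 - w.2).
have h1 : (z.1 - w.1) ^+ 2 <= r by apply: le_trans zr; rewrite lerDl sqr_ge0.
have h2 : (z.2 - w.2) ^+ 2 <= r by apply: le_trans zr; rewrite lerDr sqr_ge0.
by have /andP[? ?] := z1 h1; have /andP[? ?] := z2 h2; split; apply/andP; split; lra.
Qed.

(** Neighbourhoods in the product are balls of the maximum norm; a Euclidean disk of half the radius
    fits inside. *)
Lemma open_disk Omega w : open Omega -> Omega w ->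
  exists2 r : R, 0 < r & forall z, dist_sqr z w <= r -> Omega z.
Proof.
move=> oO Ow; have /nbhs_ballP[e /= e0 he] : nbhs w Omega by exact: open_nbhs_nbhs.
exists ((e / 2) ^+ 2); first by rewrite exprn_gt0// divr_gt0.
move=> z zr; apply: he.
have bound (t : R) : t ^+ 2 <= (e / 2) ^+ 2 -> `|t| < e.
  rewrite -sqrtr_sqr => t2; apply: (@le_lt_trans _ _ (e / 2)); last by lra.
  by rewrite -[leRHS]gtr0_norm ?divr_gt0// -sqrtr_sqr ler_wsqrtr.
split; rewrite /ball/=; rewrite distrC; apply: bound;
  apply: le_trans zr; rewrite /dist_sqr.
- by rewrite lerDl sqr_ge0.
- by rewrite lerDr sqr_ge0.
Qed.

End SmoothPlane.

Notation smooth2 := (smooth (@dir _)).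

(** * Integration in the plane *)

Notation plane R := (measurableTypeR R * measurableTypeR R)%type.

Section Rectangles.
Variable R : realType.
Implicit Types (a b c d : R) (Omega : set (R * R)).

Definition rect a b c d : set (R * R) :=
  [set z | a < z.1 < b /\ c < z.2 < d].

Lemma rectE a b c d : rect a b c d = `]a, b[%classic `*` `]c, d[%classic.
Proof. by apply/seteqP; split => -[x y] /=; rewrite !in_itv/=. Qed.

Lemma measurable_rect a b c d : measurable (rect a b c d : set (plane R)).
Proof. by rewrite rectE; apply: measurableX; exact: measurable_itv. Qed.

Lemma lebesgue2_rect_lty a b c d : (lebesgue2 R (rect a b c d) < +oo)%E.
Proof.
have -> : lebesgue2 R (rect a b c d) =
    (lebesgue_measure (`]a, b[%classic : set R) * lebesgue_measure (`]c, d[%classic : set R))%E.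
  by rewrite rectE; apply: product_measure1E; exact: measurable_itv.
rewrite !lebesgue_measure_itv/=; case: ifP => _; case: ifP => _;
  by rewrite ?(mul0e, mule0) ?ltry// -!EFinB -EFinM ltry.
Qed.

Lemma open_rect a b c d : open (rect a b c d).
Proof.
rewrite rectE openE => -[x y] [/= hx hy].
exists (`]a, b[%classic, `]c, d[%classic); last by move=> -[].
by split; apply: open_nbhs_nbhs; split => //; exact: interval_open.
Qed.

Definition rat_rect (q : (rat * rat) * (rat * rat)) : set (R * R) :=
  rect (ratr q.1.1) (ratr q.1.2) (ratr q.2.1) (ratr q.2.2).

Lemma rat_rect_nbhs Omega z : open Omega -> Omega z ->
  exists q, rat_rect q `<=` Omega /\ rat_rect q z.
Proof.
move=> oO Oz; have /nbhs_ballP[e /= e0 he] : nbhs z Omega by exact: open_nbhs_nbhs.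
have near (x : R) : exists q : rat * rat, x - e < ratr q.1 < x /\ x < ratr q.2 < x + e.
  have /rat_in_itvoo[p] : x - e < x by rewrite gtrBl.
  have /rat_in_itvoo[q] : x < x + e by rewrite ltrDl.
  by rewrite !in_itv/= => hq hp; exists (p, q).
have [p [p1 p2]] := near z.1; have [q [q1 q2]] := near z.2.
exists (p, q); split; last first.
  move: p1 p2 q1 q2 => /andP[_ p1] /andP[p2 _] /andP[_ q1] /andP[q2 _].
  by split; apply/andP.
move=> y [/= /andP[y1 y2] /andP[y3 y4]]; apply: he.
move: p1 p2 q1 q2 => /andP[p1 _] /andP[_ p2] /andP[q1 _] /andP[_ q2].
by split; rewrite /ball/= distrC ltr_distl; apply/andP; split; lra.
Qed.

Lemma open_rat_rect_cover Omega : open Omega ->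
  Omega = \bigcup_(q : (rat * rat) * (rat * rat))
    (if `[< rat_rect q `<=` Omega >] then rat_rect q else set0).
Proof.
move=> oO; apply/seteqP; split => [z Oz|z [q _]].
  have [q [qO qz]] := rat_rect_nbhs oO Oz.
  by exists q => //; rewrite ifT//; exact/asboolP.
by case: ifPn => [/asboolP qO /qO|].
Qed.

(** Measurability refers to the product sigma-algebra, hence the detour through a countable cover by
    rational rectangles. *)
Lemma open_measurable_plane Omega : open Omega -> measurable (Omega : set (plane R)).
Proof.
move=> /open_rat_rect_cover ->; apply: countable_bigcupT_measurable => // q.
by case: ifP => // _; exact: measurable_rect.
Qed.

Lemma continuous_measurable_plane Omega (f : R * R -> R) : open Omega ->
  (forall z, Omega z -> {for z, continuous f}) ->
  measurable_fun (Omega : set (plane R)) (f : plane R -> R).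
Proof.
move=> oO cf; apply: (measurability _ (RGenOpens.measurableE R)).
move=> _ [_ [a [b ->] <-]]; apply: open_measurable_plane.
rewrite openE => z [Oz fz]; apply: filterI; first exact: open_nbhs_nbhs.
by apply: cf => //; apply: open_nbhs_nbhs; split => //; exact: interval_open.
Qed.

Lemma continuous_measurable_planeT (f : R * R -> R) : continuous f ->
  measurable_fun [set: plane R] (f : plane R -> R).
Proof.
move=> cf; apply: (@continuous_measurable_plane [set: R * R] f) => [|z _].
  exact: openT.
exact: cf.
Qed.

Definition rects : set (set (plane R)) :=
  [set A | exists a b c d, A = rect a b c d].

Lemma setI_rect a b c d a' b' c' d' : rect a b c d `&` rect a' b' c' d' =
  rect (Num.max a a') (Num.min b b') (Num.max c c') (Num.min d d').
Proof.
apply/seteqP; split => z; rewrite /rect/= !gt_max !lt_min.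
  by move=> [[/andP[-> ->] /andP[-> ->]] [/andP[-> ->] /andP[-> ->]]].
by move=> [/andP[/andP[-> ->] /andP[-> ->]] /andP[/andP[-> ->] /andP[-> ->]]].
Qed.

Lemma setI_closed_rects : setI_closed rects.
Proof.
move=> _ _ [a [b [c [d ->]]]] [a' [b' [c' [d' ->]]]].
by rewrite setI_rect; do 4!eexists; reflexivity.
Qed.

Lemma rect_bigcup_fst a b : `]a, b[%classic `*` setT =
  \bigcup_n rect a b (- n%:R) n%:R.
Proof.
apply/seteqP; split => [[x y] /= [+ _]|[x y] [n _] [/= hx hy]].
  rewrite in_itv/= => hx; exists (Num.trunc `|y|).+1 => //; split => //=.
  by rewrite -ltr_norml truncnS_gt.
by split => //=; rewrite in_itv.
Qed.

Lemma rect_bigcup_snd c d : setT `*` `]c, d[%classic =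
  \bigcup_n rect (- n%:R) n%:R c d.
Proof.
apply/seteqP; split => [[x y] /= [_ +]|[x y] [n _] [/= hx hy]].
  rewrite in_itv/= => hx; exists (Num.trunc `|x|).+1 => //; split => //=.
  by rewrite -ltr_norml truncnS_gt.
by split => //=; rewrite in_itv.
Qed.

(** Bounded open rectangles are stable under intersection; generating the sigma-algebra by them
    prepares the Dynkin argument of [ae_eq0_rect]. *)
Lemma measurable_plane_rects : @measurable _ (plane R) = <<s rects >>.
Proof.
apply/seteqP; split; last first.
  apply: smallest_sub; first exact: sigma_algebra_measurable.
  by move=> _ [a [b [c [d ->]]]]; exact: measurable_rect.
have msub (X : set (plane R)) : rects X -> <<s rects >> X by exact: sub_sigma_algebra.
have salg := smallest_sigma_algebra [set: plane R] rects.
have pre (p : plane R -> R) : (forall a b, <<s rects >> (p @^-1` `]a, b[%classic)) ->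
    forall A : set R, measurable A -> <<s rects >> (p @^-1` A).
  move=> hp A mA.
  have mp : measurable_fun [set: g_sigma_algebraType rects] (p : g_sigma_algebraType rects -> R).
    apply: (measurability _ (RGenOpens.measurableE R)) => _ [_ [a [b ->] <-]].
    by rewrite setTI; exact: hp.
  by have := mp measurableT A mA; rewrite setTI.
rewrite measurable_prod_measurableType; apply: smallest_sub => //.
move=> _ [A mA [B mB <-]].
have -> : A `*` B = (fst @^-1` A) `&` (snd @^-1` B) by [].
have := @measurableI _ (g_sigma_algebraType rects); apply.
- apply: pre mA => a b; rewrite (_ : _ @^-1` _ = `]a, b[%classic `*` setT).
    rewrite rect_bigcup_fst; have := @bigcupT_measurable _ (g_sigma_algebraType rects).
    by apply => n; apply: msub; do 4!eexists; reflexivity.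
  by apply/seteqP; split => -[x y] //= [].
- apply: pre mB => a b; rewrite (_ : _ @^-1` _ = setT `*` `]a, b[%classic).
    rewrite rect_bigcup_snd; have := @bigcupT_measurable _ (g_sigma_algebraType rects).
    by apply => n; apply: msub; do 4!eexists; reflexivity.
  by apply/seteqP; split => -[x y] //= [].
Qed.

Lemma bounded_sub_rect Omega : bounded_set Omega ->
  exists r, Omega `<=` rect (- r) r (- r) r.
Proof.
move=> [M [_ hM]]; exists (Num.max M 0 + 2) => z Oz.
have := hM (Num.max M 0 + 1) _ z Oz.
rewrite (@le_lt_trans _ _ (Num.max M 0)) ?le_max ?lexx// ?ltrDl// => /(_ isT).
rewrite /= prod_normE/= ge_max => /andP[h1 h2].
by split; rewrite -ltr_norml; move: h1 h2; lra.
Qed.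

Lemma lebesgue2_bounded_lty Omega : measurable (Omega : set (plane R)) ->
  bounded_set Omega -> (lebesgue2 R Omega < +oo)%E.
Proof.
move=> mO /bounded_sub_rect[r Or].
apply: le_lt_trans (lebesgue2_rect_lty (- r) r (- r) r).
by apply: le_measure => //; rewrite inE//; exact: measurable_rect.
Qed.

End Rectangles.

(** Turns a derivative into the limit of a sequence of difference quotients, to which sequential
    theorems on measurability and integrals apply. *)
Lemma cvg_harmonic_dnbhs (R : realType) : (fun n : nat => n.+1%:R^-1 : R) @ \oo --> (0 : R)^'.
Proof.
move=> A hA; have h : nbhs (0 : R) [set x | x != 0 -> A x] by exact: hA.
have [N _ hN] := @cvg_harmonic R _ h.
exists N => // n Nn; apply: (hN n Nn) => /=.
by rewrite /harmonic/= invr_eq0 pnatr_eq0.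
Qed.

(** * Translation invariance and the integral of a derivative *)

Section Translation.
Variable R : realType.
Local Notation mu2 := (lebesgue2 R).
Implicit Types (f : plane R -> R) (v z : R * R).

Lemma lebesgue_measure_shift (r : R) (A : set R) : measurable A ->
  pushforward lebesgue_measure ((fun x => x + r) : measurableTypeR R -> measurableTypeR R) A
  = lebesgue_measure A.
Proof.
have mf : measurable_fun [set: measurableTypeR R]
    ((fun x => x + r) : measurableTypeR R -> measurableTypeR R).
  by apply: measurable_funD.
move=> mA; apply/esym/lebesgue_measure_unique => //= _ [[a b]] _ <-.
rewrite /pushforward (_ : _ @^-1` _ = `](a - r), (b - r)]%classic).
  rewrite !lebesgue_measure_itv/= !lte_fin ltrD2r; case: ifP => // _.
  by rewrite -!EFinB; congr EFin; ring.
by apply/seteqP; split => x /=; rewrite !in_itv/= ltrBlDr lerBrDr.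
Qed.

Definition translate v : plane R -> plane R := fun z => (z.1 + v.1, z.2 + v.2).

Lemma measurable_translate v : measurable_fun [set: plane R] (translate v).
Proof.
by apply/measurable_fun_pairP; split; apply: measurable_funD.
Qed.

Lemma lebesgue2_translate v (A : set (plane R)) : measurable A ->
  pushforward mu2 (translate v) A = mu2 A.
Proof.
have mt := measurable_translate v.
move=> mA; apply/esym/product_measure_unique => //= X Y mX mY.
rewrite /pushforward.
pose X' := (fun x : measurableTypeR R => x + v.1) @^-1` X.
pose Y' := (fun x : measurableTypeR R => x + v.2) @^-1` Y.
have mS (r : R) (Z : set (measurableTypeR R)) : measurable Z ->
    measurable ((fun x : measurableTypeR R => x + r) @^-1` Z).
  move=> mZ; rewrite -[X in measurable X]setTI.
  by have mf : measurable_fun [set: measurableTypeR R] (fun x : measurableTypeR R => x + r : measurableTypeR R);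
    [exact: measurable_funD|exact: mf].
have -> : translate v @^-1` (X `*` Y) = X' `*` Y' by [].
transitivity (lebesgue_measure X' * lebesgue_measure Y')%E.
  by apply: product_measure1E; exact: mS.
by congr (_ * _)%E; exact: lebesgue_measure_shift.
Qed.

Lemma Rintegral_translate f v : measurable_fun setT f ->
  mu2.-integrable setT (EFin \o (f \o translate v)) ->
  \int[mu2]_z f (translate v z) = \int[mu2]_z f z.
Proof.
move=> mf fi; rewrite /Rintegral; congr fine.
transitivity (\int[pushforward mu2 (translate v)]_z (f z)%:E)%E.
  rewrite integral_pushforward//; first exact: measurable_translate.
  exact/measurable_EFinP.
apply: eq_measure_integral => /=; first exact: measurable_translate.
by move=> _ A mA _; exact: lebesgue2_translate.
Qed.

Lemma translate_dir (h : R) j z :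
  translate (h *: dir R j) z = (h *: dir R j + z : R * R).
Proof. by case: z => x y; rewrite /translate/= addrC [X in (_, X)]addrC. Qed.

Lemma derivable_line (W : R * R -> R) (v z : R * R) (t : R) :
  derivable W (t *: v + z) v ->
  is_derive t 1 (fun s : R => W (s *: v + z)) ('D_v W (t *: v + z)).
Proof.
move=> dW; have e (h : R) : W ((h *: (1 : R^o) + t) *: v + z) = W (h *: v + (t *: v + z)).
  by rewrite scalerDl addrA [h *: (1 : R^o)]mulr1.
have eq : (fun h : R => h^-1 *: (((fun s : R => W (s *: v + z)) \o shift t) (h *: (1 : R^o))
     - W (t *: v + z))) = (fun h => h^-1 *: ((W \o shift (t *: v + z)) (h *: v) - W (t *: v + z))).
  by apply/funext => h /=; rewrite e.
by apply: DeriveDef; [rewrite /derivable eq|rewrite /derive eq].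
Qed.

Lemma bounded_derive_lipschitz (W : R * R -> R) (v z : R * R) (C h : R) :
  (forall x, derivable W x v) -> (forall x, `|'D_v W x| <= C) ->
  `|W (h *: v + z) - W z| <= C * `|h|.
Proof.
move=> dW bW; pose g (s : R) := W (s *: v + z).
have dg (s : R) : is_derive s 1 g ('D_v W (s *: v + z)) by exact: derivable_line.
have cg : continuous g.
  by move=> s; apply: differentiable_continuous; apply/derivable1_diffP; have [] := dg s.
have lip (a b : R) : a <= b -> `|g b - g a| <= C * (b - a).
  move=> ab; have [c _ ->] := MVT_segment ab (fun x _ => dg x)
    (continuous_subspaceT cg).
  by rewrite normrM (ger0_norm (_ : 0 <= b - a)) ?subr_ge0// ler_wpM2r ?subr_ge0.
have -> : W z = g 0 by rewrite /g scale0r add0r.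
have [h0|h0] := leP 0 h.
  by have := lip 0 h h0; rewrite subr0 (ger0_norm h0).
by have := lip h 0 (ltW h0); rewrite sub0r distrC (ltr0_norm h0).
Qed.

Lemma integrable_bounded_support (f : R * R -> R) (C r : R) :
  measurable_fun [set: plane R] f -> (forall z, `|f z| <= C) ->
  (forall z, ~ rect (- r) r (- r) r z -> f z = 0) ->
  mu2.-integrable setT (EFin \o f).
Proof.
move=> mf bf f0; have mQ := @measurable_rect R (- r) r (- r) r.
rewrite (_ : EFin \o f = (EFin \o f) \_ (rect (- r) r (- r) r)); last first.
  apply/funext => z; rewrite patchE; case: ifPn => // /negP zQ /=.
  by rewrite f0// => Qz; apply: zQ; rewrite inE.
apply/(integrable_mkcond _ _).1 => //; apply: measurable_bounded_integrable => //.
- exact: lebesgue2_rect_lty.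
- exact: measurable_funTS.
- by exists C; split => [|M CM x _]; [exact: num_real|exact: le_trans (bf x) (ltW CM)].
Qed.

(** Difference quotients have integral 0 by translation invariance and converge to the derivative
    under a dominating function. Only boundedness of the derivative is assumed, not continuity. *)
Lemma Rintegral_derive_eq0 (W : R * R -> R) (j : 'I_2) (C r : R) :
  (forall z, derivable W z (dir R j)) -> continuous W ->
  (forall z, `|'D_(dir R j) W z| <= C) ->
  (forall z, ~ rect (- r) r (- r) r z -> W z = 0) ->
  mu2.-integrable setT (EFin \o 'D_(dir R j) W) /\
  \int[mu2]_z 'D_(dir R j) W z = 0.
Proof.
move=> dW cW bW W0; set v := dir R j.
pose Wn (n : nat) (z : plane R) : R := n.+1%:R * (W (translate (n.+1%:R^-1 *: v) z) - W z).
have mW := continuous_measurable_planeT cW.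
have mWt n : measurable_fun [set: plane R] (W \o translate (n.+1%:R^-1 *: v)).
  exact: (measurableT_comp mW (measurable_translate _)).
have mWn n : measurable_fun [set: plane R] (Wn n).
  by apply: measurable_funM => //; apply: measurable_funB; [exact: mWt|exact: mW].
have lim z : Wn n z @[n --> \oo] --> 'D_v W z.
  have /cvg_ex[l hl] := dW z; have le : 'D_v W z = l by exact: cvg_lim.
  rewrite le; have inv := @cvg_harmonic_dnbhs R.
  have := cvg_comp _ _ inv hl; apply: cvg_trans; apply: near_eq_cvg.
  by near=> n; rewrite /= /Wn translate_dir invrK.
have C0 : 0 <= C := le_trans (normr_ge0 _) (bW (0, 0)).
(* The increments are at most 1, so all difference quotients vanish off the square enlarged by 1. *)
have bWn n z : `|Wn n z| <= C * \1_(rect (- (r + 1)) (r + 1) (- (r + 1)) (r + 1)) z.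
  rewrite indicE; case: (boolP (z \in _)) => [_|/negP zQ].
    rewrite mulr1 /Wn normrM ger0_norm// translate_dir.
    rewrite -ler_pdivlMl ?ltr0n// mulrC.
    apply: le_trans (bounded_derive_lipschitz _ _ dW bW) _.
    by rewrite ger0_norm.
  have /andP[n0 n1] : 0 <= (n.+1%:R^-1 : R) <= 1.
    by rewrite invr_ge0 ler0n invf_le1// ler1n.
  have zQ' : ~ rect (- (r + 1)) (r + 1) (- (r + 1)) (r + 1) z.
    by move=> Qz; apply: zQ; rewrite inE.
  have W1 : W z = 0.
    apply: W0 => -[/andP[z1 z2] /andP[z3 z4]]; apply: zQ'.
    by split; apply/andP; split; lra.
  have W2 : W (translate (n.+1%:R^-1 *: v) z) = 0.
    apply: W0 => -[/=]; rewrite /v /dir; move: (n.+1%:R^-1) n0 n1 => t t0 t1.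
    case: ifP => _ /= /andP[z1 z2] /andP[z3 z4]; apply: zQ'; split; apply/andP;
      rewrite ?[_ *: (1 : R)]mulr1 ?[_ *: (0 : R)]mulr0 in z1 z2 z3 z4; split; lra.
  by rewrite /Wn W1 W2 subrr !mulr0 normr0.
have ri : mu2.-integrable setT
    (fun z => (C * \1_(rect (- (r + 1)) (r + 1) (- (r + 1)) (r + 1)) z)%:E).
  have mQ := @measurable_rect R (- (r + 1)) (r + 1) (- (r + 1)) (r + 1).
  apply: (@integrable_bounded_support _ C (r + 1)).
  - by apply: measurable_funM => //; exact: measurable_indic.
  - move=> z; rewrite indicE; case: (z \in _); rewrite ?mulr1 ?mulr0 ?normr0//.
    by rewrite ger0_norm.
  - by move=> z zQ; rewrite indicE memNset// mulr0.
have mD : measurable_fun [set: plane R] ('D_v W).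
  by apply: (measurable_fun_cvg mWn) => z _; exact: lim.
have limE z : (Wn n z)%:E @[n --> \oo] --> ('D_v W z)%:E.
  by apply: cvg_EFin; [exact: nearW|exact: lim].
have [di _ cv] : [/\ mu2.-integrable setT (EFin \o 'D_v W),
    (\int[mu2]_z `|(Wn n z)%:E - ('D_v W z)%:E|)%E @[n --> \oo] --> 0%E &
    (\int[mu2]_z (Wn n z)%:E)%E @[n --> \oo] --> (\int[mu2]_z ('D_v W z)%:E)%E].
  apply: dominated_convergence ri _ => //.
  - by move=> n; apply/measurable_EFinP; exact: mWn.
  - exact/measurable_EFinP.
  - by apply: aeW => z _; exact: limE.
  - by apply: aeW => z n _; rewrite lee_fin; exact: bWn.
split; first exact: di.
(* A move by [2 |r|] leaves the square, where [W] is 0; the Lipschitz bound then controls [W z]. *)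
have Wb z : `|W z| <= C * (2 * `|r| + 1).
  have [[/andP[z1 z2] /andP[z3 z4]]|zQ] := pselect (rect (- r) r (- r) r z); last first.
    by rewrite W0// normr0 mulr_ge0//; have := normr_ge0 r; lra.
  have out : W ((2 * `|r|) *: v + z) = 0.
    apply: W0 => -[/=]; rewrite /v /dir; have rr := ler_norm r.
    case: ifP => _ /= /andP[y1 y2] /andP[y3 y4];
      rewrite ?[_ *: (1 : R)]mulr1 ?[_ *: (0 : R)]mulr0 in y1 y2 y3 y4; lra.
  have := bounded_derive_lipschitz z (2 * `|r|) dW bW.
  rewrite -/v out sub0r normrN => /le_trans; apply.
  by rewrite ler_wpM2l// ger0_norm ?mulr_ge0// lerDl.
have Wi : mu2.-integrable setT (EFin \o W).
  exact: (integrable_bounded_support mW Wb W0).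
have Wti n : mu2.-integrable setT (EFin \o (W \o translate (n.+1%:R^-1 *: v))).
  apply: (@integrable_bounded_support _ (C * (2 * `|r| + 1)) (r + 1)) => //.
    by move=> z; exact: Wb.
  move=> z zQ'; have /andP[n0 n1] : 0 <= (n.+1%:R^-1 : R) <= 1.
    by rewrite invr_ge0 ler0n invf_le1// ler1n.
  apply: W0 => -[/=]; rewrite /v /dir; move: (n.+1%:R^-1) n0 n1 => t t0 t1.
  case: ifP => _ /= /andP[z1 z2] /andP[z3 z4]; apply: zQ'; split; apply/andP;
    rewrite ?[_ *: (1 : R)]mulr1 ?[_ *: (0 : R)]mulr0 in z1 z2 z3 z4; split; lra.
have Wn0 n : (\int[mu2]_z (Wn n z)%:E = 0)%E.
  have e : \int[mu2]_z (W \o translate (n.+1%:R^-1 *: v)) z = \int[mu2]_z W z.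
    exact: Rintegral_translate.
  have Bi : mu2.-integrable setT (EFin \o
      (fun z => (W \o translate (n.+1%:R^-1 *: v)) z - W z)).
    exact: (integrableB measurableT (Wti n) Wi).
  have Wni : mu2.-integrable setT (EFin \o Wn n).
    exact: (integrableZl measurableT n.+1%:R Bi).
  rewrite -[LHS]fineK ?integrable_fin_num//; congr EFin.
  rewrite -[LHS]/(\int[mu2]_z Wn n z) RintegralZl// RintegralB//.
    by rewrite [X in X - _]e subrr mulr0.
  exact: Wti.
have e0 : (fun m => \int[mu2]_z (Wn m z)%:E)%E = cst 0%E.
  by apply/funext => m; exact: Wn0.
rewrite e0 in cv; rewrite /Rintegral.
by rewrite -(cvg_lim (@ereal_hausdorff R) cv) lim_cst.
Unshelve. all: by end_near. Qed.

End Translation.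

(** * The fundamental lemma of the calculus of variations *)

Section FundamentalLemma.
Variable R : realType.
Local Notation mu2 := (lebesgue2 R).
Implicit Types (Omega : set (R * R)) (h : R * R -> R).

Definition box_cutoff (a b : R) (n : nat) (x : R) : R :=
  step (n%:R * (x - a)) * step (n%:R * (b - x)).

Lemma smooth_box_cutoff a b n : smooth1 (box_cutoff a b n).
Proof.
apply: (@smoothM _ _ _ unit_dir (fun x : R => step (n%:R * (x - a)))
  (fun x => step (n%:R * (b - x)))).
  apply: (@smooth_comp _ _ _ unit_dir (@step R) (fun x : R => n%:R * (x - a))); first exact: smooth_step.
  by apply: eq_smooth (@smooth1_affine R n%:R (- (n%:R * a))) => x; rewrite mulrBr.
apply: (@smooth_comp _ _ _ unit_dir (@step R) (fun x : R => n%:R * (b - x))); first exact: smooth_step.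
by apply: eq_smooth (@smooth1_affine R (- n%:R) (n%:R * b)) => x; rewrite mulrBr mulNr addrC.
Qed.

Lemma box_cutoff_bound a b n x : 0 <= box_cutoff a b n x <= 1.
Proof.
by rewrite mulr_ge0 ?step_ge0//= mulr_ile1// ?step_ge0// step_le1.
Qed.

Lemma box_cutoff_eq0 a b n x : (0 < n)%N -> ~~ (a + n%:R^-1 <= x <= b - n%:R^-1) ->
  box_cutoff a b n x = 0.
Proof.
rewrite -(ltr0n R) => n0; rewrite negb_and -!ltNge => /orP[xa|xb]; rewrite /box_cutoff.
  rewrite step_eq0 ?mul0r// -ler_pdivlMl// mulr1; lra.
rewrite [X in _ * X]step_eq0 ?mulr0// -ler_pdivlMl// mulr1; lra.
Qed.

Lemma box_cutoff_cvg a b x :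
  box_cutoff a b n x @[n --> \oo] --> (if a < x < b then 1 else 0 : R).
Proof.
have ev (e : R) : 0 < e -> \forall n \near \oo, 2 <= n%:R * e.
  move=> e0; near=> n; rewrite -ler_pdivrMr//.
  by near: n; exact: nbhs_infty_ger.
case: ifPn => [/andP[ax xb]|].
  apply: (@cvg_trans _ ((cst 1 : nat -> R) @ \oo)); last exact: cvg_cst.
  apply: near_eq_cvg; near=> n; rewrite /box_cutoff !step_eq1 ?mulr1//.
    by near: n; apply: ev; rewrite subr_gt0.
  by near: n; apply: ev; rewrite subr_gt0.
rewrite negb_and -!leNgt => hx.
apply: (@cvg_trans _ ((cst 0 : nat -> R) @ \oo)); last exact: cvg_cst.
apply: near_eq_cvg; near=> n; rewrite /box_cutoff.
case/orP: hx => hx.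
  by rewrite step_eq0 ?mul0r// (le_trans _ ler01)// mulr_ge0_le0// subr_le0.
by rewrite [X in _ * X]step_eq0 ?mulr0// (le_trans _ ler01)// mulr_ge0_le0// subr_le0.
Unshelve. all: by end_near. Qed.

Definition rect_cutoff (a b c d : R) (n : nat) (z : R * R) : R :=
  box_cutoff a b n z.1 * box_cutoff c d n z.2.

Lemma smooth_rect_cutoff a b c d n : smooth2 (rect_cutoff a b c d n).
Proof.
apply: (@smoothM _ _ _ (@dir R) (fun z : R * R => box_cutoff a b n z.1)
  (fun z => box_cutoff c d n z.2)).
  apply: (@smooth_comp _ _ _ (@dir R) (box_cutoff a b n) (fun z : R * R => z.1)).
    exact: smooth_box_cutoff.
  exact: smooth_fst.
apply: (@smooth_comp _ _ _ (@dir R) (box_cutoff c d n) (fun z : R * R => z.2)).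
  exact: smooth_box_cutoff.
exact: smooth_snd.
Qed.

Definition annihilates_tests Omega h :=
  forall phi K, smooth2 phi -> compact K -> K `<=` Omega ->
  (forall z, ~ K z -> phi z = 0) ->
  \int[mu2]_(z in Omega) (h z * phi z) = 0.

(** Test with smooth cutoffs supported inside the rectangle that converge to its indicator, and pass
    to the limit by dominated convergence. *)
Lemma Rintegral_rect_eq0 Omega h a b c d : open Omega ->
  mu2.-integrable Omega (EFin \o h) -> annihilates_tests Omega h ->
  rect a b c d `<=` Omega -> \int[mu2]_(z in rect a b c d) h z = 0.
Proof.
move=> oO hi hO QO; have mO := open_measurable_plane oO.
have mQ := @measurable_rect R a b c d.
have mh := measurable_int _ hi; move/measurable_EFinP : (mh) => mh'.
have mc n : measurable_fun (Omega : set (plane R)) (rect_cutoff a b c d n).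
  apply: measurable_funTS; apply: continuous_measurable_planeT.
  by apply: smooth_continuous; exact: smooth_rect_cutoff.
have bc n z : 0 <= rect_cutoff a b c d n z <= 1.
  have /andP[x0 x1] := box_cutoff_bound a b n z.1.
  have /andP[y0 y1] := box_cutoff_bound c d n z.2.
  by rewrite mulr_ge0//= mulr_ile1.
have lim z : rect_cutoff a b c d n z @[n --> \oo] --> (\1_(rect a b c d) z : R).
  have -> : \1_(rect a b c d) z =
      (if a < z.1 < b then 1 else 0) * (if c < z.2 < d then 1 else 0) :> R.
    rewrite indicE /rect; case: (boolP (z \in _)).
      by rewrite inE => -[/= -> ->]; rewrite mulr1.
    rewrite notin_setE/= => /not_andP; case: ifP; case: ifP => //; rewrite ?mulr0 ?mul0r//.
    by move=> h1 h2 [].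
  by apply: cvgM; exact: box_cutoff_cvg.
have limh z : h z * rect_cutoff a b c d n.+1 z @[n --> \oo] --> h z * \1_(rect a b c d) z.
  have lim1 : rect_cutoff a b c d n.+1 z @[n --> \oo] --> (\1_(rect a b c d) z : R).
    by have := lim z; rewrite -cvg_shiftS.
  by apply: cvgM lim1; exact: cvg_cst.
have zero n : (\int[mu2]_(z in Omega) (h z * rect_cutoff a b c d n.+1 z)%:E = 0)%E.
  have hr : \int[mu2]_(z in Omega) (h z * rect_cutoff a b c d n.+1 z) = 0.
    have n0 : 0 < n.+1%:R^-1 :> R by rewrite invr_gt0.
    apply: (hO _ [set z | a + n.+1%:R^-1 <= z.1 <= b - n.+1%:R^-1 /\
                          c + n.+1%:R^-1 <= z.2 <= d - n.+1%:R^-1]).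
    - exact: smooth_rect_cutoff.
    - exact: compact_rectangle.
    - move=> z [/andP[z1 z2] /andP[z3 z4]]; apply: QO.
      move: (n.+1%:R^-1) n0 z1 z2 z3 z4 => t n0 z1 z2 z3 z4.
      by split; apply/andP; split; lra.
    - move=> z /= /not_andP[/negP hz|/negP hz]; rewrite /rect_cutoff.
        by rewrite box_cutoff_eq0// mul0r.
      by rewrite [X in _ * X]box_cutoff_eq0// mulr0.
  rewrite -[LHS]fineK; first by congr EFin; exact: hr.
  apply: integrable_fin_num => //; apply: (le_integrable mO _ _ hi).
    by apply/measurable_EFinP; exact: measurable_funM.
  move=> z _; rewrite lee_fin normrM ler_piMr//.
  by have /andP[c0 c1] := bc n.+1 z; rewrite ger0_norm.
have [_ _ cv] : [/\ mu2.-integrable Omega (fun z => (h z * \1_(rect a b c d) z)%:E),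
    (\int[mu2]_(z in Omega) `|(h z * rect_cutoff a b c d n.+1 z)%:E -
       (h z * \1_(rect a b c d) z)%:E|)%E @[n --> \oo] --> 0%E &
    (\int[mu2]_(z in Omega) (h z * rect_cutoff a b c d n.+1 z)%:E)%E @[n --> \oo] -->
    (\int[mu2]_(z in Omega) (h z * \1_(rect a b c d) z)%:E)%E].
  apply: (@dominated_convergence _ _ _ mu2 Omega mO _ _ (abse \o (EFin \o h))) => //.
  - by move=> n; apply/measurable_EFinP; exact: measurable_funM.
  - by apply/measurable_EFinP; apply: measurable_funM => //; exact: measurable_indic.
  - by apply: aeW => z _; apply: cvg_EFin; [exact: nearW|exact: limh].
  - exact: integrable_abse.
  - apply: aeW => z n _; rewrite lee_fin normrM ler_piMr//.
    by have /andP[c0 c1] := bc n.+1 z; rewrite ger0_norm.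
have e0 : (fun n => \int[mu2]_(z in Omega) (h z * rect_cutoff a b c d n.+1 z)%:E)%E = cst 0%E.
  by apply/funext => n; exact: zero.
rewrite e0 in cv; have := cvg_lim (@ereal_hausdorff R) cv; rewrite lim_cst// => int0.
rewrite /Rintegral -[X in integral _ X](setIidr QO) integral_mkcondr.
have -> : ((fun z => (h z)%:E) \_ (rect a b c d) = (fun z => (h z * \1_(rect a b c d) z)%:E)).
  apply/funext => z; rewrite patchE indicE; case: ifP => _; rewrite ?mulr1 ?mulr0//.
by rewrite -int0.
Qed.

(** The sets on whose trace in the rectangle [h] has integral 0 form a Dynkin system containing the
    rectangles, hence comprise all measurable sets. *)
Lemma ae_eq0_rect h a b c d : mu2.-integrable (rect a b c d) (EFin \o h) ->
  (forall a' b' c' d', rect a' b' c' d' `<=` rect a b c d ->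
     \int[mu2]_(z in rect a' b' c' d') h z = 0) ->
  {ae mu2, forall z, rect a b c d z -> h z = 0}.
Proof.
set Q := rect a b c d => hi hQ; have mQ : measurable (Q : set (plane R)) := @measurable_rect R a b c d.
have hiS (E : set (plane R)) : measurable E -> E `<=` Q -> mu2.-integrable E (EFin \o h).
  by move=> mE EQ; exact: (integrableS mQ mE EQ hi).
pose P (S : set (plane R)) := (\int[mu2]_(z in S `&` Q) (h z)%:E = 0)%E.
have zero (E : set (plane R)) : measurable E -> E `<=` Q ->
    \int[mu2]_(z in E) h z = 0 -> (\int[mu2]_(z in E) (h z)%:E = 0)%E.
  move=> mE EQ e0; rewrite -[LHS]fineK; first by congr EFin; exact: e0.
  by apply: integrable_fin_num => //; exact: hiS.
have PQ : P setT by rewrite /P setTI; apply: zero => //; exact: hQ.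
have Pall (S : set (plane R)) : measurable S -> P S.
  rewrite measurable_plane_rects; apply: dynkin_induction => //.
  - exact: measurable_plane_rects.
  - exact: setI_closed_rects.
  - move=> _ [a' [b' [c' [d' ->]]]]; rewrite /P; apply: zero.
    + by apply: measurableI => //; exact: measurable_rect.
    + exact: subIsetr.
    + by rewrite /Q setI_rect hQ// -setI_rect; exact: subIsetr.
  - move=> A mA PA; rewrite /P.
    have := @integral_setU _ _ _ mu2 (A `&` Q) (~` A `&` Q) (EFin \o h).
    rewrite -setIUl setUv setTI => /(_ (measurableI _ _ mA mQ)
      (measurableI _ _ (measurableC mA) mQ) (measurable_int _ hi)).
    rewrite [X in (_ = X + _)%E]PA add0e => <-; first by move: PQ; rewrite /P setTI.
    by apply/disj_setPS => z [[Az _] [nAz _]]; exact: nAz.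
  - move=> A mA tA PA; rewrite /P setI_bigcupl integral_bigcup.
    + by rewrite eseries0// => n _ _; exact: PA.
    + apply/trivIsetP => i j _ _ ij; move/trivIsetP : tA => /(_ i j Logic.I Logic.I ij) Aij.
      by rewrite setIACA Aij set0I.
    + by move=> n; exact: measurableI.
    + rewrite -setI_bigcupl; apply: hiS; last exact: subIsetr.
      by apply: measurableI => //; exact: bigcupT_measurable.
have ae0 : ae_eq mu2 Q (EFin \o h) (cst 0%E).
  apply: integral_ae_eq => // E EQ mE; rewrite integral0.
  by have := Pall _ mE; rewrite /P (setIidl EQ).
by apply: filterS ae0 => z hz Qz; have := hz Qz; rewrite /= => -[].
Qed.

(** Countably many rational rectangles suffice, so null exceptional sets in neighbourhoods add up to
    a null set. *)
Lemma ae_local Omega (P : R * R -> Prop) :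
  (forall z, Omega z -> exists2 U, open U /\ U z & {ae mu2, forall y, U y -> P y}) ->
  {ae mu2, forall z, Omega z -> P z}.
Proof.
move=> hloc.
pose q (n : nat) := if unpickle n is Some q then rat_rect q else set0 : set (R * R).
pose good n := {ae mu2, forall y, q n y -> P y}.
(* The guard [good n] makes [N n] empty for a rectangle on which nothing is known, so the union may
   run over all indices. *)
pose N (n : nat) : set (plane R) := [set z | ~ (good n -> q n z -> P z)].
have qn n : {ae mu2, forall z, good n -> q n z -> P z}.
  have [gn|ngn] := pselect (good n); last by apply: aeW => z.
  by apply: (negligibleS _ gn) => z nz hz; apply: nz => _; exact: hz.
have := negligible_bigcup (F := N) qn; apply: negligibleS => z /= /not_implyP[Oz hz].
have [U [oU Uz] aeU] := hloc z Oz; have [r [rU rz]] := rat_rect_nbhs oU Uz.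
have qr n : unpickle n = Some r -> q n = rat_rect r by rewrite /q => ->.
have {}qr := qr _ (pickleK r); move: (pickle r) qr => n qr.
exists n => //; rewrite /N /= qr => hr; apply: hz; apply: hr => //.
by rewrite /good qr; apply: (negligibleS _ aeU) => y ny hy; apply: ny => /rU; exact: hy.
Qed.

Lemma fundamental_lemma Omega h : open Omega ->
  mu2.-integrable Omega (EFin \o h) -> annihilates_tests Omega h ->
  {ae mu2, forall z, Omega z -> h z = 0}.
Proof.
move=> oO hi hO; apply: ae_local => z Oz; have [r [rO rz]] := rat_rect_nbhs oO Oz.
exists (rat_rect r); first by split => //; exact: open_rect.
apply: ae_eq0_rect.
  exact: (integrableS (open_measurable_plane oO) (measurable_rect _ _ _ _) rO hi).
move=> a b c d sub; apply: (Rintegral_rect_eq0 oO hi hO).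
exact: subset_trans rO.
Qed.

End FundamentalLemma.

(** * Complex derivatives and weak derivatives *)

Section ComplexDerivative.
Variable R : realType.
Implicit Types (v : R * R -> R * R) (z : R * R) (x y t : R[i]).

Definition normc_sqr x : R := complex.Re x ^+ 2 + complex.Im x ^+ 2.

Lemma normc_sqrM x y : normc_sqr (x * y) = normc_sqr x * normc_sqr y.
Proof. by case: x => a b; case: y => c d; rewrite /normc_sqr/=; ring. Qed.

Lemma normc_sqr_ge0 x : 0 <= normc_sqr x.
Proof. by rewrite addr_ge0 ?sqr_ge0. Qed.

Lemma normc_sqr_eq0 x : (normc_sqr x == 0) = (x == 0).
Proof.
case: x => a b; rewrite paddr_eq0 ?sqr_ge0// !sqrf_eq0/=.
by rewrite eq_complex.
Qed.

Lemma normc_ltE x (e : R) : 0 < e -> (`|x| < e%:C%C) = (normc_sqr x < e ^+ 2).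
Proof.
move=> e0; rewrite normc_def ltcR -[X in _ < X]gtr0_norm// -sqrtr_sqr ltr_sqrt//.
by rewrite exprn_gt0.
Qed.

Lemma normc_le1E x : (`|x| <= 1) = (normc_sqr x <= 1).
Proof.
rewrite normc_def (_ : 1 = 1%:C%C)// lecR -[X in _ <= X]sqrtr1 ler_psqrt ?nnegrE//.
exact: normc_sqr_ge0.
Qed.

Lemma gt0_complex (d : R[i]) : 0 < d -> exists2 r : R, 0 < r & d = r%:C%C.
Proof.
case: d => a b; rewrite ltcE/= => /andP[/eqP b0 a0].
by exists a => //; rewrite b0.
Qed.

(* Squared distance between the increment of [v] at [z] and its candidate complex-linear part. *)
Definition complex_defect v z (a b h k : R) : R :=
  ((v (z.1 + h, z.2 + k)).1 - (v z).1 - (a * h - b * k)) ^+ 2 +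
  ((v (z.1 + h, z.2 + k)).2 - (v z).2 - (a * k + b * h)) ^+ 2.

(** Complex differentiability at [z] with derivative [a + i b], in real terms and squared to avoid
    roots. *)
Definition complex_diff v z (a b : R) := forall e : R, 0 < e ->
  exists2 d : R, 0 < d & forall h k, h ^+ 2 + k ^+ 2 < d ^+ 2 ->
    complex_defect v z a b h k <= e ^+ 2 * (h ^+ 2 + k ^+ 2).

Let quotient v z (t : R[i]^o) : R[i]^o :=
  t^-1 *: (complex_fun v (t *: (1 : R[i]^o) + (z.1 +i* z.2)%C) - complex_fun v (z.1 +i* z.2)%C).

Lemma complex_defectE v z (a b h k : R) : (h +i* k)%C != 0 ->
  complex_defect v z a b h k =
  normc_sqr ((a +i* b)%C - quotient v z (h +i* k)%C) * normc_sqr (h +i* k)%C.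
Proof.
move=> t0; rewrite -normc_sqrM mulrBl /quotient /GRing.scale/= mulr1.
set t := (h +i* k)%C in t0 *; rewrite mulrAC mulVf// mul1r /complex_fun/=.
rewrite [h + _]addrC [k + _]addrC -surjective_pairing /normc_sqr /complex_defect/=.
by congr (_ + _); rewrite -[RHS]sqrrN; congr (_ ^+ 2); ring.
Qed.

Lemma complex_diffP v z (a b : R) :
  (quotient v z t @[t --> 0^'] --> ((a +i* b)%C : R[i]^o)) <-> complex_diff v z a b.
Proof.
split => [/(@cvgrPdist_lt _ R[i]^o) lim e e0|cd].
  have e0' : 0 < e%:C%C :> R[i] by rewrite ltcR.
  have /nbhs_ballP[d /= d0 hd] := lim _ e0'.
  have [r r0 dr] := gt0_complex d0; exists r => // h k hk.
  have [t0|t0] := eqVneq (h +i* k)%C 0.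
    move: t0 => /eqP; rewrite eq_complex/= => /andP[/eqP -> /eqP ->].
    have -> : complex_defect v z a b 0 0 = 0.
      by rewrite /complex_defect !addr0 -surjective_pairing; ring.
    by rewrite mulr_ge0 ?addr_ge0 ?sqr_ge0.
  rewrite complex_defectE// ler_wpM2r ?normc_sqr_ge0//.
  rewrite ltW// -normc_ltE//; apply: hd => //=.
  by rewrite /ball/= sub0r normrN dr normc_ltE.
apply/(@cvgrPdist_lt _ R[i]^o) => e e0; have [r r0 ->] := gt0_complex e0.
(* Half the tolerance, because the defect is bounded by a weak inequality and the limit asks for a
   strict one. *)
have [d d0 hd] := cd (r / 2) (divr_gt0 r0 (ltr0Sn _ 1)).
apply/nbhs_ballP; exists d%:C%C; first by rewrite /= ltcR.
move=> t; rewrite /ball/= sub0r normrN normc_ltE// => td t0.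
rewrite normc_ltE//; case: t td t0 => h k td t0; have /= := hd h k td.
rewrite complex_defectE// ler_pM2r; last first.
  by rewrite lt_neqAle eq_sym normc_sqr_eq0 t0 normc_sqr_ge0.
move=> /le_lt_trans; apply; rewrite ltr_pXn2r ?nnegrE ?divr_ge0 ?ltW//.
by rewrite gtr_pMr// invf_lt1// ltr1n.
Qed.

Lemma complex_diff_derivable v z (a b : R) : complex_diff v z a b ->
  derivable (complex_fun v) (z.1 +i* z.2)%C 1 /\
  (complex_fun v)^`()%classic (z.1 +i* z.2)%C = (a +i* b)%C.
Proof.
move=> /complex_diffP lim; split; first by apply/cvg_ex; exists (a +i* b)%C; exact: lim.
by rewrite derive1E; exact: cvg_lim lim.
Qed.

Lemma derivable_complex_diff v z :
  derivable (complex_fun v) (z.1 +i* z.2)%C 1 ->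
  let l := (complex_fun v)^`()%classic (z.1 +i* z.2)%C in
  complex_diff v z (complex.Re l) (complex.Im l).
Proof.
move=> dv l; apply/complex_diffP; rewrite (_ : (_ +i* _)%C = l); last by case: l.
by rewrite /l derive1E; exact: dv.
Qed.

Lemma compressive_conformalP Omega v : compressive_conformal Omega v <->
  forall z, Omega z -> exists a b, a ^+ 2 + b ^+ 2 <= 1 /\ complex_diff v z a b.
Proof.
split=> [cc [x y] Oz|cc [x y] /= Oz].
  have [dv n1] := cc (x +i* y)%C Oz.
  exists (complex.Re ((complex_fun v)^`()%classic (x +i* y)%C)).
  exists (complex.Im ((complex_fun v)^`()%classic (x +i* y)%C)).
  by split; [rewrite -normc_le1E|exact: (@derivable_complex_diff v (x, y))].
have [a [b [ab cd]]] := cc _ Oz; have [dv e] := complex_diff_derivable cd.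
by split => //; rewrite e normc_le1E.
Qed.

End ComplexDerivative.

(** * Classical derivatives are weak derivatives *)

Section ClassicalIsWeak.
Variable R : realType.
Local Notation mu2 := (lebesgue2 R).
Implicit Types (Omega K : set (R * R)) (f g w phi : R * R -> R) (z : R * R).

Lemma bounded_on_compact K f : compact K ->
  (forall z, K z -> {for z, continuous f}) ->
  exists2 M : R, 0 <= M & forall z, K z -> `|f z| <= M.
Proof.
move=> cK cf; have cw : {within K, continuous f}.
  by apply: continuous_in_subspaceT => z; rewrite inE; exact: cf.
have [M [_ hM]] := compact_bounded (continuous_compact cw cK).
exists (`|M| + 1); first by rewrite addr_ge0.
move=> z Kz; apply: (hM (`|M| + 1)); last by exists z.
by rewrite ltr_pwDr// ler_norm.
Qed.

Lemma compact_closed_plane K : compact K -> closed K.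
Proof. by apply: compact_closed; exact: norm_hausdorff. Qed.

Lemma near_notin_compact K z : compact K -> ~ K z -> \forall y \near z, ~ K y.
Proof.
move=> /compact_closed_plane cK nKz.
by have : open_nbhs z (~` K) by [split => //; exact: closed_openC]; move=> /open_nbhs_nbhs.
Qed.

Lemma near_eq_continuous f g z : (\forall y \near z, f y = g y) ->
  {for z, continuous f} -> {for z, continuous g}.
Proof.
move=> fg cf; rewrite /prop_for /continuous_at -(nbhs_singleton fg).
exact: cvg_trans (near_eq_cvg fg) cf.
Qed.

Lemma derive_eq0_off_compact K phi v z : compact K -> (forall y, ~ K y -> phi y = 0) ->
  ~ K z -> derivable phi z v /\ 'D_v phi z = 0.
Proof.
move=> cK phi0 nKz; have near0 : \forall y \near z, (cst 0 : R * R -> R) y = phi y.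
  by apply: filterS (near_notin_compact cK nKz) => y /phi0 ->.
split; first exact: near_eq_derivable near0 (derivable_cst _ _ _).
by rewrite -(near_eq_derive _ near0) derive_cst.
Qed.

Lemma smooth2_bounded K phi : smooth2 phi -> compact K ->
  (forall z, ~ K z -> phi z = 0) -> exists2 M : R, 0 <= M & forall z, `|phi z| <= M.
Proof.
move=> sphi cK phi0.
have [M M0 hM] := bounded_on_compact cK (fun z _ => @smooth_continuous _ _ _ _ _ sphi z).
exists M => // z; have [Kz|nKz] := pselect (K z); first exact: hM.
by rewrite phi0// normr0.
Qed.

Lemma compact_sub_rect K : compact K -> exists r, K `<=` rect (- r) r (- r) r.
Proof. by move=> /compact_bounded/bounded_sub_rect. Qed.

Lemma smooth2_measurable D phi : smooth2 phi -> measurable_fun (D : set (plane R)) phi.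
Proof.
move=> sphi; apply: measurable_funTS.
by apply: continuous_measurable_planeT; exact: smooth_continuous.
Qed.

Section Domain.
Variable Omega : set (R * R).
Hypothesis oO : open Omega.
Hypothesis bO : bounded_set Omega.

Let mO : measurable (Omega : set (plane R)) := open_measurable_plane oO.

Lemma integrable_bounded_domain f (M : R) : measurable_fun (Omega : set (plane R)) f ->
  (forall z, Omega z -> `|f z| <= M) -> mu2.-integrable Omega (EFin \o f).
Proof.
move=> mf bf; apply: measurable_bounded_integrable => //.
  exact: lebesgue2_bounded_lty.
by exists M; split => [|N MN x /bf h]; [exact: num_real|exact: le_trans h (ltW MN)].
Qed.

(** The domain has finite measure and [|f| <= 1 + f^2]. *)
Lemma L2_integrable f : L2 Omega f -> mu2.-integrable Omega (EFin \o f).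
Proof.
move=> [mf f2]; have i1 : mu2.-integrable Omega (EFin \o (cst 1 : R * R -> R)).
  by apply: (@integrable_bounded_domain _ 1) => // z _; rewrite normr1.
have mfE : measurable_fun (Omega : set (plane R)) (EFin \o f).
  exact: (measurable_EFinP _ _).2.
apply: (le_integrable mO mfE _ (integrableD mO i1 f2)).
move=> z _ /=; rewrite lee_fin [leRHS]ger0_norm; last by rewrite addr_ge0// sqr_ge0.
have := sqr_ge0 (`|f z| - 1); have := sqr_ge0 (f z); rewrite sqrrB1 -normrX ger0_norm ?sqr_ge0//.
by have := normr_ge0 (f z); lra.
Qed.

Lemma integrable_mul_bounded f g (M : R) : mu2.-integrable Omega (EFin \o f) ->
  measurable_fun (Omega : set (plane R)) g -> (forall z, Omega z -> `|g z| <= M) ->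
  mu2.-integrable Omega (EFin \o (fun z => f z * g z)).
Proof.
move=> fi mg bg; have /measurable_EFinP mf := measurable_int _ fi.
have Mi := integrableZr mO M fi.
apply: (le_integrable mO _ _ Mi).
  by apply/measurable_EFinP; exact: measurable_funM.
move=> z Oz /=; rewrite lee_fin !normrM ler_wpM2l//.
exact: le_trans (bg z Oz) (ler_norm _).
Qed.

Lemma measurable_derive f (j : 'I_2) : (forall z, Omega z -> {for z, continuous f}) ->
  (forall z, Omega z -> derivable f z (dir R j)) ->
  measurable_fun (Omega : set (plane R)) ('D_(dir R j) f).
Proof.
move=> cf df; set v := dir R j.
(* Extended by 0, the function has difference quotients on the whole plane; near a point of the open
   [Omega] they eventually agree with those of [f]. *)
pose F : plane R -> R := f \_ Omega.
have mF : measurable_fun [set: plane R] F.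
  by apply/(measurable_restrictT _ _).1 => //; exact: continuous_measurable_plane.
pose Fn (n : nat) (z : plane R) : R := n.+1%:R * (F (translate (n.+1%:R^-1 *: v) z) - F z).
have mFn n : measurable_fun (Omega : set (plane R)) (Fn n).
  apply: measurable_funTS; apply: measurable_funM => //; apply: measurable_funB => //.
  exact: (measurableT_comp mF (measurable_translate _)).
apply: (measurable_fun_cvg mFn) => z Oz.
have FE : \forall y \near z, f y = F y.
  near=> y; rewrite /F patchE mem_set//; near: y; exact: open_nbhs_nbhs.
have /cvg_ex[l hl] := near_eq_derivable FE (df z Oz).
rewrite (near_eq_derive v FE); have -> : 'D_v F z = l by exact: cvg_lim.
have := cvg_comp _ _ (@cvg_harmonic_dnbhs R) hl; apply: cvg_trans; apply: near_eq_cvg.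
by near=> n; rewrite /= /Fn translate_dir invrK.
Unshelve. all: by end_near. Qed.

(** The product [f phi], extended by 0, is derivable on the whole plane since it vanishes near every
    point off [K]. Its derivative is bounded, so [Rintegral_derive_eq0] applies. *)
Lemma integration_by_parts_test f phi K (j : 'I_2) :
  (forall z, Omega z -> {for z, continuous f}) ->
  (forall z, Omega z -> derivable f z (dir R j)) ->
  (exists C : R, forall z, Omega z -> `|'D_(dir R j) f z| <= C) ->
  smooth2 phi -> compact K -> K `<=` Omega -> (forall z, ~ K z -> phi z = 0) ->
  \int[mu2]_(z in Omega) (f z * 'D_(dir R j) phi z + 'D_(dir R j) f z * phi z) = 0.
Proof.
move=> cf df [C bdf] sphi cK KO phi0; set v := dir R j.
pose W : R * R -> R := fun z => (f \_ Omega) z * phi z.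
have W0 z : ~ K z -> W z = 0 by move=> nKz; rewrite /W phi0// mulr0.
have FE z : Omega z -> \forall y \near z, f y * phi y = W y.
  move=> Oz; near=> y; rewrite /W patchE mem_set//; near: y; exact: open_nbhs_nbhs.
have WE z : Omega z -> derivable W z v /\ 'D_v W z = f z * 'D_v phi z + 'D_v f z * phi z.
  move=> Oz; have dphi : derivable phi z v := smooth_derivable sphi.
  split; first exact: near_eq_derivable (FE z Oz) (derivableM (df z Oz) dphi).
  rewrite -(near_eq_derive v (FE z Oz)) [LHS]deriveM//; last exact: df.
  by rewrite /GRing.scale/= [phi z * _]mulrC.
have WE0 z : ~ K z -> derivable W z v /\ 'D_v W z = 0 by exact: derive_eq0_off_compact.
have dW z : derivable W z v.
  by have [/KO/WE[]|/WE0[]] := pselect (K z).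
have cW : continuous W.
  move=> z; have [/KO Oz|nKz] := pselect (K z).
    have cfp : {for z, continuous (fun y => f y * phi y)}.
      by apply: cvgM; [exact: cf|exact: (smooth_continuous sphi)].
    exact: near_eq_continuous (FE z Oz) cfp.
  apply: (@near_eq_continuous (cst 0)); last exact: cst_continuous.
  by apply: filterS (near_notin_compact cK nKz) => y /W0 ->.
have [M M0 hM] := bounded_on_compact cK (fun z Kz => cf z (KO _ Kz)).
have [N N0 hN] := smooth2_bounded sphi cK phi0.
have dphi0 z : ~ K z -> 'D_v phi z = 0.
  by move=> nKz; have [] := derive_eq0_off_compact v cK phi0 nKz.
have [N' N'0 hN'] := smooth2_bounded (smooth_derive j sphi) cK dphi0.
have C0 : 0 <= `|C| by [].
have bW z : `|'D_v W z| <= M * N' + `|C| * N.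
  have [Kz|nKz] := pselect (K z); last first.
    by have [_ ->] := WE0 z nKz; rewrite normr0 addr_ge0// mulr_ge0.
  have [_ ->] := WE z (KO z Kz); rewrite (le_trans (ler_normD _ _))// lerD// normrM ler_pM//.
  - exact: hM.
  - exact: le_trans (bdf z (KO z Kz)) (ler_norm _).
have [r Kr] := compact_sub_rect cK.
have [_ int0] := Rintegral_derive_eq0 dW cW bW (r := r) (fun z nQ => W0 z (fun Kz => nQ (Kr z Kz))).
rewrite -{}int0 [LHS]Rintegral_mkcond; apply: eq_Rintegral => z _.
rewrite patchE; case: ifPn => [|/negP nOz]; first by rewrite inE => /WE[_ ->].
by have [_ ->] := WE0 z (fun Kz => nOz (mem_set (KO z Kz))).
Unshelve. all: by end_near. Qed.

(** By parts, [g] and the classical derivative have equal integrals against every test function, so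
    the fundamental lemma identifies them. *)
Lemma weak_partial_classical f g w (j : 'I_2) :
  (forall z, Omega z -> {for z, continuous f}) ->
  (forall z, Omega z -> derivable f z (dir R j)) ->
  (exists C : R, forall z, Omega z -> `|'D_(dir R j) f z| <= C) ->
  {ae mu2, forall z, Omega z -> w z = f z} -> L2 Omega w ->
  L2_weak_partial Omega j w g ->
  {ae mu2, forall z, Omega z -> g z = 'D_(dir R j) f z}.
Proof.
move=> cf df [C bdf] wf Lw [Lg wg]; set v := dir R j.
have gi := L2_integrable Lg; have mdf := measurable_derive cf df.
have dfi := integrable_bounded_domain mdf bdf.
suff : {ae mu2, forall z, Omega z -> g z - 'D_v f z = 0}.
  by move=> h; apply: (negligibleS _ h) => z nz hz; apply: nz => /hz/eqP; rewrite subr_eq0 => /eqP.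
apply: fundamental_lemma => //; first exact: (integrableB mO gi dfi).
move=> phi K sphi cK KO phi0.
have [N N0 hN] := smooth2_bounded sphi cK phi0.
have dphi0 z : ~ K z -> 'D_v phi z = 0.
  by move=> nKz; have [] := derive_eq0_off_compact v cK phi0 nKz.
have [N' N'0 hN'] := smooth2_bounded (smooth_derive j sphi) cK dphi0.
have mphi := @smooth2_measurable Omega _ sphi.
have mdphi := @smooth2_measurable Omega _ (smooth_derive j sphi).
have [M M0 hM] := bounded_on_compact cK (fun z Kz => cf z (KO _ Kz)).
have mf : measurable_fun (Omega : set (plane R)) f := continuous_measurable_plane oO cf.
have [mw _] := Lw.
have gphi := integrable_mul_bounded gi mphi (fun z _ => hN z).
have dfphi := integrable_mul_bounded dfi mphi (fun z _ => hN z).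
have wi := integrable_mul_bounded (L2_integrable Lw) mdphi (fun z _ => hN' z).
have fdphi : mu2.-integrable Omega (EFin \o (fun z => f z * 'D_v phi z)).
  apply: (@integrable_bounded_domain _ (M * N')); first exact: measurable_funM.
  move=> z Oz; rewrite normrM; have [Kz|nKz] := pselect (K z).
    by rewrite ler_pM//; exact: hM.
  by rewrite dphi0// normr0 mulr0 mulr_ge0.
have ibp := integration_by_parts_test cf df (ex_intro _ C bdf) sphi cK KO phi0.
rewrite RintegralD// in ibp.
have := wg phi (smooth_test_function sphi cK KO phi0).
have -> : \int[mu2]_(z in Omega) (w z * 'D_v phi z) = \int[mu2]_(z in Omega) (f z * 'D_v phi z).
  rewrite /Rintegral; congr fine; apply: ae_eq_integral => //.
  - exact: (measurable_int _ wi).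
  - exact: (measurable_int _ fdphi).
  - by apply: (negligibleS _ wf) => z nz hz; apply: nz => /hz /= ->.
move=> e.
have -> : \int[mu2]_(z in Omega) ((g z - 'D_v f z) * phi z) =
    \int[mu2]_(z in Omega) (g z * phi z - 'D_v f z * phi z).
  by apply: eq_Rintegral => z _; rewrite mulrBl.
rewrite RintegralB//.
by apply/eqP; rewrite subr_eq0; apply/eqP; apply: oppr_inj; rewrite -e; move: ibp; lra.
Qed.

End Domain.
End ClassicalIsWeak.

Section ComplexPartials.
Variable R : realType.
Implicit Types (v : R * R -> R * R) (z : R * R).

Lemma ler_norm_sqr (x y : R) : 0 <= y -> x ^+ 2 <= y ^+ 2 -> `|x| <= y.
Proof. by move=> y0 xy; rewrite -(ger0_norm y0) -!sqrtr_sqr ler_wsqrtr. Qed.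

(** Specialize the increment to a coordinate direction; the Cauchy-Riemann equations are encoded in
    the shape of [conf_mx]. *)
Lemma complex_diff_is_derive v z (a b : R) (i j : 'I_2) : complex_diff v z a b ->
  is_derive z (dir R j) (Defs.coord i \o v) (conf_mx a b i j).
Proof.
move=> cd; set f := Defs.coord i \o v.
have lim : h^-1 *: ((f \o shift z) (h *: dir R j) - f z) @[h --> 0^'] --> conf_mx a b i j.
  apply/cvgrPdist_le => e e0; have [d d0 hd] := cd e e0.
  near=> h; have h0 : h != 0 by near: h; exact: nbhs_dnbhs_neq.
  have hlt : `|h| < d by near: h; exact: dnbhs0_lt.
  have h2 : h ^+ 2 < d ^+ 2 by rewrite -ltr_sqrt ?exprn_gt0// !sqrtr_sqr (gtr0_norm d0).
  rewrite -(@ler_pM2l _ `|h|) ?normr_gt0// -normrM.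
  set D := _ - _; apply: ler_norm_sqr; first by rewrite mulr_ge0// ltW.
  rewrite [leRHS]exprMn (real_normK (num_real h)) [leRHS]mulrC.
  have [k [l [kl hkl dE]]] : exists k l : R, [/\ k ^+ 2 + l ^+ 2 = h ^+ 2,
      h *: dir R j + z = (z.1 + k, z.2 + l) &
      conf_mx a b i j * h = if i == 0 then a * k - b * l else a * l + b * k].
    rewrite /dir; case: (ord2P j) => -> /=.
      exists h, 0; rewrite expr0n addr0; split => //.
        by case: (z) => x y; congr pair; rewrite /= ?[_ *: _]mulr1 ?[_ *: (0 : R)]mulr0 ?add0r ?addr0// addrC.
      by rewrite mxE; case: (ord2P i) => -> /=; rewrite !mulr0 ?subr0 ?add0r.
    exists 0, h; rewrite expr0n add0r; split => //.
      by case: (z) => x y; congr pair; rewrite /= ?[_ *: _]mulr1 ?[_ *: (0 : R)]mulr0 ?add0r ?addr0// addrC.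
    by rewrite mxE; case: (ord2P i) => -> /=; rewrite !mulr0 ?sub0r ?addr0// mulNr.
  have := hd k l; rewrite kl => /(_ h2); apply: le_trans.
  have -> : h * D = - (f (z.1 + k, z.2 + l) - f z - conf_mx a b i j * h).
    by rewrite /D mulrBr /GRing.scale/= mulVKf// hkl; ring.
  rewrite sqrrN dE /complex_defect /f /=.
  by case: (ord2P i) => -> /=; rewrite /Defs.coord/= ?lerDl ?lerDr sqr_ge0.
by apply: DeriveDef; [apply/cvg_ex; exists (conf_mx a b i j); exact: lim|exact: cvg_lim lim].
Unshelve. all: by end_near. Qed.

Lemma complex_diff_continuous v z (a b : R) (i : 'I_2) : complex_diff v z a b ->
  {for z, continuous (Defs.coord i \o v)}.
Proof.
move=> cd; set f := Defs.coord i \o v.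
have [d d0 hd] := cd 1 ltr01; pose M := 2 + `|a| + `|b|.
have M0 : 0 < M by have := normr_ge0 a; have := normr_ge0 b; rewrite /M; lra.
apply/cvgrPdist_le => e e0.
suff : nbhs z [set y | `|f z - f y| <= e] by [].
apply/nbhs_ballP; exists (Num.min (d / 2) (e / (2 * M))).
  by rewrite /= lt_min !divr_gt0// mulr_gt0.
move=> y; rewrite /ball/= => -[]; rewrite /ball/= !lt_min.
rewrite distrC => /andP[k1 k2]; rewrite distrC => /andP[l1 l2].
set k := y.1 - z.1 in k1 k2; set l := y.2 - z.2 in l1 l2.
have yE : y = (z.1 + k, z.2 + l) by rewrite /k /l [y]surjective_pairing/=; congr pair; ring.
have sq (t r : R) : `|t| < r -> t ^+ 2 <= r ^+ 2.
  move=> tr; have r0 : 0 < r := le_lt_trans (normr_ge0 t) tr.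
  by rewrite -(real_normK (num_real t)) ler_sqr ?nnegrE ?(ltW r0)// ltW.
have kld : k ^+ 2 + l ^+ 2 < d ^+ 2.
  have := sq _ _ k1; have := sq _ _ l1; rewrite expr_div_n; have : 0 < d ^+ 2 by rewrite exprn_gt0.
  by lra.
have := hd k l kld; rewrite expr1n mul1r => hdef.
pose t := if i == 0 then a * k - b * l else a * l + b * k.
have ft : (f y - f z - t) ^+ 2 <= k ^+ 2 + l ^+ 2.
  apply: le_trans hdef; rewrite /complex_defect -yE /f /t /=.
  by case: (ord2P i) => -> /=; rewrite /Defs.coord/= ?lerDl ?lerDr sqr_ge0.
have ft' : `|f y - f z - t| <= `|k| + `|l|.
  apply: ler_norm_sqr; rewrite ?addr_ge0// (le_trans ft)//.
  have := mulr_ge0 (normr_ge0 k) (normr_ge0 l).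
  by rewrite -(real_normK (num_real k)) -(real_normK (num_real l)); lra.
have tM : `|t| <= (`|a| + `|b|) * (`|k| + `|l|).
  have h1 := normr_ge0 (a * l); have h2 := normr_ge0 (a * k).
  have h3 := normr_ge0 (b * l); have h4 := normr_ge0 (b * k).
  rewrite !normrM in h1 h2 h3 h4; rewrite /t; case: ifP => _.
    by apply: le_trans (ler_normB _ _) _; rewrite !normrM; lra.
  by apply: le_trans (ler_normD _ _) _; rewrite !normrM; lra.
have -> : f z - f y = - ((f y - f z - t) + t) by ring.
rewrite normrN; apply: le_trans (ler_normD _ _) _.
have : `|k| + `|l| <= e / M.
  have -> : e / M = e / (2 * M) + e / (2 * M) by field; rewrite gt_eqF.
  by rewrite lerD// ltW.
rewrite ler_pdivlMr// => h; apply: le_trans h; rewrite [leRHS]mulrC.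
apply: le_trans (lerD ft' tM) _; rewrite /M.
have := normr_ge0 k; have := normr_ge0 l; lra.
Qed.

End ComplexPartials.

(** * From zero effective energy to a pointwise condition on the weak gradient *)

Section EffectiveEnergyIntegral.
Variable R : realType.
Local Notation mu2 := (lebesgue2 R).

(* No measurability is assumed: the integral of a nonnegative function is the supremum of the
   integrals of the simple functions below it. *)
Lemma ge0_le_integral_nonmeasurable d (T : measurableType d) (mu : {measure set T -> \bar R})
    (D : set T) (f g : T -> \bar R) :
  (forall x, D x -> (0 <= f x)%E) -> (forall x, D x -> (f x <= g x)%E) ->
  (\int[mu]_(x in D) f x <= \int[mu]_(x in D) g x)%E.
Proof.
move=> f0 fg; have g0 x : D x -> (0 <= g x)%E by move=> Dx; exact: le_trans (f0 x Dx) (fg x Dx).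
rewrite !ge0_integralE//; apply: le_ereal_sup => _ [h hf <-].
exists h => // x; apply: le_trans (hf x) _; rewrite !patchE; case: ifPn => //.
by rewrite inE => /fg.
Qed.

(** As [f] may fail to be measurable, it is dominated by a measurable function: [+oo] on a
    measurable null set containing the exceptional points, and 0 elsewhere. *)
Lemma ae_eq0_integral (D : set (plane R)) (f : plane R -> \bar R) : measurable D ->
  (forall x, D x -> (0 <= f x)%E) -> {ae mu2, forall x, D x -> f x = 0%E} ->
  (\int[mu2]_(x in D) f x = 0)%E.
Proof.
move=> mD f0 [N [mN N0 fN]]; apply/eqP; rewrite eq_le; apply/andP; split; last exact: integral_ge0.
pose g : plane R -> \bar R := fun x => if x \in N then +oo%E else 0%E.
apply: (@le_trans _ _ (\int[mu2]_(x in D) g x)%E).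
  apply: ge0_le_integral_nonmeasurable => // x Dx; rewrite /g; case: ifPn => [_|/negP xN].
    exact: leey.
  have [->//|nf] := pselect (f x = 0%E); exfalso; apply: xN; rewrite inE; apply: fN.
  by move=> /(_ Dx).
have mg : measurable_fun D g.
  rewrite (_ : g = (cst +oo%E : plane R -> \bar R) \_ N); last first.
    by apply/funext => x; rewrite /g patchE.
  by apply: measurable_funTS; apply/(measurable_restrictT _ _).1.
rewrite (@ae_eq_integral _ _ _ mu2 D (cst 0%E) g) ?integral0//.
exists N; split => // x /= /not_implyP[Dx gx]; rewrite /g in gx.
by apply: contrapT => xN; apply: gx; rewrite memNset.
Qed.

Variables (M : metamaterial R) (eta : R).
Hypothesis hM : M = kagome R \/ M = rotating_squares R.
Hypothesis heta : 0 < eta < 8^-1.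

Lemma weak_grad_L2 Omega (u : R * R -> R * R) (i j : 'I_2) : H1 Omega u ->
  L2_weak_partial Omega j (Defs.coord i \o u) (fun z => weak_grad Omega u z i j).
Proof.
move=> /(_ i)[_ /(_ j)[g hg]].
have -> : (fun z => weak_grad Omega u z i j) = get (L2_weak_partial Omega j (Defs.coord i \o u)).
  by apply/funext => z; rewrite mxE.
exact: getI hg.
Qed.

Lemma measurable_conf_gap (D : set (plane R)) (F : plane R -> 'M[R]_2) :
  (forall i j, measurable_fun D (fun z => F z i j)) ->
  measurable_fun D (fun z => conf_gap (F z)).
Proof.
move=> mF; have msq (f : plane R -> R) : measurable_fun D f -> measurable_fun D (fun z => f z ^+ 2).
  by move=> mf; exact: measurable_funX.
have m4 (f : plane R -> R) : measurable_fun D f -> measurable_fun D (fun z => f z / 4).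
  by move=> mf; apply: measurable_funM.
have ma : measurable_fun D (fun z => anticonf_sqr (F z)).
  by apply: m4; apply: measurable_funD; apply: msq; [apply: measurable_funB|apply: measurable_funD].
have mc : measurable_fun D (fun z => conf_sqr (F z)).
  by apply: m4; apply: measurable_funD; apply: msq; [apply: measurable_funD|apply: measurable_funB].
apply: measurable_funD => //; apply: msq; apply: measurable_maxr => //.
apply: measurable_funB => //.
have ms : measurable_fun setT (@Num.sqrt R).
  by apply: continuous_measurable_fun; exact: sqrt_continuous.
exact: (measurableT_comp ms mc).
Qed.

(** One direction integrates the lower bound [c * conf_gap], which is measurable; the other uses
    that [Wbar] is 0 wherever [conf_gap] is. *)
Lemma Eeff_eq0_conf_gap Omega (u : R * R -> R * R) : open Omega -> H1 Omega u ->
  Eeff M eta Omega u = 0%E <->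
  {ae mu2, forall z, Omega z -> conf_gap (weak_grad Omega u z) = 0}.
Proof.
move=> oO h1; have mO := open_measurable_plane oO; split; last first.
  move=> h; apply: ae_eq0_integral => //.
    by move=> z _; exact: Wbar_ge0.
  apply: (negligibleS _ h) => z nz hz; apply: nz => Oz.
  by rewrite (Wbar_eq0 hM heta)//; exact: hz.
move=> int0; have [c c0 hc] := Wbar_ge_conf_gap hM heta.
have mg : measurable_fun (Omega : set (plane R)) (fun z => c * conf_gap (weak_grad Omega u z)).
  apply: measurable_funM => //; apply: measurable_conf_gap => i j.
  by have [[]] := weak_grad_L2 i j h1.
have g0 z : 0 <= c * conf_gap (weak_grad Omega u z).
  by rewrite mulr_ge0 ?conf_gap_ge0// ltW.
have intg : (\int[mu2]_(z in Omega) `|(c * conf_gap (weak_grad Omega u z))%:E| = 0)%E.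
  apply/eqP; rewrite eq_le; apply/andP; split; last exact: integral_ge0.
  rewrite -int0; apply: ge0_le_integral_nonmeasurable => // z _.
  by rewrite gee0_abs ?lee_fin//; exact: hc.
have mgE : measurable_fun (Omega : set (plane R)) (EFin \o (fun z => c * conf_gap (weak_grad Omega u z))).
  exact/measurable_EFinP.
have /(ae_eq_integral_abs mu2 mO mgE) ae0 := intg.
apply: (negligibleS _ ae0) => z nz hz; apply: nz => Oz.
have := hz Oz => /= -[] /eqP; rewrite mulf_eq0 (gt_eqF c0)/= => /eqP; exact.
Qed.

Lemma conformal_Eeff_eq0 Omega (u v : R * R -> R * R) : open Omega -> bounded_set Omega ->
  H1 Omega u -> compressive_conformal Omega v ->
  {ae mu2, forall z, Omega z -> u z = v z} -> Eeff M eta Omega u = 0%E.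
Proof.
move=> oO bO h1 /compressive_conformalP cc uv; apply/(Eeff_eq0_conf_gap oO h1).
have entry i j : {ae mu2, forall z, Omega z ->
    weak_grad Omega u z i j = 'D_(dir R j) (Defs.coord i \o v) z}.
  have [Lu _] := h1 i; apply: (weak_partial_classical oO bO _ _ _ _ Lu) => //.
  - by move=> z /cc[a [b [_ cd]]]; exact: complex_diff_continuous cd.
  - by move=> z /cc[a [b [_ cd]]]; have [] := complex_diff_is_derive i j cd.
  - exists 1 => z /cc[a [b [ab cd]]]; have [_ ->] := complex_diff_is_derive i j cd.
    have bound (s t : R) : s ^+ 2 + t ^+ 2 <= 1 -> `|s| <= 1.
      move=> st; rewrite -sqrtr_sqr -sqrtr1 ler_wsqrtr// (le_trans _ st)// lerDl sqr_ge0//.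
    rewrite mxE; case: ifP => _; first exact: bound ab.
    by case: ifP => _; rewrite ?normrN; apply: (bound _ a); rewrite addrC.
  - apply: (negligibleS _ uv) => z nz hz; apply: nz => Oz.
    by have /= -> := hz Oz.
  - exact: weak_grad_L2.
have e0 := negligibleU (entry 0 0) (entry 0 1); have e1 := negligibleU (entry 1 0) (entry 1 1).
apply: (negligibleS _ (negligibleU e0 e1)) => z /= /not_implyP[Oz gap].
apply: contrapT => /not_orP[/not_orP[/contrapT h00 /contrapT h01] /not_orP[/contrapT h10 /contrapT h11]].
apply: gap; have [a [b [ab cd]]] := cc z Oz.
rewrite (_ : weak_grad Omega u z = conf_mx a b); first exact: conf_gap_conf_mx.
apply/matrixP => i j; have [_ <-] := complex_diff_is_derive i j cd.
by case: (ord2P i) => ->; case: (ord2P j) => ->; [exact: h00|exact: h01|exact: h10|exact: h11].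
Qed.

End EffectiveEnergyIntegral.

(** * Mean values against radial mollifiers *)

Section RadialKernels.
Variable R : realType.
Local Notation mu2 := (lebesgue2 R).
Implicit Types (Omega K : set (R * R)) (f g phi : R * R -> R) (z w : R * R).

Lemma smooth2_radial (b : R -> R) w : smooth1 b -> smooth2 (fun z => b (dist_sqr z w)).
Proof.
by move=> sb; have := @smooth_comp _ _ _ (@dir R) b (fun z => dist_sqr z w) sb (@smooth_dist_sqr R w); exact.
Qed.

Lemma derive_radial (b : R -> R) w (j : 'I_2) z : smooth1 b ->
  'D_(dir R j) (fun z => b (dist_sqr z w)) z =
  b^`()%classic (dist_sqr z w) * (2 * (Defs.coord j z - Defs.coord j w)).
Proof.
move=> sb; have ds : derivable (fun z => dist_sqr z w) z (dir R j).
  exact: (smooth_derivable (@smooth_dist_sqr R w)).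
have [_ e] := is_derive_comp_line ds (smooth1_derivable sb).
by rewrite [LHS]e derive_dist_sqr.
Qed.

(** A Cartesian component of the radial field around [w] with profile [b]. *)
Definition radial_coord (b : R -> R) w (i : 'I_2) z : R :=
  (Defs.coord i z - Defs.coord i w) * b (dist_sqr z w).

Lemma smooth_radial_coord b w i : smooth1 b -> smooth2 (radial_coord b w i).
Proof.
move=> sb; apply: (@smoothM _ _ _ (@dir R) (fun z => Defs.coord i z - Defs.coord i w)
  (fun z => b (dist_sqr z w))); [exact: smooth_coordB|exact: smooth2_radial].
Qed.

Lemma derive_radial_coord b w (i j : 'I_2) z : smooth1 b ->
  'D_(dir R j) (radial_coord b w i) z = (i == j)%:R * b (dist_sqr z w) +
  2 * (Defs.coord i z - Defs.coord i w) * (Defs.coord j z - Defs.coord j w) *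
  b^`()%classic (dist_sqr z w).
Proof.
move=> sb; have dc : derivable (fun z => Defs.coord i z - Defs.coord i w) z (dir R j).
  exact: (smooth_derivable (@smooth_coordB R i w)).
have db : derivable (fun z => b (dist_sqr z w)) z (dir R j).
  exact: (smooth_derivable (smooth2_radial w sb)).
have := deriveM dc db; rewrite derive_coordB derive_radial// /GRing.scale/= => e.
by rewrite [LHS]e; ring.
Qed.

Lemma divergence_radial_coord b w z : smooth1 b ->
  'D_(dir R 0) (radial_coord b w 0) z + 'D_(dir R 1) (radial_coord b w 1) z =
  2 * (b (dist_sqr z w) + dist_sqr z w * b^`()%classic (dist_sqr z w)).
Proof.
move=> sb; rewrite !derive_radial_coord// !eqxx /Defs.coord/=.
move: (b _) (b^`()%classic _) => B B'; rewrite /dist_sqr; ring.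
Qed.

Definition weak_partial_smooth Omega (j : 'I_2) f g := forall phi K,
  smooth2 phi -> compact K -> K `<=` Omega -> (forall z, ~ K z -> phi z = 0) ->
  \int[mu2]_(z in Omega) (f z * 'D_(dir R j) phi z) =
  - \int[mu2]_(z in Omega) (g z * phi z).

Lemma weak_partial_smoothP Omega j f g : L2_weak_partial Omega j f g ->
  weak_partial_smooth Omega j f g.
Proof. by move=> [_ wp] phi K sphi cK KO phi0; apply: wp; exact: smooth_test_function KO phi0. Qed.

Lemma weak_partial_smooth_cst Omega j (c : R) : open Omega -> bounded_set Omega ->
  weak_partial_smooth Omega j (cst c) (cst 0).
Proof.
move=> oO bO phi K sphi cK KO phi0.
have := @integration_by_parts_test R Omega oO (cst c) phi K j.
have -> : \int[mu2]_(z in Omega) ((cst 0 : R * R -> R) z * phi z) = 0.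
  by under eq_Rintegral do rewrite mul0r; rewrite Rintegral_cst ?mul0r//; exact: open_measurable_plane.
rewrite oppr0 => <- //.
- by apply: eq_Rintegral => z _; rewrite derive_cst mul0r addr0.
- by move=> z _; exact: cst_continuous.
- by exists 0 => z _; rewrite derive_cst normr0.
Qed.

Lemma Rintegral_ae_eq Omega f g : measurable (Omega : set (plane R)) ->
  mu2.-integrable Omega (EFin \o f) -> mu2.-integrable Omega (EFin \o g) ->
  {ae mu2, forall z, Omega z -> f z = g z} ->
  \int[mu2]_(z in Omega) f z = \int[mu2]_(z in Omega) g z.
Proof.
move=> mO fi gi fg; rewrite /Rintegral; congr fine; apply: ae_eq_integral => //.
- exact: (measurable_int _ fi).
- exact: (measurable_int _ gi).
- by apply: (negligibleS _ fg) => z nz hz; apply: nz => /hz /= ->.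
Qed.

(* The field [(x b(|x|^2), y b(|x|^2))] around [w] is curl free, and its divergence is [2 G'(|x|^2)]
   with [G(s) = s b(s)]. *)
Lemma radial_annihilation Omega f f' p0 p1 q0 q1 (c : R) (b : R -> R) w (r : R) :
  open Omega -> bounded_set Omega ->
  mu2.-integrable Omega (EFin \o f) -> mu2.-integrable Omega (EFin \o f') ->
  mu2.-integrable Omega (EFin \o p0) -> mu2.-integrable Omega (EFin \o p1) ->
  mu2.-integrable Omega (EFin \o q0) -> mu2.-integrable Omega (EFin \o q1) ->
  weak_partial_smooth Omega 0 f p0 -> weak_partial_smooth Omega 1 f p1 ->
  weak_partial_smooth Omega 0 f' q0 -> weak_partial_smooth Omega 1 f' q1 ->
  {ae mu2, forall z, Omega z -> p0 z = c * q1 z} ->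
  {ae mu2, forall z, Omega z -> p1 z = - c * q0 z} ->
  smooth1 b -> (forall s, r < s -> b s = 0) ->
  (forall z, dist_sqr z w <= r -> Omega z) ->
  \int[mu2]_(z in Omega) (f z * (b (dist_sqr z w) +
    dist_sqr z w * b^`()%classic (dist_sqr z w))) = 0.
Proof.
move=> oO bO fi f'i p0i p1i q0i q1i wp0 wp1 wq0 wq1 cr0 cr1 sb b0 diskO.
have mO := open_measurable_plane oO; have cK := @compact_disk R w r.
have rc0 i z : ~ [set z | dist_sqr z w <= r] z -> radial_coord b w i z = 0.
  by move=> /= /negP; rewrite -ltNge => /b0 e; rewrite /radial_coord e mulr0.
have sr i := @smooth_radial_coord b w i sb.
have [N0 _ hN0] := smooth2_bounded (sr 0) cK (rc0 0).
have [N1 _ hN1] := smooth2_bounded (sr 1) cK (rc0 1).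
have mr i := @smooth2_measurable R Omega _ (sr i).
have mdr i j := @smooth2_measurable R Omega _ (smooth_derive j (sr i)).
have drc0 i j z : ~ [set z | dist_sqr z w <= r] z -> 'D_(dir R j) (radial_coord b w i) z = 0.
  by move=> nz; have [] := derive_eq0_off_compact (dir R j) cK (rc0 i) nz.
have [N00 _ hN00] := smooth2_bounded (smooth_derive 0 (sr 0)) cK (drc0 0 0).
have [N11 _ hN11] := smooth2_bounded (smooth_derive 1 (sr 1)) cK (drc0 1 1).
have e0 := wp0 _ _ (sr 0) cK diskO (rc0 0); have e1 := wp1 _ _ (sr 1) cK diskO (rc0 1).
have e2 := wq1 _ _ (sr 0) cK diskO (rc0 0); have e3 := wq0 _ _ (sr 1) cK diskO (rc0 1).
(* Both cross derivatives of the radial field are [2 x y b'] in coordinates [(x, y)] centred at [w];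
   moving them onto [f'] gives the equality. *)
have curl : \int[mu2]_(z in Omega) (q1 z * radial_coord b w 0 z) =
            \int[mu2]_(z in Omega) (q0 z * radial_coord b w 1 z).
  apply: oppr_inj; rewrite -e2 -e3; apply: eq_Rintegral => z _.
  by rewrite !derive_radial_coord//=; ring.
have i0 g (gi : mu2.-integrable Omega (EFin \o g)) := integrable_mul_bounded oO gi (mr 0) (fun z _ => hN0 z).
have i1 g (gi : mu2.-integrable Omega (EFin \o g)) := integrable_mul_bounded oO gi (mr 1) (fun z _ => hN1 z).
(* The Cauchy-Riemann relations replace the derivatives of [f] by those of [f'], with opposite
   signs, and by [curl] the two integrals cancel. *)
have f0 : \int[mu2]_(z in Omega) (p0 z * radial_coord b w 0 z) =
    c * \int[mu2]_(z in Omega) (q1 z * radial_coord b w 0 z).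
  rewrite -RintegralZl//; last exact: i0.
  apply: Rintegral_ae_eq => //; [exact: i0|exact: (integrableZl mO c (i0 _ q1i))|].
  by apply: (negligibleS _ cr0) => z nz hz; apply: nz => /hz ->; rewrite mulrA.
have f1 : \int[mu2]_(z in Omega) (p1 z * radial_coord b w 1 z) =
    - c * \int[mu2]_(z in Omega) (q0 z * radial_coord b w 1 z).
  rewrite -RintegralZl//; last exact: i1.
  apply: Rintegral_ae_eq => //; [exact: i1|exact: (integrableZl mO (- c) (i1 _ q0i))|].
  by apply: (negligibleS _ cr1) => z nz hz; apply: nz => /hz ->; rewrite mulrA.
have fd0 := integrable_mul_bounded oO fi (mdr 0 0) (fun z _ => hN00 z).
have fd1 := integrable_mul_bounded oO fi (mdr 1 1) (fun z _ => hN11 z).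
have two : \int[mu2]_(z in Omega) (2 * (f z * (b (dist_sqr z w) +
    dist_sqr z w * b^`()%classic (dist_sqr z w)))) = 0.
  transitivity (\int[mu2]_(z in Omega) (f z * 'D_(dir R 0) (radial_coord b w 0) z) +
                \int[mu2]_(z in Omega) (f z * 'D_(dir R 1) (radial_coord b w 1) z)).
    rewrite -RintegralD//; apply: eq_Rintegral => z _.
    by rewrite -mulrDr divergence_radial_coord//; ring.
  by rewrite e0 e1 f0 f1 curl; ring.
have -> : \int[mu2]_(z in Omega) (f z * (b (dist_sqr z w) +
    dist_sqr z w * b^`()%classic (dist_sqr z w))) =
  \int[mu2]_(z in Omega) (2^-1 * (2 * (f z * (b (dist_sqr z w) +
    dist_sqr z w * b^`()%classic (dist_sqr z w))))).
  by apply: eq_Rintegral => z _; rewrite mulKf.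
rewrite RintegralZl ?two ?mulr0//.
apply: eq_integrable (integrableD mO fd0 fd1) => // z _ /=.
rewrite -EFinD; congr EFin.
by rewrite -mulrDr divergence_radial_coord//; ring.
Qed.

Fact kernel_key : unit. Proof. exact: tt. Qed.

(* Locked: conversion problems between two kernels would otherwise unfold [step]. *)
Definition kernel (t : R) : R -> R :=
  locked_with kernel_key (fun s => step (t^-1 * s))^`()%classic.

Lemma kernelE (t : R) : kernel t = (fun s => step (t^-1 * s))^`()%classic.
Proof. by rewrite /kernel unlock. Qed.

Lemma smooth_step_scale (t : R) : smooth1 (fun s : R => step (t^-1 * s)).
Proof.
have h1 : smooth1 (fun s : R => t^-1 * s).
  by apply: eq_smooth (@smooth1_affine R t^-1 0) => s; rewrite addr0.
by have := @smooth_comp _ _ _ unit_dir (@step R) (fun s : R => t^-1 * s) (@smooth_step R) h1; exact.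
Qed.

Lemma smooth_kernel t : smooth1 (kernel t).
Proof. by rewrite kernelE; apply: smooth1_derive1; exact: smooth_step_scale. Qed.

Lemma kernel_ge0 t s : 0 < t -> 0 <= kernel t s.
Proof.
move=> t0; rewrite kernelE; apply: nondecreasing_derive1_ge0.
  by move=> x y xy; apply: step_homo; rewrite ler_pM2l ?invr_gt0.
exact/smooth1_derivable/smooth_step_scale.
Qed.

Lemma kernel_eq0 t s : 0 < t -> s < t \/ 2 * t < s -> kernel t s = 0.
Proof.
move=> t0; rewrite kernelE => -[st|ts].
  apply: (@near_cst_derive1_eq0 _ _ 0); near=> y; rewrite step_eq0//.
  by rewrite -ler_pdivlMl ?invr_gt0// invrK mulr1 ltW//; near: y; exact: lt_nbhsl.
apply: (@near_cst_derive1_eq0 _ _ 1); near=> y; rewrite step_eq1//.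
by rewrite -ler_pdivrMl ?invr_gt0// invrK mulrC ltW//; near: y; exact: lt_nbhsr.
Unshelve. all: by end_near. Qed.

(* A smooth function equal to [1 / s] for [s >= m]. *)
Lemma smooth_inverse_cutoff (m : R) : 0 < m ->
  exists2 gam : R -> R, smooth1 gam & forall s, m <= s -> gam s = s^-1.
Proof.
move=> m0; pose th (s : R) := step ((m / 2)^-1 * s).
(* A convex combination of [s] and 1 that equals 1 for [s <= m / 2] and [s] for [s >= m], hence
   positive everywhere. *)
pose den (s : R) := s * th s + (1 + -1 * th s).
have sth : smooth1 th by exact: smooth_step_scale.
have sden : smooth1 den.
  apply: (@smoothD _ _ _ unit_dir (fun s : R => s * th s) (fun s => 1 + -1 * th s)).
    by apply: (@smoothM _ _ _ unit_dir (@id R) th) => //; exact: smooth1_id.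
  apply: (@smoothD _ _ _ unit_dir (cst 1) (fun s : R => -1 * th s)); first exact: smooth_cst.
  by apply: (@smoothM _ _ _ unit_dir (cst (-1)) th) => //; exact: smooth_cst.
have den0 s : den s != 0.
  have [sm|ms] := leP s (m / 2).
    rewrite /den /th step_eq0 ?mulr0 ?add0r ?addr0 ?oner_eq0//.
    by rewrite -ler_pdivlMl ?invr_gt0 ?divr_gt0// invrK mulr1.
  have s0 : 0 < s by apply: lt_trans ms; rewrite divr_gt0.
  have t0 : 0 <= th s by exact: step_ge0.
  have t1 : th s <= 1 by exact: step_le1.
  rewrite gt_eqF// /den; have [t2|t2] := eqVneq (th s) 0; first by rewrite t2; lra.
  have tp : 0 < th s by rewrite lt_neqAle eq_sym t2.
  by have := mulr_gt0 s0 tp; move: (s * th s) => q q0; lra.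
exists (fun s => (den s)^-1); first exact: smoothV.
move=> s ms; congr (_^-1); rewrite /den /th step_eq1; first by ring.
by rewrite -ler_pdivrMl ?invr_gt0 ?divr_gt0// invrK divfK.
Qed.

(** The left side of the identity is the derivative of [s b(s)], so [b] is the difference of the two
    scaled steps divided by [s]. That difference vanishes up to [min t t'], which lets a smooth
    [gam] stand for [1 / s], and again where both steps have reached 1. *)
Lemma kernel_primitive (t t' : R) : 0 < t -> 0 < t' ->
  exists b : R -> R, [/\ smooth1 b,
    forall s, 2 * Num.max t t' < s -> b s = 0 &
    forall s, 0 <= s -> b s + s * b^`()%classic s = kernel t s - kernel t' s].
Proof.
move=> t0 t'0; have m0 : 0 < Num.min t t' by rewrite lt_min t0.
have [gam sgam gamE] := smooth_inverse_cutoff m0.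
pose th (u s : R) := step (u^-1 * s).
pose D (s : R) := th t s + -1 * th t' s.
have sth u : smooth1 (th u) by exact: smooth_step_scale.
have sD : smooth1 D.
  apply: (@smoothD _ _ _ unit_dir (th t) (fun s : R => -1 * th t' s)) => //.
  by apply: (@smoothM _ _ _ unit_dir (cst (-1)) (th t')) => //; exact: smooth_cst.
pose b (s : R) := D s * gam s.
have sb : smooth1 b by exact: (@smoothM _ _ _ unit_dir D gam).
have scaled (u s : R) : 0 < u -> (u^-1 * s <= 1) = (s <= u).
  by move=> u0; rewrite -[in RHS](ler_pM2l (_ : 0 < u^-1)) ?invr_gt0// mulVf ?gt_eqF.
exists b; split => // [s|s s0].
  move=> hs; have {hs} : 2 * t < s /\ 2 * t' < s.
    by move: hs; rewrite maxr_pMr// gt_max => /andP[].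
  move=> [ts t's]; rewrite /b /D /th !step_eq1 ?mulr1 ?subrr ?mul0r//.
  - by rewrite -ler_pdivrMl ?invr_gt0// invrK mulrC ltW.
  - by rewrite -ler_pdivrMl ?invr_gt0// invrK mulrC ltW.
have sbE : (fun s : R => s * b s) = D.
  apply/funext => x; rewrite /b; have [xm|mx] := leP x (Num.min t t').
    have : x <= t /\ x <= t' by move: xm; rewrite le_min => /andP[].
    by move=> [xt xt']; rewrite /D /th !step_eq0 ?scaled// !(mulr0, mul0r, addr0).
  rewrite gamE ?ltW// mulrCA divff ?mulr1// gt_eqF//; exact: lt_trans mx.
have db := smooth1_derivable sb.
have <- : D^`()%classic s = kernel t s - kernel t' s.
  have d1 := smooth1_derivable (sth t); have d2 := smooth1_derivable (sth t').
  rewrite !kernelE !derive1E (_ : D = th t \- th t'); first by rewrite deriveB.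
  by apply/funext => x; rewrite /D mulN1r.
rewrite -sbE !derive1E.
have := deriveM (@derivable_id _ R^o s 1) (db s).
rewrite derive_id /GRing.scale/= => e; rewrite [RHS]e; ring.
Qed.

End RadialKernels.

(** * Radial means and their normalization *)

Section RadialMeans.
Variable R : realType.
Local Notation mu2 := (lebesgue2 R).
Implicit Types (Omega K : set (R * R)) (f g phi : R * R -> R) (z w : R * R) (t : R).

(** A weak mean value property: with [G(s) = s b(s)], the function is orthogonal to [G'(|z - w|^2)].
    It retains from the Cauchy-Riemann system what the comparison of radii needs. *)
Definition radially_harmonic Omega f := forall (b : R -> R) w r,
  smooth1 b -> (forall s, r < s -> b s = 0) -> (forall z, dist_sqr z w <= r -> Omega z) ->
  \int[mu2]_(z in Omega) (f z * (b (dist_sqr z w) +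
    dist_sqr z w * b^`()%classic (dist_sqr z w))) = 0.

Definition mollifier t w : R * R -> R := fun z => kernel t (dist_sqr z w).

Lemma smooth_mollifier t w : smooth2 (mollifier t w).
Proof. exact: (@smooth2_radial R (kernel t) w (@smooth_kernel R t)). Qed.

Lemma mollifier_ge0 t w z : 0 < t -> 0 <= mollifier t w z.
Proof. exact: kernel_ge0. Qed.

Lemma mollifier_eq0 t w z : 0 < t -> ~ [set y | dist_sqr y w <= 2 * t] z -> mollifier t w z = 0.
Proof. by move=> t0 /= /negP; rewrite -ltNge => h; apply: kernel_eq0 => //; right. Qed.

Lemma mollifier_bounded t w : 0 < t -> exists2 C : R, 0 <= C & forall z, `|mollifier t w z| <= C.
Proof.
move=> t0; apply: (smooth2_bounded (smooth_mollifier t w) (@compact_disk R w (2 * t))) => z.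
exact: mollifier_eq0.
Qed.

Lemma mollifierC t w z : mollifier t w z = mollifier t z w.
Proof. by rewrite /mollifier dist_sqrC. Qed.

Lemma measurable_mollifier t w (D : set (plane R)) : measurable_fun D (mollifier t w).
Proof. exact: smooth2_measurable (smooth_mollifier t w). Qed.

Lemma integrable_mollifier Omega f t w : open Omega -> 0 < t ->
  mu2.-integrable Omega (EFin \o f) ->
  mu2.-integrable Omega (EFin \o (fun z => f z * mollifier t w z)).
Proof.
move=> oO t0 fi; have [C _ hC] := mollifier_bounded w t0.
by apply: (integrable_mul_bounded oO fi _ (fun z _ => hC z)); exact: measurable_mollifier.
Qed.

(** By [kernel_primitive], the difference of the two mollifiers has the form to which
    [radially_harmonic] applies. *)
Lemma radial_mean_indep Omega f t t' w : open Omega -> mu2.-integrable Omega (EFin \o f) ->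
  radially_harmonic Omega f -> 0 < t -> 0 < t' ->
  (forall z, dist_sqr z w <= 2 * t -> Omega z) -> (forall z, dist_sqr z w <= 2 * t' -> Omega z) ->
  \int[mu2]_(z in Omega) (f z * mollifier t w z) =
  \int[mu2]_(z in Omega) (f z * mollifier t' w z).
Proof.
move=> oO fi hf t0 t'0 dt dt'; have mO := open_measurable_plane oO.
have [b [sb b0 bE]] := kernel_primitive t0 t'0.
have := hf b w _ sb b0; have -> : \int[mu2]_(z in Omega) (f z * (b (dist_sqr z w) +
    dist_sqr z w * b^`()%classic (dist_sqr z w))) =
    \int[mu2]_(z in Omega) (f z * mollifier t w z - f z * mollifier t' w z).
  by apply: eq_Rintegral => z _; rewrite bE ?dist_sqr_ge0// mulrBr.
have i1 := integrable_mollifier w oO t0 fi; have i2 := integrable_mollifier w oO t'0 fi.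
rewrite (RintegralB mO i1 i2) => h; apply/eqP; rewrite -subr_eq0; apply/eqP; apply: h => z.
by case: (leP t t') => _; [exact: dt'|exact: dt].
Qed.

Lemma radially_harmonic_cst Omega (c : R) : open Omega -> bounded_set Omega ->
  radially_harmonic Omega (cst c).
Proof.
move=> oO bO b w r sb b0 dO.
have ci (a : R) : mu2.-integrable Omega (EFin \o (cst a : R * R -> R)).
  by apply: (integrable_bounded_domain oO bO (M := `|a|)).
have wc (j : 'I_2) (a : R) := @weak_partial_smooth_cst R Omega j a oO bO.
apply: (@radial_annihilation R Omega (cst c) (cst 0) (cst 0) (cst 0) (cst 0) (cst 0) 0 b w r) => //.
- by apply: aeW => z _; rewrite mul0r.
- by apply: aeW => z _; rewrite mulr0.
Qed.

(** The normalizing constant for all centres and all [t]; in polar coordinates it is pi, as each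
    kernel has integral 1 on the half line. *)
Definition mollifier_mass : R := \int[mu2]_z mollifier 1 (0, 0) z.

Lemma Rintegral_mollifier_setT Omega t w : open Omega -> 0 < t ->
  (forall z, dist_sqr z w <= 2 * t -> Omega z) ->
  \int[mu2]_(z in Omega) mollifier t w z = \int[mu2]_z mollifier t w z.
Proof.
move=> oO t0 dO; rewrite [LHS]Rintegral_mkcond; apply: eq_Rintegral => z _.
rewrite patchE; case: ifPn => // /negP nO; rewrite mollifier_eq0// => /dO Oz.
by apply: nO; rewrite inE.
Qed.

(** Translate the centre to the origin, then apply the independence of [t] to the constant function
    1 on a square containing both disks. *)
Lemma Rintegral_mollifierT t w : 0 < t ->
  \int[mu2]_z mollifier t w z = mollifier_mass.
Proof.
move=> t0.
have -> : \int[mu2]_z mollifier t w z = \int[mu2]_z mollifier t (0, 0) z.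
  have -> : \int[mu2]_z mollifier t w z =
      \int[mu2]_z (mollifier t (0, 0) (translate (- w.1, - w.2) z)).
    by apply: eq_Rintegral => z _; rewrite /mollifier /dist_sqr/= !subr0.
  apply: Rintegral_translate; first exact: measurable_mollifier.
  have [C C0 hC] := mollifier_bounded w t0.
  have [r Kr] := compact_sub_rect (@compact_disk R w (2 * t)).
  have e : mollifier t (0, 0) \o translate (- w.1, - w.2) = mollifier t w.
    by apply/funext => z; rewrite /mollifier /dist_sqr/= !subr0.
  rewrite e; apply: (@integrable_bounded_support _ _ C r) => //.
    exact: measurable_mollifier.
  by move=> z nz; apply: mollifier_eq0 => // /Kr.
rewrite /mollifier_mass.
have [r Kr] := compact_sub_rect (@compact_disk R (0, 0) (2 * Num.max t 1)).
pose Q : set (R * R) := rect (- r) r (- r) r.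
have oQ : open Q by exact: open_rect.
have bQ : bounded_set Q.
  exists `|r|; split => // M rM z [z1 z2]; rewrite /= prod_normE/= ge_max.
  by rewrite !ler_norml; have := ler_norm r; move: z1 z2 => /andP[? ?] /andP[? ?] ?;
    apply/andP; split; apply/andP; split; lra.
have sub s : 0 < s -> s <= Num.max t 1 -> forall z, dist_sqr z (0, 0) <= 2 * s -> Q z.
  by move=> s0 st z zs; apply: Kr => /=; apply: le_trans zs _; rewrite ler_pM2l.
have st : forall z, dist_sqr z (0, 0) <= 2 * t -> Q z by apply: sub => //; rewrite le_max lexx.
have s1 : forall z, dist_sqr z (0, 0) <= 2 * 1 -> Q z by apply: sub; rewrite ?le_max ?lexx ?orbT.
rewrite -(Rintegral_mollifier_setT oQ t0 st) -(Rintegral_mollifier_setT oQ ltr01 s1).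
have := @radial_mean_indep Q (cst 1) t 1 (0, 0) oQ.
have e s : \int[mu2]_(z in Q) ((cst 1 : R * R -> R) z * mollifier s (0, 0) z) =
    \int[mu2]_(z in Q) mollifier s (0, 0) z.
  by apply: eq_Rintegral => z _; rewrite mul1r.
rewrite !e; apply => //.
- by apply: (integrable_bounded_domain oQ bQ (M := 1)) => // z _; rewrite normr1.
- exact: radially_harmonic_cst.
Qed.

Lemma Rintegral_mollifier Omega t w : open Omega -> 0 < t ->
  (forall z, dist_sqr z w <= 2 * t -> Omega z) ->
  \int[mu2]_(z in Omega) mollifier t w z = mollifier_mass.
Proof.
by move=> oO t0 dO; rewrite (Rintegral_mollifier_setT oO t0 dO); exact: Rintegral_mollifierT.
Qed.

Lemma lebesgue2_rect_gt0 (a b c d : R) : a < b -> c < d -> (0 < lebesgue2 R (rect a b c d))%E.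
Proof.
move=> ab cd; have -> : lebesgue2 R (rect a b c d) =
    (lebesgue_measure (`]a, b[%classic : set R) * lebesgue_measure (`]c, d[%classic : set R))%E.
  by rewrite rectE; apply: product_measure1E; exact: measurable_itv.
by rewrite !lebesgue_measure_itv/= !lte_fin ab cd -!EFinB -EFinM lte_fin mulr_gt0 ?subr_gt0.
Qed.

(** The scaled step climbs from 0 at [t] to 1 at [2 t], so the mean value theorem yields a point of
    positive slope. *)
Lemma kernel_gt0 t : 0 < t -> exists2 s : R, 0 < s & 0 < kernel t s.
Proof.
move=> t0; pose g (s : R) := step (t^-1 * s).
have sg := smooth_step_scale t.
have dg (s : R) : derivable g s 1 by exact: smooth1_derivable.
have t2 : t < 2 * t by lra.
have cg : {within `[t, 2 * t], continuous g}.
  apply: continuous_subspaceT; exact: (smooth_continuous sg).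
have [s st e] := MVT t2 (fun x _ => DeriveDef (dg x) erefl) cg.
move: st; rewrite in_itv/= => /andP[ts _]; exists s; first exact: lt_trans ts.
rewrite kernelE derive1E; move: e; rewrite /g mulrCA mulVf ?gt_eqF// mulr1 step_eq1//.
rewrite step_eq0// subr0 => e; have p : 0 < 2 * t - t by lra.
by rewrite -(pmulr_lgt0 _ p) -e.
Qed.

Lemma mollifier_mass_gt0 : 0 < mollifier_mass.
Proof.
have [s s0 ks] := @kernel_gt0 1 ltr01; pose k := kernel 1 s.
(* [p] has squared distance [s] from the origin, so the mollifier is [k] there and exceeds [k / 2]
   on a rectangle around it. *)
pose p : R * R := (Num.sqrt s, 0); pose A : set (R * R) := [set z | k / 2 < mollifier 1 (0, 0) z].
have cm := smooth_continuous (smooth_mollifier 1 (0, 0)).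
have oA : open A.
  have /continuousP/(_ _ (@open_gt R (k / 2))) := cm; exact.
have Ap : A p.
  rewrite /A /= /mollifier /dist_sqr /p /= !subr0 sqr_sqrtr ?ltW// expr0n addr0.
  by rewrite -/k; move: ks; rewrite -/k; lra.
have [q [qA [/andP[q1 q2] /andP[q3 q4]]]] := rat_rect_nbhs oA Ap.
have Q0 : (0 < mu2 (rat_rect q))%E.
  by apply: lebesgue2_rect_gt0; [exact: lt_trans q1 q2|exact: lt_trans q3 q4].
have mQ : measurable (rat_rect q : set (plane R)) by exact: measurable_rect.
have mm : measurable_fun setT (EFin \o mollifier 1 (0, 0) : plane R -> \bar R).
  by apply/measurable_EFinP; exact: measurable_mollifier.
have k2 : 0 < k / 2 by rewrite divr_gt0.
have ge0 z : (0 <= (mollifier 1 (0, 0) z)%:E)%E by rewrite lee_fin mollifier_ge0.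
have lb : ((k / 2)%:E * mu2 (rat_rect q) <= \int[mu2]_z (mollifier 1 (0, 0) z)%:E)%E.
  rewrite -(integral_cst mu2 mQ); apply: (@le_trans _ _
    (\int[mu2]_(z in rat_rect q) (mollifier 1 (0, 0) z)%:E)%E).
    apply: ge0_le_integral => //.
    - by move=> z _; rewrite lee_fin ltW.
    - exact: measurable_funS mm.
    - by move=> z /qA hz; rewrite lee_fin ltW.
  by apply: ge0_subset_integral.
rewrite /mollifier_mass /Rintegral fine_gt0//; apply/andP; split.
  by apply: lt_le_trans lb; rewrite mule_gt0// lte_fin.
have [C C0 hC] := mollifier_bounded (0, 0) ltr01.
have [r Kr] := compact_sub_rect (@compact_disk R (0, 0) (2 * 1)).
have := @integrable_bounded_support R (mollifier 1 (0, 0)) C r.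
move=> /(_ (@measurable_mollifier 1 (0, 0) setT) hC) hi.
have {}hi := hi (fun z nz => mollifier_eq0 ltr01 (fun d => nz (Kr z d))).
by have := integrable_fin_num measurableT hi; rewrite ge0_fin_numE//; apply: integral_ge0 => z _; exact: ge0.
Qed.

End RadialMeans.

Section MeanValue.
Variable R : realType.
Local Notation mu2 := (lebesgue2 R).
Implicit Types (Omega K : set (R * R)) (f g phi : R * R -> R) (z w : R * R) (t : R).

Lemma derive_radial_coord_translate (b : R -> R) w (i j : 'I_2) z : smooth1 b ->
  'D_(dir R j) (radial_coord b w i) z =
  'D_(dir R j) (radial_coord b (0, 0) i) (z.1 - w.1, z.2 - w.2).
Proof.
move=> sb; rewrite !derive_radial_coord//.
have -> : dist_sqr (z.1 - w.1, z.2 - w.2) (0, 0) = dist_sqr z w.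
  by rewrite /dist_sqr/= !subr0.
have e (l : 'I_2) : Defs.coord l (z.1 - w.1, z.2 - w.2) - Defs.coord l (0, 0) =
    Defs.coord l z - Defs.coord l w.
  by rewrite /Defs.coord/=; case: ifP => _; rewrite subr0.
by rewrite !e.
Qed.

Lemma derive_mollifier t w (j : 'I_2) : 'D_(dir R j) (mollifier t w) =
  fun z => 2 * radial_coord (kernel t)^`()%classic w j z.
Proof.
apply/funext => z; rewrite derive_radial; last exact: smooth_kernel.
by rewrite /radial_coord mulrC -mulrA.
Qed.

Lemma derive2_mollifier t w (i j : 'I_2) z :
  'D_(dir R j) ('D_(dir R i) (mollifier t w)) z =
  2 * 'D_(dir R j) (radial_coord (kernel t)^`()%classic w i) z.
Proof.
apply: etrans (congr1 (fun F => 'D_(dir R j) F z) (derive_mollifier t w i)) _.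
have sk : smooth1 (kernel t)^`()%classic by apply: smooth1_derive1; exact: smooth_kernel.
have dr : derivable (radial_coord (kernel t)^`()%classic w i) z (dir R j).
  exact: (smooth_derivable (smooth_radial_coord w i sk)).
exact: (deriveZ 2 dr).
Qed.

(* The bound is uniform in the centre of the mollifier. *)
Lemma derive2_mollifier_bounded t : 0 < t -> exists2 C : R, 0 <= C &
  forall w (i j : 'I_2) z, `|'D_(dir R j) ('D_(dir R i) (mollifier t w)) z| <= C.
Proof.
move=> t0; pose D i j := 'D_(dir R j) ('D_(dir R i) (mollifier t (0, 0))).
pose K := [set z : R * R | dist_sqr z (0, 0) <= 2 * t].
have cK : compact K by exact: compact_disk.
have sm := smooth_mollifier t (0, 0).
have D1 i z : ~ K z -> 'D_(dir R i) (mollifier t (0, 0)) z = 0.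
  by move=> nz; have [] := derive_eq0_off_compact (dir R i) cK (fun y => mollifier_eq0 t0) nz.
have D2 i j z : ~ K z -> D i j z = 0.
  by move=> nz; have [] := derive_eq0_off_compact (dir R j) cK (D1 i) nz.
have bD i j : exists2 C : R, 0 <= C & forall z, `|D i j z| <= C.
  exact: (smooth2_bounded (smooth_derive j (smooth_derive i sm)) cK (D2 i j)).
have [C00 p00 h00] := bD 0 0; have [C01 p01 h01] := bD 0 1.
have [C10 p10 h10] := bD 1 0; have [C11 p11 h11] := bD 1 1.
have C0 : 0 <= C00 + C01 + C10 + C11 by rewrite !addr_ge0.
exists (C00 + C01 + C10 + C11); first exact: C0.
move=> w i j z.
have e : 'D_(dir R j) ('D_(dir R i) (mollifier t w)) z = D i j (z.1 - w.1, z.2 - w.2).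
  apply: etrans (derive2_mollifier t w i j z) _.
  apply: etrans _ (esym (derive2_mollifier t (0, 0) i j _)).
  apply: congr1; apply: derive_radial_coord_translate.
  by apply: smooth1_derive1; exact: smooth_kernel.
rewrite e; clear e; clearbody D; move: (z.1 - w.1, z.2 - w.2) => y.
have := h00 y; have := h01 y; have := h10 y; have := h11 y.
by case: (ord2P i) => ->; case: (ord2P j) => ->; lra.
Qed.

Lemma taylor_dir (W : R * R -> R) (j : 'I_2) (C h : R) z :
  (forall x, derivable W x (dir R j)) ->
  (forall x, derivable ('D_(dir R j) W) x (dir R j)) ->
  (forall x, `|'D_(dir R j) ('D_(dir R j) W) x| <= C) ->
  `|W (h *: dir R j + z) - W z - h * 'D_(dir R j) W z| <= C * h ^+ 2.
Proof.
set v := dir R j => dW d2W bW; pose g (s : R) := W (s *: v + z).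
have C0 : 0 <= C := le_trans (normr_ge0 _) (bW z).
have dg (s : R) : is_derive s 1 g ('D_v W (s *: v + z)) by exact: derivable_line.
have mvt (a b : R) : a < b -> exists2 c, a < c < b &
    W (b *: v + z) - W (a *: v + z) = 'D_v W (c *: v + z) * (b - a).
  move=> ab; have [c cab e] : exists2 c, c \in `]a, b[ & g b - g a = 'D_v W (c *: v + z) * (b - a).
    apply: (MVT ab (fun x _ => dg x)).
    apply: continuous_subspaceT => x; apply: differentiable_continuous.
    by apply/derivable1_diffP; case: (dg x).
  by exists c => //; move: cab; rewrite in_itv.
have close (c : R) : `|c| <= `|h| ->
    `|W (h *: v + z) - W z - h * 'D_v W z| <= `|h| * `|'D_v W (c *: v + z) - 'D_v W z| ->
    `|W (h *: v + z) - W z - h * 'D_v W z| <= C * h ^+ 2.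
  move=> ch /le_trans; apply; rewrite -real_normK ?num_real// expr2 mulrCA ler_wpM2l//.
  apply: le_trans (bounded_derive_lipschitz z c d2W bW) _.
  by rewrite ler_wpM2l.
have [h0|h0|->] := ltgtP h 0.
- have [c /andP[hc c0]] := mvt h 0 h0; rewrite scale0r add0r sub0r => e.
  apply: (close c); first by rewrite !ltr0_norm//; lra.
  by rewrite -normrM le_eqVlt; apply/orP; left; apply/eqP; congr `|_|; lra.
- have [c /andP[c0 hc]] := mvt 0 h h0; rewrite scale0r add0r subr0 => e.
  apply: (close c); first by rewrite !gtr0_norm//; lra.
  by rewrite -normrM e le_eqVlt; apply/orP; left; apply/eqP; congr `|_|; ring.
- by rewrite scale0r add0r mul0r subrr subr0 normr0 expr0n mulr0.
Qed.

(** Go from [z] horizontally to [y], then vertically. The mixed second derivative accounts for the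
    vertical slope being taken at [y] instead of [z]. *)
Lemma taylor_plane (W : R * R -> R) (C h k : R) z : smooth2 W ->
  (forall (i j : 'I_2) x, `|'D_(dir R j) ('D_(dir R i) W) x| <= C) ->
  `|W (z.1 + h, z.2 + k) - W z - (h * 'D_(dir R 0) W z + k * 'D_(dir R 1) W z)|
    <= 2 * C * (h ^+ 2 + k ^+ 2).
Proof.
move=> sW bW; have C0 : 0 <= C := le_trans (normr_ge0 _) (bW 0 0 z).
have dW j x : derivable W x (dir R j) := smooth_derivable sW.
have d2W i j x : derivable ('D_(dir R i) W) x (dir R j) := smooth_derivable (smooth_derive i sW).
pose y : R * R := (z.1 + h, z.2).
have yE : h *: dir R 0 + z = y.
  by rewrite -translate_dir /translate /dir/= /GRing.scale/= mulr1 mulr0 addr0.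
have wE : k *: dir R 1 + y = (z.1 + h, z.2 + k).
  by rewrite -translate_dir /translate /dir/= /GRing.scale/= mulr1 mulr0 addr0.
have t1 := taylor_dir h z (dW 0) (d2W 0 0) (bW 0 0).
have t2 := taylor_dir k y (dW 1) (d2W 1 1) (bW 1 1).
have t3 := bounded_derive_lipschitz z h (d2W 1 0) (bW 1 0).
rewrite yE in t1 t3; rewrite wE in t2.
have -> : W (z.1 + h, z.2 + k) - W z - (h * 'D_(dir R 0) W z + k * 'D_(dir R 1) W z) =
  (W (z.1 + h, z.2 + k) - W y - k * 'D_(dir R 1) W y) +
  ((W y - W z - h * 'D_(dir R 0) W z) + k * ('D_(dir R 1) W y - 'D_(dir R 1) W z)) by ring.
apply: le_trans (ler_normD _ _) _; apply: le_trans (lerD t2 (ler_normD _ _)) _.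
apply: le_trans (lerD (lexx _) (lerD t1 (lexx _))) _; rewrite normrM.
have t4 : `|k| * `|'D_(dir R 1) W y - 'D_(dir R 1) W z| <= C * (`|h| * `|k|).
  by rewrite [`|h| * _]mulrC mulrCA ler_wpM2l.
apply: le_trans (lerD (lexx _) (lerD (lexx _) t4)) _.
rewrite [2 * C]mulrC -mulrA -!mulrDr ler_wpM2l//.
have := sqr_ge0 (`|h| - `|k|); rewrite -(real_normK (num_real h)) -(real_normK (num_real k)).
by have := normr_ge0 h; have := normr_ge0 k; nra.
Qed.

End MeanValue.

(** * The smooth representative and its first-order expansion *)

Section ConformalRepresentative.
Variable R : realType.
Local Notation mu2 := (lebesgue2 R).
Local Notation mass := (mollifier_mass R).
Implicit Types (Omega K : set (R * R)) (f g phi : R * R -> R) (z w : R * R) (t : R).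

Lemma norm_Rintegral_mul_le Omega f g (M : R) : open Omega -> mu2.-integrable Omega (EFin \o f) ->
  measurable_fun (Omega : set (plane R)) g -> (forall z, Omega z -> `|g z| <= M) ->
  `|\int[mu2]_(z in Omega) (f z * g z)| <= M * \int[mu2]_(z in Omega) `|f z|.
Proof.
move=> oO fi mg bg; have mO := open_measurable_plane oO.
have ni := integrable_norm fi.
have Mi : mu2.-integrable Omega (EFin \o (fun z => M * `|f z|)).
  exact: (integrableZl mO M ni).
have fgi := integrable_mul_bounded oO fi mg bg.
have fgi' : mu2.-integrable Omega (EFin \o (fun z => `|f z * g z|)).
  exact: (integrable_norm fgi).
apply: le_trans (le_normr_Rintegral mO fgi) _.
rewrite -(RintegralZl M mO ni); apply: le_Rintegral => // z Oz.
by rewrite normrM mulrC ler_wpM2r// bg.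
Qed.

(** The disk is the one outside which [mollifier t w] vanishes. *)
Definition admissible Omega w t := 0 < t /\ forall z, dist_sqr z w <= 2 * t -> Omega z.

Lemma admissible_exists Omega w : open Omega -> Omega w -> exists t, admissible Omega w t.
Proof.
move=> oO Ow; have [r r0 hr] := open_disk oO Ow; exists (r / 2); split; first by rewrite divr_gt0.
by move=> z; rewrite mulrC divfK// => /hr.
Qed.

Lemma admissibleW Omega w t t' : 0 < t' -> t' <= t -> admissible Omega w t -> admissible Omega w t'.
Proof.
by move=> t'0 t't [t0 h]; split => // z zt; apply: h; apply: le_trans zt _; rewrite ler_pM2l.
Qed.

(** [|z - w0|^2 <= 2 |z - w|^2 + 2 |w - w0|^2 <= 6 t], within the [8 t] allowed at [w0]. So one [t]
    serves all centres near [w0]. *)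
Lemma admissible_near Omega w0 w t : 0 < t -> admissible Omega w0 (4 * t) ->
  dist_sqr w w0 <= t -> admissible Omega w t.
Proof.
move=> t0 [_ h] wt; split => // z zt; apply: h; move: wt zt; rewrite /dist_sqr.
by have := sqr_ge0 ((z.1 - w.1) - (w.1 - w0.1)); have := sqr_ge0 ((z.2 - w.2) - (w.2 - w0.2)); nra.
Qed.

(** [get] selects some radius at each point, with no regularity in [w]; [mean_valueE] replaces it by
    any admissible one. *)
Definition mean_value Omega f w : R :=
  mass^-1 * \int[mu2]_(z in Omega) (f z * mollifier (get (admissible Omega w)) w z).

Lemma mean_valueE Omega f w t : open Omega -> mu2.-integrable Omega (EFin \o f) ->
  radially_harmonic Omega f -> admissible Omega w t ->
  mean_value Omega f w = mass^-1 * \int[mu2]_(z in Omega) (f z * mollifier t w z).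
Proof.
move=> oO fi hf at_; have [t0 dt] := at_.
have [t'0 dt'] : admissible Omega w (get (admissible Omega w)) by apply: getI at_.
by rewrite /mean_value (radial_mean_indep oO fi hf t'0 t0 dt' dt).
Qed.

(** A derivative in the centre is minus the derivative in the variable, so it can be moved onto [f]
    as a weak derivative. *)
Lemma derive_mollifierC t w z (j : 'I_2) :
  'D_(dir R j) (mollifier t z) w = - 'D_(dir R j) (mollifier t w) z.
Proof.
apply: etrans (congr1 (fun F : R * R -> R => F w) (derive_mollifier t z j)) _.
apply: etrans _ (esym (congr1 (fun F : R * R -> R => - F z) (derive_mollifier t w j))).
rewrite /= /radial_coord dist_sqrC; move: (_^`()%classic _) => B; ring.
Qed.

(** Integrate against [f] the expansion of the mollifier in its centre. The linear terms become the
    averages of the weak derivatives, and the remainder is controlled by the integral of [|f|]. *)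
Lemma mean_value_taylor Omega f (p : 'I_2 -> R * R -> R) w t : open Omega ->
  mu2.-integrable Omega (EFin \o f) ->
  (forall j, mu2.-integrable Omega (EFin \o p j)) ->
  radially_harmonic Omega f -> (forall j, weak_partial_smooth Omega j f (p j)) ->
  0 < t -> admissible Omega w (4 * t) ->
  let A j := mass^-1 * \int[mu2]_(z in Omega) (p j z * mollifier t w z) in
  exists2 C : R, 0 <= C & forall h k, h ^+ 2 + k ^+ 2 <= t ->
    `|mean_value Omega f (w.1 + h, w.2 + k) - mean_value Omega f w - (h * A 0 + k * A 1)|
      <= C * (h ^+ 2 + k ^+ 2).
Proof.
move=> oO fi pi hf wp t0 aw A; have mO := open_measurable_plane oO.
have m0 := mollifier_mass_gt0 R.
have [C C0 hC] := derive2_mollifier_bounded t0.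
pose N := \int[mu2]_(z in Omega) `|f z|.
have N0 : 0 <= N by apply: Rintegral_ge0.
exists (mass^-1 * (2 * C * N)); first by rewrite mulr_ge0 ?invr_ge0 ?(ltW m0)// !mulr_ge0.
move=> h k hk; pose w' : R * R := (w.1 + h, w.2 + k).
have aw0 : admissible Omega w t by apply: admissibleW aw => //; lra.
have aw' : admissible Omega w' t.
  apply: (admissible_near t0 aw); have -> : dist_sqr w' w = h ^+ 2 + k ^+ 2.
    by rewrite /dist_sqr/=; ring.
  exact: hk.
rewrite (mean_valueE oO fi hf aw0) (mean_valueE oO fi hf aw').
(* The Taylor remainder in the centre; the plus sign comes from writing the derivatives in the
   variable [z]. *)
pose g z := mollifier t w' z - mollifier t w z +
  (h * 'D_(dir R 0) (mollifier t w) z + k * 'D_(dir R 1) (mollifier t w) z).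
have gE z : g z = mollifier t z w' - mollifier t z w -
    (h * 'D_(dir R 0) (mollifier t z) w + k * 'D_(dir R 1) (mollifier t z) w).
  by rewrite /g !(derive_mollifierC t w z) (mollifierC t w' z) (mollifierC t w z); ring.
have bg z : Omega z -> `|g z| <= 2 * C * (h ^+ 2 + k ^+ 2).
  by move=> _; rewrite gE; apply: (taylor_plane h k w (smooth_mollifier t z)) => i j x; exact: hC.
have mm v : measurable_fun (Omega : set (plane R)) (mollifier t v) by exact: measurable_mollifier.
have sd j := smooth_derive j (smooth_mollifier t w).
have md j : measurable_fun (Omega : set (plane R)) ('D_(dir R j) (mollifier t w)).
  exact: smooth2_measurable (sd j).
have mg : measurable_fun (Omega : set (plane R)) g.
  apply: measurable_funD; first exact: measurable_funB.
  by apply: measurable_funD; apply: measurable_funM.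
have cK := @compact_disk R w (2 * t).
have wj j : \int[mu2]_(z in Omega) (f z * 'D_(dir R j) (mollifier t w) z) =
    - \int[mu2]_(z in Omega) (p j z * mollifier t w z).
  apply: (wp j _ _ (smooth_mollifier t w) cK); first by case: aw0.
  by move=> z; exact: mollifier_eq0.
have di j : mu2.-integrable Omega (EFin \o (fun z => f z * 'D_(dir R j) (mollifier t w) z)).
  have d0 z : ~ [set y | dist_sqr y w <= 2 * t] z -> 'D_(dir R j) (mollifier t w) z = 0.
    by move=> nz; have [] := derive_eq0_off_compact (dir R j) cK (fun y => mollifier_eq0 t0) nz.
  have [B _ hB] := smooth2_bounded (sd j) cK d0.
  exact: (integrable_mul_bounded oO fi (md j) (fun z _ => hB z)).
have i1 := integrable_mollifier w oO t0 fi; have i2 := integrable_mollifier w' oO t0 fi.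
have e : \int[mu2]_(z in Omega) (f z * g z) =
    \int[mu2]_(z in Omega) (f z * mollifier t w' z) - \int[mu2]_(z in Omega) (f z * mollifier t w z)
    - (h * \int[mu2]_(z in Omega) (p 0 z * mollifier t w z) +
       k * \int[mu2]_(z in Omega) (p 1 z * mollifier t w z)).
  transitivity (\int[mu2]_(z in Omega) ((f z * mollifier t w' z - f z * mollifier t w z) +
      (h * (f z * 'D_(dir R 0) (mollifier t w) z) + k * (f z * 'D_(dir R 1) (mollifier t w) z)))).
    by apply: eq_Rintegral => z _; rewrite /g; ring.
  have h0 := integrableZl mO h (di 0); have k1 := integrableZl mO k (di 1).
  rewrite (RintegralD mO (integrableB mO i2 i1) (integrableD mO h0 k1)).
  rewrite (RintegralB mO i2 i1) (RintegralD mO h0 k1) (RintegralZl h mO (di 0)).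
  by rewrite (RintegralZl k mO (di 1)) !wj; ring.
have -> : mass^-1 * \int[mu2]_(z in Omega) (f z * mollifier t w' z) -
    mass^-1 * \int[mu2]_(z in Omega) (f z * mollifier t w z) - (h * A 0 + k * A 1) =
    mass^-1 * \int[mu2]_(z in Omega) (f z * g z) by rewrite e /A; ring.
have mi : 0 <= mass^-1 by rewrite invr_ge0 ltW.
have -> : mass^-1 * (2 * C * N) * (h ^+ 2 + k ^+ 2) =
    mass^-1 * (2 * C * (h ^+ 2 + k ^+ 2) * N) by ring.
rewrite normrM (ger0_norm mi); apply: (ler_wpM2l mi).
exact: norm_Rintegral_mul_le.
Qed.

End ConformalRepresentative.

Section ConformalMeanValue.
Variable R : realType.
Local Notation mu2 := (lebesgue2 R).

Lemma ae_le_Rintegral (D : set (plane R)) (f g : R * R -> R) : measurable D ->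
  mu2.-integrable D (EFin \o f) -> mu2.-integrable D (EFin \o g) ->
  {ae mu2, forall z, D z -> f z <= g z} ->
  \int[mu2]_(z in D) f z <= \int[mu2]_(z in D) g z.
Proof.
move=> mD fi gi fg; rewrite -subr_ge0 -(RintegralB mD gi fi).
have di : mu2.-integrable D (EFin \o (fun z => g z - f z)) := integrableB mD gi fi.
rewrite (Rintegral_ae_eq mD di (integrable_norm di)); first by apply: Rintegral_ge0 => z _ /=.
apply: (negligibleS _ fg) => z nz hz; apply: nz => /hz zfg.
by rewrite /= ger0_norm// subr_ge0.
Qed.

Local Notation mass := (mollifier_mass R).

Variables (Omega : set (R * R)) (u : R * R -> R * R) (G : R * R -> 'M[R]_2).
Hypothesis oO : open Omega.
Hypothesis bO : bounded_set Omega.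
Hypothesis ui : forall i, mu2.-integrable Omega (EFin \o (Defs.coord i \o u)).
Hypothesis Gi : forall i j, mu2.-integrable Omega (EFin \o (fun z => G z i j)).
Hypothesis wG : forall i j, weak_partial_smooth Omega j (Defs.coord i \o u) (fun z => G z i j).
Hypothesis confG : {ae mu2, forall z, Omega z -> conf_gap (G z) = 0}.

Let mO : measurable (Omega : set (plane R)) := open_measurable_plane oO.

Let aeG (P : R * R -> Prop) :
  (forall z a b, G z = conf_mx a b -> a ^+ 2 + b ^+ 2 <= 1 -> P z) ->
  {ae mu2, forall z, Omega z -> P z}.
Proof.
move=> h; apply: (negligibleS _ confG) => z nz hz; apply: nz => /hz /conf_gap_eq0[a [b [e ab]]].
exact: h e ab.
Qed.

Lemma conformal_radially_harmonic i : radially_harmonic Omega (Defs.coord i \o u).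
Proof.
move=> b w r sb b0 dO; case: (ord2P i) => ->.
  (* The constant [c] carries the sign of the Cauchy-Riemann system: 1 for the real part, and -1 for
     the imaginary part, where the components trade places. *)
  apply: (radial_annihilation (c := 1) (r := r) oO bO (ui 0) (ui 1) (Gi 0 0) (Gi 0 1) (Gi 1 0) (Gi 1 1)
    (wG 0 0) (wG 0 1) (wG 1 0) (wG 1 1)) => //; apply: aeG => z x y -> _; rewrite !mxE/=; ring.
apply: (radial_annihilation (c := -1) (r := r) oO bO (ui 1) (ui 0) (Gi 1 0) (Gi 1 1) (Gi 0 0) (Gi 0 1)
  (wG 1 0) (wG 1 1) (wG 0 0) (wG 0 1)) => //; apply: aeG => z x y -> _; rewrite !mxE/=; ring.
Qed.

Definition conformal_representative w : R * R :=
  (mean_value Omega (Defs.coord 0 \o u) w, mean_value Omega (Defs.coord 1 \o u) w).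

(** The candidate derivative is the average of the weak gradient, which inherits the conformal shape
    and, by convexity, the bound 1. *)
Lemma conformal_representative_diff w : Omega w ->
  exists a b, a ^+ 2 + b ^+ 2 <= 1 /\ complex_diff conformal_representative w a b.
Proof.
move=> Ow; have [t4 at4] := admissible_exists oO Ow; pose t := t4 / 4.
have t0 : 0 < t by rewrite divr_gt0//; case: at4.
have aw : admissible Omega w (4 * t) by rewrite /t mulrC divfK.
have m0 := mollifier_mass_gt0 R; have mi : 0 < mass^-1 by rewrite invr_gt0.
have [_ diskO] : admissible Omega w t by apply: admissibleW aw => //; lra.
pose A i j := mass^-1 * \int[mu2]_(z in Omega) (G z i j * mollifier t w z).
have Ai i j := integrable_mollifier w oO t0 (Gi i j).
have A11 : A 1 1 = A 0 0.
  rewrite /A; congr (_ * _); apply: Rintegral_ae_eq (Ai 1 1) (Ai 0 0) _ => //.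
  by apply: aeG => z x y -> _; rewrite !mxE.
have A01 : A 0 1 = - A 1 0.
  rewrite /A -mulrN; congr (_ * _); rewrite -mulN1r -(RintegralZl (-1) mO (Ai 1 0)).
  apply: Rintegral_ae_eq (Ai 0 1) (integrableZl mO (-1) (Ai 1 0)) _ => //.
  by apply: aeG => z x y -> _; rewrite !mxE/=; ring.
exists (A 0 0), (A 1 0); split.
  set a := A 0 0; set b := A 1 0; pose N := a ^+ 2 + b ^+ 2.
  (* Averages [a x + b y <= (a^2 + b^2 + x^2 + y^2) / 2 <= (N + 1) / 2], where [x + i y] is the
     gradient at a point; the resulting [N <= (N + 1) / 2] means [N <= 1]. *)
  suff : mass * N <= mass * ((N + 1) / 2) by rewrite ler_pM2l// /N; lra.
  have ai := integrableZl mO a (Ai 0 0); have bi := integrableZl mO b (Ai 1 0).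
  have -> : mass * N = \int[mu2]_(z in Omega) (a * (G z 0 0 * mollifier t w z) +
      b * (G z 1 0 * mollifier t w z)).
    rewrite (RintegralD mO ai bi) (RintegralZl a mO (Ai 0 0)) (RintegralZl b mO (Ai 1 0)).
    have e i j : \int[mu2]_(z in Omega) (G z i j * mollifier t w z) = mass * A i j.
      by rewrite /A mulVKf ?gt_eqF.
    by rewrite !e -/a -/b /N; ring.
  have oi : mu2.-integrable Omega (EFin \o (cst 1 : R * R -> R)).
    by apply: (integrable_bounded_domain oO bO (M := 1)) => // z _; rewrite normr1.
  have ki := integrable_mollifier w oO t0 oi; have ci := integrableZl mO ((N + 1) / 2) ki.
  have -> : mass * ((N + 1) / 2) = \int[mu2]_(z in Omega)
      ((N + 1) / 2 * ((cst 1 : R * R -> R) z * mollifier t w z)).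
    rewrite (RintegralZl _ mO ki) mulrC; congr (_ * _).
    rewrite -(Rintegral_mollifier oO t0 diskO).
    by apply: eq_Rintegral => z _; rewrite mul1r.
  apply: (ae_le_Rintegral mO (integrableD mO ai bi) ci).
  apply: aeG => z x y -> xy; rewrite !mxE/= mul1r !mulrA -mulrDl ler_wpM2r//.
    exact: mollifier_ge0.
  by rewrite /N; have := sqr_ge0 (a - x); have := sqr_ge0 (b - y); nra.
have [C0 C00 h0] := mean_value_taylor oO (ui 0) (Gi 0) (@conformal_radially_harmonic 0) (wG 0) t0 aw.
have [C1 C10 h1] := mean_value_taylor oO (ui 1) (Gi 1) (@conformal_radially_harmonic 1) (wG 1) t0 aw.
rewrite -/(A 0 0) -/(A 0 1) in h0; rewrite -/(A 1 0) -/(A 1 1) in h1.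
(* The first bound keeps the increment where the expansion holds; the second makes the quadratic
   remainders small against [e] times the increment. *)
move=> e e0; pose d := Num.min (Num.sqrt t) (e / (C0 + C1 + 1)).
have D0 : 0 < C0 + C1 + 1 by lra.
have d0 : 0 < d by rewrite lt_min sqrtr_gt0 t0 divr_gt0.
exists d => // h k hk; pose s := h ^+ 2 + k ^+ 2.
have s0 : 0 <= s by rewrite addr_ge0 ?sqr_ge0.
have st : s <= t.
  apply: ltW; apply: lt_le_trans hk _; rewrite -[leRHS]sqr_sqrtr ?(ltW t0)//.
  by rewrite ler_pXn2r ?nnegrE ?(ltW d0) ?sqrtr_ge0// ge_min lexx.
have se : (C0 + C1 + 1) ^+ 2 * s <= e ^+ 2.
  apply: (@le_trans _ _ ((C0 + C1 + 1) ^+ 2 * d ^+ 2)).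
    by rewrite ler_wpM2l ?sqr_ge0// ltW.
  rewrite -exprMn ler_pXn2r ?nnegrE ?mulr_ge0 ?(ltW d0) ?(ltW D0) ?(ltW e0)//.
  by rewrite mulrC -ler_pdivlMr// ge_min lexx orbT.
have := h0 h k st; have := h1 h k st; rewrite A11 A01 -/s.
rewrite /complex_defect /conformal_representative/=.
set x := _ - _ - (h * A 1 0 + _); set y := _ - _ - (h * A 0 0 + _) => hx hy.
rewrite (_ : _ - (A 0 0 * h - A 1 0 * k) = y); last by rewrite /y; ring.
rewrite (_ : _ - (A 0 0 * k + A 1 0 * h) = x); last by rewrite /x; ring.
have sq (p q : R) : `|p| <= q -> p ^+ 2 <= q ^+ 2.
  by move=> pq; rewrite -real_normK ?num_real// ler_pXn2r ?nnegrE//; apply: le_trans pq.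
apply: le_trans (lerD (sq _ _ hy) (sq _ _ hx)) _; rewrite -/s.
apply: (@le_trans _ _ ((C0 + C1 + 1) ^+ 2 * s * s)); last by rewrite ler_wpM2r.
by rewrite !exprMn -mulrDl -mulrA -expr2 ler_wpM2r ?sqr_ge0//; nra.
Qed.

End ConformalMeanValue.

Section Swap.
Context {d1 d2} {T1 : measurableType d1} {T2 : measurableType d2} {R : realType}.
Variables (m1 : {sigma_finite_measure set T1 -> \bar R}) (m2 : {sigma_finite_measure set T2 -> \bar R}).

Lemma integrable_mul_boundedT d (T : measurableType d) (m : {measure set T -> \bar R})
    (f g : T -> R) (B : R) : m.-integrable setT (EFin \o f) -> measurable_fun setT g ->
  (forall x, `|g x| <= B) -> m.-integrable setT (EFin \o (fun x => f x * g x)).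
Proof.
move=> fi mg bg; have /measurable_EFinP mf := measurable_int _ fi.
have Bi := integrableZr measurableT B fi.
apply: (le_integrable measurableT _ _ Bi).
  by apply/measurable_EFinP; exact: measurable_funM.
move=> x _ /=; rewrite lee_fin !normrM ler_wpM2l//.
exact: le_trans (bg x) (ler_norm _).
Qed.

(** Fubini for [f(x) phi(y) k(x, y)], which is integrable because [k] is bounded. The integrability
    of the inner mean comes along for later use. *)
Lemma Rintegral_swap (f : T1 -> R) (phi : T2 -> R) (k : T1 * T2 -> R) (B : R) :
  m1.-integrable setT (EFin \o f) -> m2.-integrable setT (EFin \o phi) ->
  measurable_fun setT k -> (forall x, `|k x| <= B) ->
  m1.-integrable setT (EFin \o (fun x => f x * \int[m2]_y (phi y * k (x, y)))) /\
  \int[m2]_y (phi y * \int[m1]_x (f x * k (x, y))) =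
  \int[m1]_x (f x * \int[m2]_y (phi y * k (x, y))).
Proof.
move=> fi phii mk bk.
have /measurable_EFinP mf := measurable_int _ fi.
have /measurable_EFinP mphi := measurable_int _ phii.
have mk1 y : measurable_fun setT (fun x => k (x, y)) := measurable_fun_pair1 y mk.
have mk2 x : measurable_fun setT (fun y => k (x, y)) := measurable_fun_pair2 x mk.
have i1 y := integrable_mul_boundedT fi (mk1 y) (fun x => bk (x, y)).
have i2 x := integrable_mul_boundedT phii (mk2 x) (fun y => bk (x, y)).
pose F (z : T1 * T2) : \bar R := (f z.1 * (phi z.2 * k z))%:E.
have mF : measurable_fun setT F.
  apply/measurable_EFinP; apply: measurable_funM; first exact: measurableT_comp mf _.
  by apply: measurable_funM => //; exact: measurableT_comp mphi _.
have FE2 x : (\int[m2]_y F (x, y) = (f x * \int[m2]_y (phi y * k (x, y)))%:E)%E.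
  have ii := integrableZl measurableT (f x) (i2 x).
  rewrite -(RintegralZl (f x) measurableT (i2 x)) -[LHS]fineK//.
  exact: (integrable_fin_num measurableT ii).
have FE1 y : (\int[m1]_x F (x, y) = (phi y * \int[m1]_x (f x * k (x, y)))%:E)%E.
  have ii := integrableZl measurableT (phi y) (i1 y).
  rewrite -(RintegralZl (phi y) measurableT (i1 y)).
  have -> : (\int[m1]_x F (x, y) = \int[m1]_x (phi y * (f x * k (x, y)))%:E)%E.
    by apply: eq_integral => x _; rewrite /F/= mulrCA.
  rewrite -[LHS]fineK//; exact: (integrable_fin_num measurableT ii).
have B0 (x : T1 * T2) : 0 <= B := le_trans (normr_ge0 _) (bk x).
pose N := \int[m2]_y `|phi y|.
have Fi : (m1 \x m2)%E.-integrable setT F.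
  apply/integrable12ltyP => //; pose C := `|B| * N.
  have C0 : 0 <= C by apply: mulr_ge0 => //; apply: Rintegral_ge0.
  have Ci := integrableZr measurableT C (integrable_norm fi).
  have := integrable_fin_num measurableT Ci; rewrite ge0_fin_numE; last first.
    apply: integral_ge0 => x _; rewrite lee_fin /=.
    by apply: mulr_ge0.
  apply: le_lt_trans; apply: ge0_le_integral_nonmeasurable.
    by move=> x _; exact: integral_ge0.
  move=> x _; have ni := integrable_norm (i2 x); have ki := integrableZl measurableT `|f x| ni.
  have bi := integrableZr measurableT `|B| (integrable_norm phii).
  have -> : (\int[m2]_y `|F (x, y)| = (\int[m2]_y (`|f x| * `|phi y * k (x, y)|))%:E)%E.
    transitivity (\int[m2]_y (`|f x| * `|phi y * k (x, y)|)%:E)%E.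
      by apply: eq_integral => y _; rewrite /F/= normrM.
    rewrite -[LHS]fineK//; exact: (integrable_fin_num measurableT ki).
  rewrite lee_fin (RintegralZl _ measurableT ni) /C; apply: ler_wpM2l => //.
  rewrite [leRHS]mulrC -(RintegralZr `|B| measurableT (integrable_norm phii)).
  apply: le_Rintegral => // y _; rewrite /= normrM ler_wpM2l//.
  exact: le_trans (bk _) (ler_norm _).
split.
  apply: eq_integrable (integrable_fubini_F Fi) => // x _.
  by rewrite /fubini_F FE2.
have := Fubini Fi.
under eq_integral do rewrite FE2.
under [in RHS]eq_integral do rewrite FE1.
by move=> e; rewrite /Rintegral -e.
Qed.

End Swap.

(** * The mean value coincides with the function almost everywhere *)

Section MeanValueRepresents.
Variable R : realType.
Local Notation mu2 := (lebesgue2 R).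
Local Notation mass := (mollifier_mass R).
Implicit Types (Omega K U : set (R * R)) (f phi W : R * R -> R) (z w : R * R) (t : R).

Lemma lebesgue2_sigma_finite : sigma_finite [set: plane R] mu2.
Proof.
exists (fun n => rect (- n%:R) n%:R (- n%:R) n%:R : set (plane R)).
  apply/seteqP; split => // z _; exists (Num.trunc (Num.max `|z.1| `|z.2|)).+1 => //.
  have := truncnS_gt (Num.max `|z.1| `|z.2|); rewrite gt_max => /andP[h1 h2].
  by split; rewrite -ltr_norml.
by move=> n; split; [exact: measurable_rect|exact: lebesgue2_rect_lty].
Qed.

(** The planar measure with its sigma-finiteness attached, as the exchange of two integrals over the
    plane requires. *)
Definition lebesgue2_sf : {sigma_finite_measure set (plane R) -> \bar R} :=
  HB.pack_for {sigma_finite_measure set (plane R) -> \bar R}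
    (Measure.sort mu2) (Measure.class mu2)
    (Measure_isSigmaFinite.Build _ _ _ mu2 lebesgue2_sigma_finite).

Lemma smooth_lipschitz W (C h k : R) z : smooth2 W ->
  (forall (j : 'I_2) x, `|'D_(dir R j) W x| <= C) ->
  `|W (z.1 + h, z.2 + k) - W z| <= C * (`|h| + `|k|).
Proof.
move=> sW bW; have dW j x : derivable W x (dir R j) := smooth_derivable sW.
pose y : R * R := (z.1 + h, z.2).
have t1 := bounded_derive_lipschitz z h (dW 0) (bW 0).
have t2 := bounded_derive_lipschitz y k (dW 1) (bW 1).
have yE : h *: dir R 0 + z = y.
  by rewrite -translate_dir /translate /dir/= /GRing.scale/= mulr1 mulr0 addr0.
have wE : k *: dir R 1 + y = (z.1 + h, z.2 + k).
  by rewrite -translate_dir /translate /dir/= /GRing.scale/= mulr1 mulr0 addr0.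
rewrite yE in t1; rewrite wE in t2; rewrite mulrDr [leRHS]addrC.
have -> : W (z.1 + h, z.2 + k) - W z = (W (z.1 + h, z.2 + k) - W y) + (W y - W z) by ring.
exact: le_trans (ler_normD _ _) (lerD t2 t1).
Qed.

Lemma integrable_mollifierT t w : 0 < t -> mu2.-integrable setT (EFin \o mollifier t w).
Proof.
move=> t0; have [C C0 hC] := mollifier_bounded w t0.
have [r Kr] := compact_sub_rect (@compact_disk R w (2 * t)).
apply: (integrable_bounded_support _ hC (r := r)); first exact: measurable_mollifier.
by move=> z nz; apply: mollifier_eq0 => // /Kr.
Qed.

(** With parameter [tau^2 / 2] the mollifier lives in the disk of radius [tau], where a Lipschitz
    function varies by at most [2 C tau]. *)
Lemma mollify_close phi (C tau : R) z : smooth2 phi ->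
  mu2.-integrable setT (EFin \o phi) -> (forall (j : 'I_2) x, `|'D_(dir R j) phi x| <= C) ->
  0 < tau ->
  `|\int[mu2]_w (phi w * mollifier (tau ^+ 2 / 2) z w) - mass * phi z| <= 2 * C * tau * mass.
Proof.
move=> sphi phii bphi tau0; set t := tau ^+ 2 / 2.
have t0 : 0 < t by rewrite divr_gt0// exprn_gt0.
have mi := integrable_mollifierT z t0.
have oT : open [set: R * R] by exact: openT.
have i1 := integrable_mollifier z oT t0 phii.
have i2 := integrableZl measurableT (phi z) mi.
have i3 := integrableZl measurableT (2 * C * tau) mi.
have massE (c : R) : c * mass = \int[mu2]_w (c * mollifier t z w).
  by rewrite (RintegralZl c measurableT mi) (Rintegral_mollifierT z t0).
rewrite [mass * _]mulrC !massE -(RintegralB measurableT i1 i2).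
have i4 := integrableB measurableT i1 i2.
apply: le_trans (le_normr_Rintegral measurableT i4) _.
apply: (le_Rintegral measurableT (integrable_norm i4) i3) => w _ /=.
have [wz|wz] := pselect (dist_sqr w z <= 2 * t); last first.
  by rewrite (mollifier_eq0 t0 wz) !mulr0 subrr normr0.
have k0 := mollifier_ge0 z w t0.
rewrite -mulrBl normrM (ger0_norm k0); apply: (ler_wpM2r k0).
have C0 : 0 <= C := le_trans (normr_ge0 _) (bphi 0 z).
have := smooth_lipschitz (w.1 - z.1) (w.2 - z.2) z sphi bphi.
rewrite [z.1 + _]addrC [z.2 + _]addrC !subrK -surjective_pairing => /le_trans; apply.
have -> : 2 * C * tau = C * (tau + tau) by ring.
have wz' : dist_sqr w z <= tau ^+ 2 by rewrite /t mulrC divfK in wz.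
by apply: ler_wpM2l => //; apply: lerD; apply: ler_norm_sqr; rewrite ?(ltW tau0)//;
  apply: le_trans wz'; rewrite /dist_sqr ?lerDl ?lerDr sqr_ge0.
Qed.

Lemma measurable_mollifier2 t :
  measurable_fun [set: plane R * plane R] (fun x : plane R * plane R => mollifier t x.2 x.1).
Proof.
have mk : measurable_fun [set: R] (kernel t).
  apply: continuous_measurable_fun; exact: (smooth_continuous (smooth_kernel t)).
have m11 : measurable_fun [set: plane R * plane R] (fun x : plane R * plane R => x.1.1).
  exact: measurableT_comp measurable_fst measurable_fst.
have m12 : measurable_fun [set: plane R * plane R] (fun x : plane R * plane R => x.1.2).
  exact: measurableT_comp measurable_snd measurable_fst.
have m21 : measurable_fun [set: plane R * plane R] (fun x : plane R * plane R => x.2.1).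
  exact: measurableT_comp measurable_fst measurable_snd.
have m22 : measurable_fun [set: plane R * plane R] (fun x : plane R * plane R => x.2.2).
  exact: measurableT_comp measurable_snd measurable_snd.
have md : measurable_fun [set: plane R * plane R]
    (fun x : plane R * plane R => dist_sqr (x.1 : R * R) (x.2 : R * R)).
  by apply: measurable_funD; apply: measurable_funX; exact: measurable_funB.
exact: (measurableT_comp mk md).
Qed.

Lemma mollifier_bounded2 t : 0 < t -> exists B, forall z w, `|mollifier t w z| <= B.
Proof.
move=> t0; have [B _ hB] := mollifier_bounded (0, 0) t0; exists B => z w.
have -> : mollifier t w z = mollifier t (0, 0) (z.1 - w.1, z.2 - w.2).
  by rewrite /mollifier /dist_sqr/= !subr0.
exact: hB.
Qed.

(** The mean value may be computed with any small radius. After exchanging the integrals, the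
    mollifier acts on the smooth [phi] instead of [f], at a cost of order [tau]; [M] does not depend
    on [tau]. *)
Lemma mean_value_test Omega U f phi K rho : open Omega -> mu2.-integrable Omega (EFin \o f) ->
  radially_harmonic Omega f -> 0 < rho -> U `<=` Omega -> (forall w, U w -> admissible Omega w rho) ->
  open U -> mu2.-integrable U (EFin \o mean_value Omega f) ->
  smooth2 phi -> compact K -> K `<=` U -> (forall z, ~ K z -> phi z = 0) ->
  exists M, forall tau, 0 < tau -> tau ^+ 2 / 2 <= rho ->
  `|mass * \int[mu2]_(z in U) ((mean_value Omega f z - f z) * phi z)| <= M * tau.
Proof.
move=> oO fi hf rho0 UO aU oU mvi sphi cK KU phi0.
have mO := open_measurable_plane oO; have mU := open_measurable_plane oU.
have m0 := mollifier_mass_gt0 R.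
have [N N0 hN] := smooth2_bounded sphi cK phi0.
have mphi (D : set (plane R)) : measurable_fun D phi by exact: smooth2_measurable.
have [r Kr] := compact_sub_rect cK.
have phii : mu2.-integrable setT (EFin \o phi).
  by apply: (integrable_bounded_support _ hN (r := r)) => // z nz; apply: phi0 => /Kr.
have bD : exists C, forall (j : 'I_2) z, `|'D_(dir R j) phi z| <= C.
  have d0 j z : ~ K z -> 'D_(dir R j) phi z = 0.
    by move=> nz; have [] := derive_eq0_off_compact (dir R j) cK phi0 nz.
  have [C0 C00 h0] := smooth2_bounded (smooth_derive 0 sphi) cK (d0 0).
  have [C1 C10 h1] := smooth2_bounded (smooth_derive 1 sphi) cK (d0 1).
  exists (C0 + C1) => j z; case: (ord2P j) => ->.
    by apply: le_trans (h0 z) _; rewrite lerDl.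
  by apply: le_trans (h1 z) _; rewrite lerDr.
(* Extension by 0 puts both integrals on the whole plane before they are exchanged. *)
have [C hC] := bD; pose F : R * R -> R := f \_ Omega.
have Fi : mu2.-integrable setT (EFin \o F).
  by rewrite /F -restrict_EFin -integrable_mkcond.
pose I := \int[mu2]_z `|F z|.
exists (2 * C * mass * I) => tau tau0 taut; set t := tau ^+ 2 / 2.
have t0 : 0 < t by rewrite divr_gt0// exprn_gt0.
have [B hB] := mollifier_bounded2 t0.
pose k (x : plane R * plane R) := mollifier t x.2 x.1.
have [] := @Rintegral_swap _ _ _ _ R lebesgue2_sf lebesgue2_sf F phi k B Fi phii
  (measurable_mollifier2 t) (fun x => hB x.1 x.2).
pose P z := \int[mu2]_w (phi w * mollifier t z w).
have PE z : \int[mu2]_w (phi w * k (z, w)) = P z.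
  by apply: eq_Rintegral => w _; rewrite /k/= mollifierC.
have UP (h : R * R -> R) : \int[mu2]_z (phi z * h z) = \int[mu2]_(z in U) (phi z * h z).
  rewrite [RHS]Rintegral_mkcond; apply: eq_Rintegral => z _.
  by rewrite patchE; case: ifPn => // /negP nU; rewrite phi0 ?mul0r// => /KU Uz; apply: nU; rewrite inE.
have FOE (h : R * R -> R) : \int[mu2]_z (F z * h z) = \int[mu2]_(z in Omega) (f z * h z).
  rewrite [RHS]Rintegral_mkcond; apply: eq_Rintegral => z _.
  by rewrite /F !patchE; case: ifPn => // _; rewrite mul0r.
have mvU := integrable_mul_bounded oU mvi (mphi U) (fun z _ => hN z).
have fU : mu2.-integrable U (EFin \o f) := integrableS mO mU UO fi.
have fphiU := integrable_mul_bounded oU fU (mphi U) (fun z _ => hN z).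
have e1 : \int[mu2]_w (phi w * \int[mu2]_z (F z * k (z, w))) =
    mass * \int[mu2]_(w in U) (mean_value Omega f w * phi w).
  rewrite UP -(RintegralZl mass mU mvU); apply: eq_Rintegral => w; rewrite inE => Uw.
  have aw : admissible Omega w t by apply: admissibleW (aU w Uw).
  by rewrite (mean_valueE oO fi hf aw) FOE mulrC -mulrA mulVKf ?gt_eqF.
have e2 : \int[mu2]_z (F z * (mass * phi z)) = mass * \int[mu2]_(z in U) (f z * phi z).
  rewrite -(RintegralZl mass mU fphiU) -[LHS]/(\int[mu2]_z _).
  transitivity (\int[mu2]_z (phi z * (F z * mass))); first by apply: eq_Rintegral => z _; ring.
  rewrite UP; apply: eq_Rintegral => z; rewrite inE => Uz.
  by rewrite /F patchE mem_set; [ring|exact: UO].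
have -> : (fun x : plane R => F x * \int[lebesgue2_sf]_y (phi y * k (x, y))) = (fun z => F z * P z).
  by apply/funext => z; rewrite -PE.
move=> FPi swap.
have {}swap : mass * \int[mu2]_(w in U) (mean_value Omega f w * phi w) = \int[mu2]_z (F z * P z).
  by rewrite -e1; apply: etrans swap _; apply: eq_Rintegral => z _; rewrite -PE.
have Fphi : mu2.-integrable setT (EFin \o (fun z => F z * (mass * phi z))).
  apply: (integrable_mul_boundedT (m := mu2) (B := mass * N) Fi).
    by apply: measurable_funM.
  by move=> z; rewrite normrM gtr0_norm// ler_wpM2l// ltW.
have -> : mass * \int[mu2]_(z in U) ((mean_value Omega f z - f z) * phi z) =
    \int[mu2]_z (F z * P z - F z * (mass * phi z)).
  rewrite (RintegralB measurableT FPi Fphi) e2 -swap -mulrBr -(RintegralB mU mvU fphiU).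
  by congr (_ * _); apply: eq_Rintegral => z _; rewrite mulrBl.
have di := integrableB measurableT FPi Fphi.
apply: le_trans (le_normr_Rintegral measurableT di) _.
have -> : 2 * C * mass * I * tau = 2 * C * tau * mass * I by ring.
have nFi := integrable_norm Fi.
rewrite /I -(RintegralZl (2 * C * tau * mass) measurableT nFi).
apply: (le_Rintegral measurableT (integrable_norm di) (integrableZl measurableT _ nFi)) => z _ /=.
rewrite -mulrBr normrM mulrC; apply: ler_wpM2r => //.
exact: mollify_close.
Qed.

Lemma mean_value_ae Omega f : open Omega -> bounded_set Omega ->
  mu2.-integrable Omega (EFin \o f) -> radially_harmonic Omega f ->
  (forall z, Omega z -> {for z, continuous (mean_value Omega f)}) ->
  {ae mu2, forall z, Omega z -> f z = mean_value Omega f z}.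
Proof.
move=> oO bO fi hf cmv; apply: ae_local => z0 Oz0; have mO := open_measurable_plane oO.
have [t4 at4] := admissible_exists oO Oz0; pose t0 := t4 / 4.
have t00 : 0 < t0 by rewrite divr_gt0//; case: at4.
have a4 : admissible Omega z0 (4 * t0) by rewrite /t0 mulrC divfK.
(* On this disk the radius given by [t0] is admissible at every centre. *)
pose U : set (R * R) := [set z | dist_sqr z z0 < t0].
have oU : open U.
  have c := smooth_continuous (@smooth_dist_sqr R z0).
  by have /continuousP/(_ _ (@open_lt R t0)) := c; exact.
have Uz0 : U z0 by rewrite /U /= /dist_sqr !subrr expr0n addr0.
pose K : set (R * R) := [set z | dist_sqr z z0 <= t0].
have KO : K `<=` Omega.
  by move=> z /= zt; case: a4 => _; apply; apply: le_trans zt _; lra.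
have UO : U `<=` Omega by move=> z /ltW /KO.
have aU w : U w -> admissible Omega w t0 by move=> /ltW; exact: admissible_near.
have bU : bounded_set U.
  have [M [Mr hM]] := bO; exists M; split => // x Mx z /UO; exact: hM.
have [B _ hB] := bounded_on_compact (@compact_disk R z0 t0) (fun z Kz => cmv z (KO z Kz)).
have mvi : mu2.-integrable U (EFin \o mean_value Omega f).
  apply: (integrable_bounded_domain oU bU (M := B)).
    by apply: continuous_measurable_plane => // z /UO; exact: cmv.
  by move=> z /ltW; exact: hB.
exists U => //; have mU := open_measurable_plane oU.
have fU : mu2.-integrable U (EFin \o f) := integrableS mO mU UO fi.
have : {ae mu2, forall z, U z -> mean_value Omega f z - f z = 0}.
  apply: (fundamental_lemma oU (integrableB mU mvi fU)) => phi L sphi cL LU phi0.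
  have [M hM] := mean_value_test oO fi hf t00 UO aU oU mvi sphi cL LU phi0.
  set D := \int[mu2]_(z in U) _ in hM *.
  have m0 := mollifier_mass_gt0 R.
  suff : `|mass * D| <= 0.
    by rewrite normr_le0 mulf_eq0 gt_eqF//= => /eqP.
  (* With [tau <= x] the bound [M tau] is at most half of [|mass * D|], which forces the latter to
     vanish. *)
  rewrite leNgt; apply/negP => d0; pose x := `|mass * D| / (2 * (`|M| + 1)).
  have M1 : 0 < `|M| + 1 by rewrite ltr_wpDl.
  have x0 : 0 < x by rewrite divr_gt0// mulr_gt0.
  pose tau := Num.min (Num.min 1 t0) x.
  have tau0 : 0 < tau by rewrite !lt_min ltr01 t00 x0.
  have : tau <= 1 /\ tau <= t0 /\ tau <= x.
    by rewrite /tau !ge_min !lexx ?orbT.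
  move=> [tau1 [taut taux]].
  have tt : tau ^+ 2 / 2 <= t0 by nra.
  have := hM tau tau0 tt.
  have : M * tau <= (`|M| + 1) * x.
    apply: (@le_trans _ _ ((`|M| + 1) * tau)); last by rewrite ler_wpM2l// ltW.
    by rewrite ler_wpM2r ?(ltW tau0)//; have := ler_norm M; lra.
  have -> : (`|M| + 1) * x = `|mass * D| / 2.
    by rewrite /x; field; rewrite gt_eqF.
  by move: (`|mass * D|) d0 => q; lra.
apply: negligibleS => z nz hz; apply: nz => /hz /eqP.
by rewrite subr_eq0 => /eqP.
Qed.

End MeanValueRepresents.

(** * Zero energy deformations *)

Theorem theorem2p9 (R : realType) (M : metamaterial R)
    (hM : M = kagome R \/ M = rotating_squares R) :
  exists eta0 : R, 0 < eta0 /\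
    forall eta : R, 0 < eta < eta0 ->
    forall (Omega : set (R * R)) (u : R * R -> R * R),
      bounded_lipschitz_domain Omega -> H1 Omega u ->
      Eeff M eta Omega u = 0%E <->
      exists v : R * R -> R * R,
        compressive_conformal Omega v /\
        {ae @lebesgue2 R, forall x, Omega x -> u x = v x}.
Proof.
exists 8^-1; split; first by rewrite invr_gt0.
move=> eta heta Omega u [_ oO _ bO _] h1; split; last first.
  by move=> [v [cc uv]]; exact: (conformal_Eeff_eq0 hM heta oO bO h1 cc uv).
move=> /(Eeff_eq0_conf_gap hM heta oO h1) gap0.
have ui i : (lebesgue2 R).-integrable Omega (EFin \o (Defs.coord i \o u)).
  by have [Lu _] := h1 i; exact: L2_integrable.
have Gi i j : (lebesgue2 R).-integrable Omega (EFin \o (fun z => weak_grad Omega u z i j)).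
  by have [Lg _] := weak_grad_L2 i j h1; exact: L2_integrable.
have wG i j := weak_partial_smoothP (weak_grad_L2 i j h1).
have diff z (Oz : Omega z) := conformal_representative_diff oO bO ui Gi wG gap0 Oz.
have cmv i z : Omega z -> {for z, continuous (mean_value Omega (Defs.coord i \o u))}.
  move=> Oz; have [a [b [_ cd]]] := diff z Oz; have := complex_diff_continuous (i := i) cd.
  by case: (ord2P i) => ->.
have rh i := @conformal_radially_harmonic _ _ _ _ oO bO ui Gi wG gap0 i.
have ae i := mean_value_ae oO bO (ui i) (rh i) (cmv i).
exists (conformal_representative Omega u); split; first exact/compressive_conformalP.
have := negligibleU (ae 0) (ae 1); apply: negligibleS => z /= /not_implyP[Oz nz].
apply: contrapT => /not_orP[/contrapT e0 /contrapT e1]; apply: nz.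
by rewrite /conformal_representative -(e0 Oz) -(e1 Oz) [LHS]surjective_pairing.
Qed.
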